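(* Let $n\in\mathbb{N}$, $0\le p\le n$, and $k\in\mathbb{N}_0$. With $\alpha_k:=\frac n2-p+k$ and $\beta_k:=\frac n2-p-k$, the residue at $\lambda=-n-2k$ of the $\mathrm{End}(\Lambda^p(\mathbb{R}^n)^* )$-valued distribution $R^\lambda_{1,-1}(x)=r^{\lambda-2}(x)(i_x\varepsilon_x-\varepsilon_xi_x)$ on $\mathbb{R}^n$ is $$\operatorname{Res}_{\lambda=-n-2k}\big(R^\lambda_{1,-1}(x)\big)=\frac{(-1)^k\,2\pi^{\frac n2}}{4^k\,k!\,\Gamma(\frac n2+k+1)}\,\big[\alpha_k(\delta d)^k+\beta_k(d\delta)^k\big]\delta_0(x),$$ that is, up to a constant, the Branson-Gover operator $L^{(p)}_{2k}=\alpha_k(\delta d)^k+\beta_k(d\delta)^k$ applied to the Dirac distribution; for $k=0$ the bracket is understood as $L_0^{(p)}:=\alpha_0\operatorname{Id}$.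
   Context: On $\mathbb{R}^n$ with standard orthonormal basis $e_1,\dots,e_n$ (vectors and covectors identified via the Euclidean scalar product), for $x\in\mathbb{R}^n$ and a $p$-form $\omega$ put $i_x\omega:=\sum_k x_k\, i_{e_k}\omega$ and $\varepsilon_x\omega:=\sum_k x_k\, e_k\wedge\omega$; $r(x)=(x_1^2+\cdots+x_n^2)^{1/2}$. The operator $d$ is the exterior differential and $\delta$ its formal $L^2$-adjoint, so $\delta d+d\delta=-\sum_k\partial_k^2$. $R^\lambda_{1,-1}$ is defined as a locally integrable tempered distribution for $\Re(\lambda)>-n$ and extended meromorphically to $\lambda\in\mathbb{C}$ with at most simple poles, in $-n-2\mathbb{N}_0$. $\delta_0$ is the Dirac distribution at the origin (times the identity of $\Lambda^p(\mathbb{R}^n)^*$). A differential operator $D$ on $p$-forms acts on an $\mathrm{End}(\Lambda^p(\mathbb{R}^n)^* )$-valued distribution $R$ by $(DR)\beta:=D(R\beta)$ for constant $p$-forms $\beta$. *)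

(* Defs.v *)
From HB Require Import structures.
From mathcomp Require Import all_boot all_order all_algebra.
From mathcomp Require Import all_classical all_reals all_analysis.
From mathcomp Require Import complex.

Set Implicit Arguments.
Unset Strict Implicit.
Unset Printing Implicit Defensive.
Import Order.TTheory GRing.Theory Num.Theory.
Import numFieldNormedType.Exports.

Local Open Scope classical_set_scope.
Local Open Scope ring_scope.
Local Open Scope complex_scope.

Lemma product_sigma_finite d1 d2 (T1 : measurableType d1)
    (T2 : measurableType d2) (R : realType)
    (m1 : {sigma_finite_measure set T1 -> \bar R})
    (m2 : {sigma_finite_measure set T2 -> \bar R}) :
  sigma_finite [set: _] (m1 \x m2)%E.
Proof.
have /sigma_finiteP[F [TF ndF Foo]] := sigma_finiteT m1.
have /sigma_finiteP[G [TG ndG Goo]] := sigma_finiteT m2.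
exists (fun k => F k `*` G k).
  rewrite -setXTT TF TG predeqE => -[x y]; split.
    move=> [/= [i _ Fix] [j _ Gjy]]; exists (maxn i j) => //; split.
    - by move: x Fix; exact/subsetPset/ndF/leq_maxl.
    - by move: y Gjy; exact/subsetPset/ndG/leq_maxr.
  by move=> [i _ []/= ? ?]; split; exists i.
move=> k; have [? ?] := Foo k; have [? ?] := Goo k.
split; first exact: measurableX.
by rewrite product_measure1E// lte_mul_pinfty// ge0_fin_numE.
Qed.

(* The library has no Lebesgue measure on [R^n]; it is built below as the n-fold
   product of [lebesgue_measure], on [n.-tuple R] with its product
   sigma-algebra. *)
Section cons_measure.
Context {d : measure_display} {T : measurableType d} {R : realType}.

Definition cons_pair n (xt : T * n.-tuple T) : n.+1.-tuple T :=
  [the n.+1.-tuple T of xt.1 :: xt.2].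

Definition uncons_pair n (t : n.+1.-tuple T) : T * n.-tuple T :=
  (thead t, [tuple of behead t]).

Lemma cons_pairK n : cancel (@cons_pair n) (@uncons_pair n).
Proof.
move=> [x t]; rewrite /uncons_pair /cons_pair; congr pair => /=.
by apply: val_inj.
Qed.

Lemma measurable_cons_pair n : measurable_fun [set: _] (@cons_pair n).
Proof. by apply: measurable_cons; [exact: measurable_fst | exact: measurable_snd]. Qed.

Lemma measurable_uncons_pair n : measurable_fun [set: _] (@uncons_pair n).
Proof.
apply/measurable_fun_pairP; split => /=.
  exact: measurable_tnth.
exact: measurable_behead.
Qed.

Variables (n : nat) (m1 : {sigma_finite_measure set T -> \bar R})
  (m2 : {sigma_finite_measure set (n.-tuple T) -> \bar R}).

Definition cons_measure : set (n.+1.-tuple T) -> \bar R :=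
  pushforward (m1 \x m2)%E (@cons_pair n).

Let preim (A : set (n.+1.-tuple T)) :
  measurable A -> measurable (@cons_pair n @^-1` A).
Proof.
by move=> mA; rewrite -[X in measurable X]setTI; exact: measurable_cons_pair.
Qed.

Let cons_measure0 : cons_measure set0 = 0%E.
Proof. by rewrite /cons_measure /pushforward preimage_set0 measure0. Qed.

Let cons_measure_ge0 A : (0 <= cons_measure A)%E.
Proof. by rewrite /cons_measure /pushforward measure_ge0. Qed.

Let cons_measure_sigma_additive : semi_sigma_additive cons_measure.
Proof.
move=> F mF tF mUF; rewrite /cons_measure /pushforward preimage_bigcup.
apply: measure_semi_sigma_additive.
- by move=> i; exact: preim.
- apply/trivIsetP => /= i j _ _ ij; rewrite -preimage_setI.
  by move/trivIsetP : tF => /(_ _ _ _ _ ij) ->//; rewrite preimage_set0.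
- by rewrite -preimage_bigcup; exact: preim.
Qed.

HB.instance Definition _ := isMeasure.Build _ _ _ cons_measure
  cons_measure0 cons_measure_ge0 cons_measure_sigma_additive.

Let cons_measure_sigma_finite : sigma_finite [set: _] cons_measure.
Proof.
have [F FT mF] : sigma_finite [set: _] (m1 \x m2)%E by exact: product_sigma_finite.
exists (fun k => @uncons_pair n @^-1` F k).
  by rewrite -preimage_bigcup -FT preimage_setT.
move=> k; have [mFk Fk] := mF k; split.
  by rewrite -[X in measurable X]setTI; exact: measurable_uncons_pair.
rewrite /cons_measure /pushforward -comp_preimage.
rewrite (_ : _ \o _ = id) ?preimage_id//.
by apply/funext => x /=; rewrite cons_pairK.
Qed.

HB.instance Definition _ := Measure_isSigmaFinite.Build _ _ _
  cons_measure cons_measure_sigma_finite.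

End cons_measure.

Fixpoint lebesgue_tuple (R : realType) (n : nat) :
    {sigma_finite_measure set (n.-tuple (measurableTypeR R)) -> \bar R} :=
  match n with
  | 0%N => \d_([tuple] : 0.-tuple (measurableTypeR R))
  | n'.+1 => cons_measure (@lebesgue_measure R) (lebesgue_tuple R n')
  end.

(* The complexified exterior algebra of [R^n]: [w J] is the coefficient of [w] on [e_{s_1} /\ ... /\ e_{s_p}], where
    [J = {s_1 < ... < s_p}]. *)

Definition ext (R : realType) (n : nat) := {ffun {set 'I_n} -> R[i]^o}.
HB.instance Definition _ (R : realType) (n : nat) :=
  Vector.copy (ext R n) {ffun {set 'I_n} -> R[i]^o}.

Section forms.
Context {R : realType} {n : nat}.
Implicit Types (w : ext R n) (J : {set 'I_n}) (x : 'rV[R]_n).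

Definition e_ J : ext R n := [ffun J' => (J' == J)%:R].

Definition pforms (p : nat) : {vspace ext R n} :=
  <<[seq e_ J | J <- enum [set J : {set 'I_n} | #|J| == p]]>>%VS.

(* the sign of moving the factor [e_k] to the front of a monomial on [J] *)
Definition front_sign (k : 'I_n) J : R[i] :=
  (-1) ^+ #|[set j in J | (j < k)%N]|.

(* [e_k /\ w], since [e_k /\ e_(J :\ k) = front_sign k J *: e_J] for [k] in [J] *)
Definition wedge (k : 'I_n) w : ext R n :=
  [ffun J : {set 'I_n} => if k \in J then front_sign k J * w (J :\ k) else 0].

(* [i_{e_k} w] *)
Definition contr (k : 'I_n) w : ext R n :=
  [ffun J : {set 'I_n} => if k \in J then 0 else front_sign k J * w (k |: J)].

Lemma contr_adjoint k (w w' : ext R n) :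
  \sum_J wedge k w J * w' J = \sum_J w J * contr k w' J.
Proof.
rewrite (bigID (fun J : {set 'I_n} => k \in J)) /= [X in _ + X]big1 ?addr0; last first.
  by move=> J kJ; rewrite ffunE (negPf kJ); exact: mul0r.
rewrite [RHS](bigID (fun J : {set 'I_n} => k \in J)) /= [X in _ = X + _]big1 ?add0r; last first.
  by move=> J kJ; rewrite ffunE kJ; exact: mulr0.
rewrite [RHS](reindex_onto (fun J => J :\ k) (fun J => k |: J)) /=; last first.
  by move=> J kJ; rewrite setU1K.
apply: eq_big => [J|J kJ].
  rewrite !inE eqxx /=; apply/idP/eqP => [kJ|<-]; first by rewrite finset.setD1K.
  by rewrite !inE eqxx.
rewrite !ffunE kJ !inE eqxx /= finset.setD1K// mulrCA mulrA; congr (_ * _ * _).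
rewrite /front_sign; congr ((-1) ^+ #|pred_of_set _|).
apply/setP => j; rewrite !inE; case: (j =P k) => [->|//] /=.
by rewrite ltnn andbF.
Qed.

Definition wedgex x w : ext R n := \sum_k (x ord0 k)%:C *: wedge k w.
Definition contrx x w : ext R n := \sum_k (x ord0 k)%:C *: contr k w.

End forms.

Definition cfun (R : realType) (n : nat) := 'rV[R]_n -> R[i].

Section functions.
Context {R : realType} {n : nat}.
Implicit Types (f : cfun R n) (x : 'rV[R]_n).

Definition reP f x : R := complex.Re (f x).
Definition imP f x : R := complex.Im (f x).

(* the Euclidean norm; the library's norm [`|x|] on ['rV_n] is the sup norm *)
Definition rnorm x : R := Num.sqrt (\sum_k x ord0 k ^+ 2).

Definition partial (k : 'I_n) f : cfun R n :=
  fun x => 'D_(delta_mx ord0 k) (reP f) x +i* 'D_(delta_mx ord0 k) (imP f) x.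

Definition partials (s : seq 'I_n) f : cfun R n := foldr partial f s.

(* all iterated partial derivatives exist and are continuous *)
Definition smooth f := forall s : seq 'I_n,
  [/\ continuous (reP (partials s f)), continuous (imP (partials s f)) &
    forall k x, derivable (reP (partials s f)) x (delta_mx ord0 k) /\
                derivable (imP (partials s f)) x (delta_mx ord0 k)].

Definition seminorm_set (N : nat) f : set R :=
  [set y | exists s x, (size s <= N)%N /\
     y = (1 + rnorm x) ^+ N * Normc.normc (partials s f x)].

Definition seminorm N f : R := sup (seminorm_set N f).

Definition schwartz f := smooth f /\ forall N, has_ubound (seminorm_set N f).

Definition integral_Rn f : R[i] :=
  let mu := lebesgue_tuple R n in
  let pt (t : n.-tuple R) : 'rV[R]_n := \row_i tnth t i in
  (\int[mu]_t reP f (pt t)) +i* (\int[mu]_t imP f (pt t)).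

End functions.

(* Distributions are functions on all of [cfun R n], but only their values on
   Schwartz functions are meaningful. *)

Definition pform (R : realType) (n p : nat) := subvs_of (@pforms R n p).

Definition end_distr (R : realType) (n p : nat) :=
  cfun R n -> 'End(pform R n p).

Definition form_distr (R : realType) (n : nat) := cfun R n -> ext R n.

Definition alpha (R : realType) (n p k : nat) : R := n%:R / 2 - p%:R + k%:R.
Definition beta (R : realType) (n p k : nat) : R := n%:R / 2 - p%:R - k%:R.

Section distributions.
Context {R : realType} {n : nat}.
Implicit Types (T : form_distr R n).

Definition tempered p (F : end_distr R n p) :=
  (forall (a : R[i]) f g, schwartz f -> schwartz g ->
     F (fun x => a * f x + g x) = a *: F f + F g) /\
  (forall (b : pform R n p) (J : {set 'I_n}), exists (N : nat) (M : R),
     forall f, schwartz f ->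
       Normc.normc (vsval (F f b) J) <= M * seminorm N f).

Definition apply_distr p (F : end_distr R n p) (b : pform R n p) :
  form_distr R n := fun f => vsval (F f b).

Definition dpartial (k : 'I_n) T : form_distr R n :=
  fun f => - T (partial k f).

Definition extd T : form_distr R n :=
  fun f => \sum_k wedge k (dpartial k T f).

(* the formal adjoint of [extd]: by [contr_adjoint] the adjoint of
   [e_k /\ _] is [i_{e_k}], and that of [d/dx_k] is [- d/dx_k] *)
Definition codiff T : form_distr R n :=
  fun f => - \sum_k contr k (dpartial k T f).

Definition dirac_form p (b : pform R n p) : form_distr R n :=
  fun f => f 0 *: vsval b.

(* for [k = 0] the general formula would give [2 * alpha_0] *)
Definition branson_gover (p k : nat) T : form_distr R n :=
  fun f => if k is 0%N then (alpha R n p 0)%:C *: T f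
           else (alpha R n p k)%:C *: iter k (codiff \o extd) T f +
                (beta R n p k)%:C *: iter k (extd \o codiff) T f.

End distributions.

Section laurent.
Context {R : realType}.
Local Notation C := (R[i]).

Definition holomorphic_at (f : C -> C) (c : C) :=
  exists (a : nat -> C) (e : C), 0 < e /\ forall z : C, `|z - c| < e ->
    (series (fun m => a m * (z - c) ^+ m) : nat -> C^o) @ \oo --> (f z : C^o).

(* [f z = \sum_m a_m (z - c)^(m - N)] on a punctured disc *)
Definition laurent_at (f : C -> C) (c : C) (N : nat) (a : nat -> C) :=
  exists e : C, 0 < e /\ forall z : C, 0 < `|z - c| < e ->
    (series (fun m => a m * (z - c) ^+ m) : nat -> C^o) @ \oo -->
      ((z - c) ^+ N * f z : C^o).

Definition pole_order_le (N : nat) (f : C -> C) (c : C) :=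
  exists a, laurent_at f c N a.

(* the coefficient of [(z - c)^-1] in the Laurent expansion *)
Definition is_residue (f : C -> C) (c v : C) :=
  exists N a, laurent_at f c N.+1 a /\ a N = v.

End laurent.

Definition pole_point (R : realType) (n k : nat) : R[i] := - (n%:R + 2 * k%:R).

Section Rlambda.
Context {R : realType} {n : nat}.
Implicit Types (x : 'rV[R]_n) (l : R[i]).

(* [r^l = r^(Re l) * exp (i * Im l * ln r)], for [r > 0] *)
Definition cpower (r : R) l : R[i] :=
  (r `^ complex.Re l)%:C *
    (cos (complex.Im l * ln r) +i* sin (complex.Im l * ln r)).

Definition Rkernel l x (w : ext R n) : ext R n :=
  cpower (rnorm x) (l - 2) *:
    (contrx x (wedgex x w) - wedgex x (contrx x w)).

(* [F] is the meromorphic continuation in [l] of the locally integrable kernel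
   [Rkernel l] on [Re l > - n]; the values of [F] at the poles are
   unconstrained. *)
Definition Rlambda_extension p (F : R[i] -> end_distr R n p) :=
  [/\ forall l, (forall k, l <> pole_point R n k) -> tempered (F l),
      forall l f (b : pform R n p) (J : {set 'I_n}),
        - n%:R < complex.Re l -> schwartz f ->
        apply_distr (F l) b f J =
          integral_Rn (fun x => f x * Rkernel l x (vsval b) J) &
      forall f (b : pform R n p) (J : {set 'I_n}), schwartz f ->
        (forall l, (forall k, l <> pole_point R n k) ->
           holomorphic_at (fun l => apply_distr (F l) b f J) l) /\
        (forall k, pole_order_le 1
           (fun l => apply_distr (F l) b f J) (pole_point R n k))].

End Rlambda.

Definition Gamma (R : realType) (s : R) : R :=
  \int[@lebesgue_measure R]_(t in `]0, +oo[) (t `^ (s - 1) * expR (- t)).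

(* Main.v *)
(* For real l > 4, writing x_i r^(l-2) = (1/l) d_i r^l and integrating by parts
   turns l <R^l, f> into l <r^l, U> + <r^l, V>, where U = b f and V combines f and
   the x_j d_i f. Green's formula <r^(l+2), Lap u> = (l+2)(l+n) <r^l, u>, iterated k
   times, shifts l to l+2k, where the right-hand side is analytic for l > -n-2k.
   Since the continuation is meromorphic, the identity persists down to
   l = -n-2k, where (l+2k+n) <r^(l+2k), g> tends to area(S^(n-1)) g(0); this limit
   is computed for Gaussians through the Gamma function, and functions vanishing
   at 0 do not contribute. The residue is therefore a combination of Lap^k f(0)
   and second derivatives of Lap^(k-1) f at 0. These also compute
   alpha_k (delta d)^k + beta_k (d delta)^k on a Dirac form, because
   d d = delta delta = 0 and delta d + d delta = - Lap. Only real l are used: the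
   residue is read off the real and imaginary parts of the continuation on the
   real line. *)

Require Import Defs.
From HB Require Import structures.
From mathcomp Require Import all_boot all_order all_algebra.
From mathcomp Require Import all_classical all_reals all_analysis.
From mathcomp Require Import measurable_realfun complex.
From mathcomp Require Import ring lra.

Set Implicit Arguments.
Unset Strict Implicit.
Unset Printing Implicit Defensive.
Import Order.TTheory GRing.Theory Num.Theory.
Import numFieldNormedType.Exports.

Local Open Scope classical_set_scope.
Local Open Scope ring_scope.

(** * Integrals on the line and the Gamma function *)

(** The continuation is accessible only through its integral on Re l > -n and through local
    expansions. To the right of -n-2k it may have further poles, where its values are arbitrary.
    Meromorphy on the real line is therefore phrased on punctured intervals, and the functional
    equation travels left by a supremum argument that tolerates arbitrary values at single points.
    The equation is kept free of denominators: the factor l and the product of Green's factors stay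
    in place until l = -n-2k, where neither vanishes because n > 0, and only there are they
    cancelled. The region l > 4 is chosen for regularity: there r^(l-2), hence every partial
    derivative of r^l, is continuous at the origin. No polar coordinates are used. Against a
    Gaussian, r^(-2s) is written as |x|^2 times a Gamma integral in an auxiliary variable.
    Exchanging the integrals leaves a Gaussian second moment and the Beta integral B(s+1, n/2-s),
    whose pole 1/(n/2-s) is the whole residue. *)

Lemma integral_exhaust_cvg d (T : measurableType d) (R : realType)
    (mu : {measure set T -> \bar R}) (D : set T) (A : (set T)^nat)
    (f : T -> R) :
  measurable D -> (forall n, measurable (A n)) -> (forall n, A n `<=` D) ->
  (forall x, D x -> \forall n \near \oo, A n x) ->
  mu.-integrable D (EFin \o f) ->
  (\int[mu]_(x in A n) (f x)%:E)%E @[n --> \oo] --> (\int[mu]_(x in D) (f x)%:E)%E.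
Proof.
move=> mD mA AD DA intf.
have /measurable_EFinP mf := measurable_int _ intf.
have mfn n : measurable_fun D (EFin \o (f \_ (A n))).
  apply/measurable_EFinP/(measurable_restrict _ (mA n) mD).
  by rewrite setIidr//; exact: (measurable_funS mD (AD n) mf).
have [| | | |_ _] := @dominated_convergence _ _ _ mu D mD
  (fun n => EFin \o (f \_ (A n))) (EFin \o f) (abse \o (EFin \o f)) mfn.
- exact/measurable_EFinP.
- apply: aeW => x Dx; apply: cvg_near_cst.
  near=> n; rewrite /= patchE mem_set//.
  by near: n; exact: DA.
- exact: integrable_abse.
- apply: aeW => x n Dx; rewrite /= patchE; case: ifP => //= _.
  by rewrite normr0 lee_fin.
set u := (X in X @ \oo --> _) => uf; set v := (X in X @ \oo --> _).
suff -> : v = u by [].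
apply/funext => n; rewrite /u /v /=.
rewrite [LHS]integral_mkcond [RHS]integral_mkcond.
apply: eq_integral => x _; rewrite /= !patchE.
case: (boolP (x \in A n)) => [/set_mem/AD xD|_]; first by rewrite mem_set.
by case: ifP.
Unshelve. all: by end_near. Qed.

Section real_integrals.
Context {R : realType}.
Local Notation mu := (@lebesgue_measure R).

(** The integrand may change sign, so the improper fundamental theorem for nonnegative functions
    does not apply. The intervals [[0, n.+1]] exhaust the half-line; they end at [n.+1] because the
    compact version needs a nondegenerate interval. *)
Lemma integral0y_derive (F f : R -> R) (l : R) :
  (forall x : R, 0 < x -> is_derive x 1 F (f x)) ->
  F x @[x --> 0^'+] --> F 0 ->
  {within `[0%R : R, +oo[, continuous f} ->
  mu.-integrable `[0%R : R, +oo[%classic (EFin \o f) ->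
  F x @[x --> +oo] --> l ->
  (\int[mu]_(x in `[0%R, +oo[) (f x)%:E)%E = (l - F 0)%:E.
Proof.
move=> dF F0 cf intf Fl.
have cF x : 0 < x -> {for x, continuous F}.
  move=> x0; apply: differentiable_continuous; apply/derivable1_diffP.
  by apply: ex_derive; exact: dF.
have H : (\int[mu]_(x in `[0%R, n.+1%:R]) (f x)%:E)%E @[n --> \oo] -->
    (\int[mu]_(x in `[0%R, +oo[) (f x)%:E)%E.
  apply: (@integral_exhaust_cvg _ _ R mu `[0%R : R, +oo[%classic (fun n => `[0%R : R, n.+1%:R]%classic) f) => //.
    by move=> n x; rewrite /= !in_itv/= andbT => /andP[].
  move=> x; rewrite /= in_itv/= andbT => x0.
  near=> n; rewrite /= in_itv/= x0/=.
  rewrite (@le_trans _ _ n%:R)//; last by rewrite ler_nat.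
  by near: n; exact: nbhs_infty_ger.
apply/esym; apply: (cvg_unique _ _ H) => //.
have -> : (fun n : nat => \int[mu]_(x in `[0%R, n.+1%:R]) (f x)%:E)%E =
          (fun n : nat => (F n.+1%:R - F 0)%:E).
  apply/funext => n; rewrite (@continuous_FTC2 _ f F)//.
  - apply: continuous_subspaceW cf.
    by move=> x; rewrite /= !in_itv/= andbT => /andP[].
  - split => //.
    + by move=> x; rewrite in_itv/= => /andP[x0 _]; apply: ex_derive; exact: dF.
    + by apply: cvg_at_left_filter; apply: cF.
  - move=> x; rewrite in_itv/= => /andP[x0 _].
    by rewrite derive1E; exact/derive_val/dF.
apply: cvg_EFin; first by near=> n.
apply: cvgB; last exact: cvg_cst.
have /cvg_pinftyP := Fl; apply.
apply/cvgryPge => A; near=> n.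
apply: (@le_trans _ _ n%:R); last by rewrite ler_nat.
by near: n; exact: nbhs_infty_ger.
Unshelve. all: by end_near. Qed.

Lemma integralT_derive0 (F f : R -> R) :
  (forall x : R, is_derive x 1 F (f x)) -> continuous f ->
  mu.-integrable setT (EFin \o f) ->
  F x @[x --> +oo] --> 0 -> F x @[x --> -oo] --> 0 ->
  (\int[mu]_x (f x)%:E)%E = 0%E.
Proof.
move=> dF cf intf Fy FNy.
have cF : continuous F.
  move=> x; apply: differentiable_continuous; apply/derivable1_diffP.
  by apply: ex_derive; exact: dF.
have H : (\int[mu]_(x in `[(- n.+1%:R)%R, n.+1%:R%R]) (f x)%:E)%E @[n --> \oo] -->
    (\int[mu]_x (f x)%:E)%E.
  apply: (@integral_exhaust_cvg _ _ R mu setT (fun n => `[- n.+1%:R : R, n.+1%:R]%classic) f) => //.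
  move=> x _.
  near=> n; rewrite /= in_itv/= -ler_norml.
  rewrite (@le_trans _ _ n%:R)//; last by rewrite ler_nat.
  by near: n; exact: nbhs_infty_ger.
apply/esym; apply: (cvg_unique _ _ H) => //.
have -> : (fun n : nat => \int[mu]_(x in `[(- n.+1%:R)%R, n.+1%:R%R]) (f x)%:E)%E =
          (fun n : nat => (F n.+1%:R - F (- n.+1%:R))%:E).
  apply/funext => n; rewrite (@continuous_FTC2 _ f F)//.
  - by rewrite gtrN.
  - exact: continuous_subspaceT.
  - split => //.
    + by apply: cvg_at_right_filter; apply: cF.
    + by apply: cvg_at_left_filter; apply: cF.
  - by move=> x _; rewrite derive1E; have [_ ->] := dF x.
apply: cvg_EFin; first by near=> n.
have ny : (n.+1%:R : R) @[n --> \oo] --> +oo%R.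
  apply/cvgryPge => A; near=> n.
  apply: (@le_trans _ _ n%:R); last by rewrite ler_nat.
  by near: n; exact: nbhs_infty_ger.
rewrite -[X in _ --> X]subr0; apply: cvgB.
  by move/cvg_pinftyP : Fy; apply.
move/cvg_ninftyP : FNy; apply.
exact/cvgNrNy.
Unshelve. all: by end_near. Qed.

Lemma integral_gauss_scaled (a : R) : 0 < a ->
  (\int[mu]_x (expR (- (a * x ^+ 2)))%:E)%E = (Num.sqrt (pi / a))%:E.
Proof.
move=> a0; have sa0 : 0 < Num.sqrt a by rewrite sqrtr_gt0.
pose F (x : R) : R := Num.sqrt a * x.
have dF (x : R) : is_derive x (1 : R) F (Num.sqrt a).
  have -> : F = Num.sqrt a \*: (@id R) by [].
  by apply: is_derive_eq; rewrite /= /GRing.scale /= mulr1.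
have F'E : derive1 F = cst (Num.sqrt a).
  by apply/funext => x; rewrite derive1E; have [_ ->] := dF x.
have mg : measurable_fun [set: R] (fun x : R => expR (- (a * x ^+ 2))).
  apply: continuous_measurable_fun => x.
  apply: continuous_comp; last exact: continuous_expR.
  apply: continuousN; apply: continuousM; first exact: cst_continuous.
  exact: exprn_continuous.
have := @integralT_gauss R.
rewrite (@increasing_ge0_integration_by_substitutionT _ F).
- move=> H.
  have {}H : (\int[mu]_x ((Num.sqrt a)%:E * (expR (- (a * x ^+ 2)))%:E))%E =
      (Num.sqrt pi)%:E.
    rewrite -H; apply: eq_integral => x _; rewrite F'E -EFinM; congr EFin.
    rewrite mulrC; congr (_ * _).
    by rewrite /gauss_fun /F /= exprMn sqr_sqrtr ?(ltW a0).
  move: H; rewrite ge0_integralZl//; last first.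
    exact/measurable_EFinP.
  move=> H.
  rewrite sqrtrM ?pi_ge0// sqrtrV ?ltW// mulrC EFinM -H muleA -EFinM.
  by rewrite mulVf ?gt_eqF// mul1e.
- by move=> x y xy; rewrite /F ltr_pM2l.
- by rewrite F'E => x; exact: cst_continuous.
- by rewrite F'E; exact: is_cvg_cst.
- by rewrite F'E; exact: is_cvg_cst.
- by move=> x; apply: ex_derive; exact: dF.
- by apply: gt0_cvgMrNy => //; exact: cvg_id.
- by apply: gt0_cvgMry => //; exact: cvg_id.
- exact: continuous_gauss_fun.
- by move=> x; exact: gauss_fun_ge0.
Qed.

Lemma cvg_onep_powRN (a : R) : 0 < a -> (1 + t) `^ (- a) @[t --> +oo] --> 0.
Proof.
move=> a0; apply/cvgrPdist_le => e e0; near=> t.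
have t0 : 0 < 1 + t.
  by rewrite ltr_wpDr//; near: t; apply: nbhs_pinfty_ge; exact: num_real.
rewrite sub0r normrN ger0_norm ?powR_ge0// /powR gt_eqF//.
rewrite -[leRHS]lnK ?posrE// ler_expR mulNr lerNl -ler_pdivrMl//.
rewrite -[leLHS]expRK ler_ln ?posrE ?expR_gt0//.
apply: (@le_trans _ _ t); last by rewrite lerDr.
near: t; apply: nbhs_pinfty_ge; exact: num_real.
Unshelve. all: by end_near. Qed.

Lemma is_derive_onep_powR (a t : R) : 0 < 1 + t ->
  is_derive t 1 (fun t => (1 + t) `^ a) (a * (1 + t) `^ (a - 1)).
Proof.
move=> t0.
have dg : is_derive t (1 : R) (cst 1 + id : R -> R) 1.
  by apply: is_derive_eq; rewrite add0r.
have := is_derive1_comp (f := @powR R ^~ a) (is_derive1_powR a t0) dg.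
by rewrite mulr1.
Qed.

Lemma integral0y_onep_powR (a : R) : 0 < a ->
  (\int[mu]_(t in `[0%R, +oo[) ((1 + t) `^ (- a - 1))%:E)%E = (a^-1)%:E.
Proof.
move=> a0.
pose F (t : R) : R := - a^-1 * (1 + t) `^ (- a).
have p1 (x : R) : -1 < x -> 0 < 1 + x by lra.
have dF (x : R) : -1 < x -> is_derive x (1 : R) F ((1 + x) `^ (- a - 1)).
  move=> x0; have -> : F = - a^-1 \*: (fun t : R => (1 + t) `^ (- a)) by [].
  have := is_derive_onep_powR (- a) (p1 _ x0).
  move=> dg; apply: is_derive_eq; rewrite /GRing.scale /= mulrA mulrNN.
  by rewrite mulVf ?gt_eqF// mul1r.
have cF (x : R) : -1 < x -> {for x, continuous F}.
  move=> x0; apply: differentiable_continuous; apply/derivable1_diffP.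
  by apply: ex_derive; exact: dF.
rewrite (@ge0_continuous_FTC2y _ _ F 0 0) => //.
- by rewrite /F addr0 powR1 mulr1 -EFinB sub0r opprK.
- by move=> x _; exact: powR_ge0.
- apply: continuous_in_subspaceT => x; rewrite inE/= in_itv/= andbT => x0.
  apply: differentiable_continuous; apply/derivable1_diffP; apply: ex_derive.
  apply: is_derive_onep_powR; lra.
- rewrite -[X in _ --> X](mulr0 (- a^-1)); apply: cvgM; first exact: cvg_cst.
  exact: cvg_onep_powRN.
- by move=> x x0; apply: ex_derive; apply: dF; lra.
- by apply: cvg_at_right_filter; apply: cF; lra.
- move=> x; rewrite in_itv/= andbT => x0; rewrite derive1E.
  have /dF[_ ->//] : -1 < x by lra.
Qed.

End real_integrals.

(** * The Gamma integral: bounds, functional equation, continuity *)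

Section gamma.
Context {R : realType}.
Local Notation mu := (@lebesgue_measure R).
Local Notation D := (`[0%R : R, +oo[%classic : set R).

(** The exponential series gives (1+t)^(m+2) <= (m+2)! e^(1+t): m of the factors absorb t^s and the
    other two leave the integrable (1+t)^-2. The bound is uniform in s, which dominated convergence
    in s requires. The exponent is spelled [- 1 - 1] to match the family [- a - 1] integrated
    above. *)
Lemma powR_expRN_le (m : nat) (s t : R) : 0 <= s <= m%:R -> 0 <= t ->
  t `^ s * expR (- t) <= expR 1 * m.+2`!%:R * (1 + t) `^ (- 1 - 1).
Proof.
move=> /andP[s0 sm] t0.
have t1 : 0 < 1 + t by lra.
have f0 : 0 < m.+2`!%:R :> R by rewrite ltr0n fact_gt0.
have H1 : t `^ s <= (1 + t) ^+ m.
  apply: (@le_trans _ _ ((1 + t) `^ s)).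
    by apply: ge0_ler_powR => //; rewrite ?nnegrE; lra.
  rewrite -powR_mulrn ?(ltW t1)//; apply: ler_powR => //; lra.
have H2 : (1 + t) ^+ m.+2 <= m.+2`!%:R * expR (1 + t).
  rewrite -ler_pdivrMl// mulrC.
  by apply: le_trans (expR_ge1Dxn m.+1 (ltW t1)); rewrite lerDr.
have -> : (1 + t) `^ (- 1 - 1) = (1 + t) ^- 2.
  by rewrite -powR_invn ?(ltW t1)//; congr (_ `^ _); lra.
rewrite -(ler_pM2r (exprn_gt0 2 t1)) divfK ?gt_eqF ?exprn_gt0//.
apply: (@le_trans _ _ ((1 + t) ^+ m.+2 * expR (- t))).
  rewrite mulrAC -(addn2 m) exprD; apply: ler_pM => //.
  - by rewrite mulr_ge0 ?powR_ge0 ?exprn_ge0 ?ltW.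
  - by apply: ler_pM => //; rewrite ?powR_ge0 ?exprn_ge0 ?ltW.
apply: (@le_trans _ _ (m.+2`!%:R * expR (1 + t) * expR (- t))).
  by rewrite ler_pM2r ?expR_gt0.
by rewrite -mulrA -expRD addrK mulrC.
Qed.

Lemma integrable_onep_powR (a : R) : 0 < a ->
  mu.-integrable D (EFin \o (fun t => (1 + t) `^ (- a - 1))).
Proof.
move=> a0; apply/integrableP; split.
  apply/measurable_EFinP/measurable_funTS.
  apply: (@measurableT_comp _ _ _ _ _ _ (@powR R ^~ (- a - 1)) _ (fun t : R => 1 + t)).
    exact: measurable_powR.
  exact: measurable_funD.
under eq_integral => x _ do rewrite /= ger0_norm ?powR_ge0//.
by rewrite integral0y_onep_powR// ltry.
Qed.

Lemma measurable_powR_expRN (A : set R) (s a : R) : measurable A ->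
  measurable_fun A (fun t : R => t `^ s * expR (- (a * t))).
Proof.
move=> mA; apply: measurable_funTS.
apply: measurable_funM; first exact: measurable_powR.
apply: measurableT_comp => //; apply: measurableT_comp => //.
Qed.

Lemma measurable_powR_expRN1 (A : set R) (s : R) : measurable A ->
  measurable_fun A (fun t : R => t `^ s * expR (- t)).
Proof.
move=> mA; rewrite (_ : (fun t : R => _) =
  (fun t => t `^ s * expR (- (1 * t)))); last by apply/funext => t; rewrite mul1r.
exact: measurable_powR_expRN.
Qed.

Lemma integrable_powR_expRN (s : R) : 0 <= s ->
  mu.-integrable D (EFin \o (fun t => t `^ s * expR (- t))).
Proof.
move=> s0; have [m sm] : exists m : nat, s <= m%:R.
  by exists (Num.trunc s).+1; rewrite ltW// truncnS_gt.
apply: (@le_integrable _ _ R mu D (measurable_itv _) _ (EFin \o (fun t : R =>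
  expR 1 * m.+2`!%:R * (1 + t) `^ (- 1 - 1)))).
- apply/measurable_EFinP; apply: measurable_powR_expRN1; exact: measurable_itv.
- move=> t; rewrite /= in_itv/= andbT => t0.
  rewrite lee_fin !ger0_norm ?mulr_ge0 ?powR_ge0 ?expR_ge0//.
  by apply: powR_expRN_le => //; rewrite s0.
- exact: (integrableZl _ _ (integrable_onep_powR ltr01)).
Qed.

(** Gamma is handled only at arguments above 1: the weight t^s with s > 0 is then continuous up to
    0, and the endpoint can be included. *)
Lemma GammaE (s : R) : 0 < s ->
  (\int[mu]_(t in D) (t `^ s * expR (- t))%:E)%E = (Gamma (s + 1))%:E.
Proof.
move=> s0; have intf := integrable_powR_expRN (ltW s0).
rewrite /Gamma /Rintegral fineK.
  rewrite addrK integral_itv_obnd_cbnd//.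
  apply/measurable_EFinP; apply: measurable_powR_expRN1; exact: measurable_itv.
rewrite addrK; apply: integrable_fin_num => //.
apply: (integrableS _ _ _ intf) => //.
by move=> x; rewrite /= !in_itv/= !andbT; exact: ltW.
Qed.

(** On [1, 2] the integrand is at least e^-2. *)
Lemma Gamma_gt0 (s : R) : 0 < s -> 0 < Gamma (s + 1).
Proof.
move=> s0; rewrite -lte_fin -GammaE//.
have mg : measurable_fun D (EFin \o (fun t => t `^ s * expR (- t))).
  exact: measurable_int (integrable_powR_expRN (ltW s0)).
apply: (@lt_le_trans _ _ (\int[mu]_(t in `[1%R : R, 2%R]) (expR (- 2))%:E)%E).
  by rewrite integral_cst//= lebesgue_measure_itv/= lte_fin ltr1n -EFinD -EFinM
    lte_fin mulr_gt0// ?expR_gt0//; lra.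
apply: (@le_trans _ _ (\int[mu]_(t in `[1%R : R, 2%R]) (t `^ s * expR (- t))%:E)%E).
  apply: ge0_le_integral => //.
  - apply/measurable_EFinP; apply: measurable_powR_expRN1; exact: measurable_itv.
  - move=> x; rewrite /= in_itv/= => /andP[x1 x2]; rewrite lee_fin.
    rewrite -[leLHS]mul1r; apply: ler_pM => //.
      by rewrite -(powRr0 x); apply: ler_powR => //; exact: ltW.
    by rewrite ler_expR; lra.
apply: ge0_subset_integral => //.
- by move=> x _; rewrite lee_fin mulr_ge0 ?powR_ge0 ?expR_ge0.
- by move=> x; rewrite /= !in_itv/= andbT => /andP[x1 _]; lra.
Qed.

Lemma continuous_within_powR (s : R) : 0 < s ->
  {within `[0%R : R, +oo[, continuous (@powR R ^~ s)}.
Proof.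
move=> s0; apply/continuous_within_itvcyP; split.
  move=> x; rewrite in_itv/= andbT => x0.
  apply: differentiable_continuous; apply/derivable1_diffP.
  by apply: derivable_powR; rewrite in_itv/= andbT.
by rewrite powR0 ?gt_eqF//; exact: powR_cvg0.
Qed.

Lemma continuous_within_powR_expRN (s : R) : 0 < s ->
  {within `[0%R : R, +oo[, continuous (fun t => t `^ s * expR (- t))}.
Proof.
move=> s0 x.
have c2 : {within `[0%R : R, +oo[, continuous (fun t : R => expR (- t))}.
  apply: continuous_subspaceT => t.
  apply: (@continuous_comp _ _ _ -%R expR); last exact: continuous_expR.
  exact: oppr_continuous.
exact: (cvgM (@continuous_within_powR s s0 x) (c2 x)).
Qed.

Lemma Gamma_scale (a s : R) : 0 < a -> 0 < s ->
  (\int[mu]_(t in D) (t `^ s * expR (- (a * t)))%:E)%E =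
  (a `^ (- s - 1) * Gamma (s + 1))%:E.
Proof.
move=> a0 s0.
pose F (x : R) : R := a * x.
have dF (x : R) : is_derive x (1 : R) F a.
  have -> : F = a \*: (@id R) by [].
  by apply: is_derive_eq; rewrite /= /GRing.scale /= mulr1.
have F'E : derive1 F = cst a.
  by apply/funext => x; rewrite derive1E; have [_ ->] := dF x.
have cF : continuous F.
  move=> x; apply: differentiable_continuous; apply/derivable1_diffP.
  by apply: ex_derive; exact: dF.
have F0 : F 0 = 0 by rewrite /F mulr0.
have := GammaE s0.
have := @increasing_ge0_integration_by_substitutiony _ F
  (fun t => t `^ s * expR (- t)) 0.
rewrite F0 => ->.
- move=> H; rewrite EFinM -H.
  rewrite [X in _ = (_ * X)%E](_ : _ = \int[mu]_(x in D)
      ((a `^ s * a)%:E * (x `^ s * expR (- (a * x)))%:E))%E; last first.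
    apply: eq_integral => x; rewrite inE/= in_itv/= andbT => x0.
    rewrite F'E -EFinM; congr EFin; rewrite /F.
    have -> : (((fun t : R => t `^ s * expR (- t)) \o (fun x : R => a * x)) * cst a) x
      = (a * x) `^ s * expR (- (a * x)) * a by [].
    by rewrite powRM ?(ltW a0)//; ring.
  rewrite ge0_integralZl//=.
  + rewrite muleA -EFinM (_ : _ * _ = 1) ?mul1e//.
    rewrite -[X in _ * (_ * X)]powRr1 ?ltW//.
    rewrite -powRD; last by rewrite (gt_eqF a0) implybT.
    by rewrite (_ : - s - 1 = - (s + 1)) ?powRN ?mulVf ?gt_eqF ?powR_gt0//; lra.
  + apply/measurable_EFinP; apply: measurable_powR_expRN; exact: measurable_itv.
  + by move=> x _; rewrite lee_fin mulr_ge0 ?powR_ge0 ?expR_ge0.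
  + by rewrite lee_fin mulr_ge0 ?powR_ge0 ?ltW.
- by move=> x y _ _ xy; rewrite /F ltr_pM2l.
- by rewrite F'E => x _; exact: cst_continuous.
- by rewrite F'E; exact: is_cvg_cst.
- by rewrite F'E; exact: is_cvg_cst.
- split; first by move=> x _; apply: ex_derive; exact: dF.
  by apply: cvg_at_right_filter; exact: cF.
- by apply: gt0_cvgMry => //; exact: cvg_id.
- exact: continuous_within_powR_expRN.
- by move=> x _; rewrite mulr_ge0 ?powR_ge0 ?expR_ge0.
Qed.

(** The derivative of t^s e^-t integrates to 0, as this function vanishes at both ends. With s > 1
    the derivative is continuous up to the endpoint 0. *)
Lemma GammaS (s : R) : 1 < s -> Gamma (s + 1) = s * Gamma s.
Proof.
move=> s1; have s0 : 0 < s by lra.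
have s10 : 0 < s - 1 by lra.
have E1 := GammaE s0; have E2 := GammaE s10; rewrite subrK in E2.
have i1 := integrable_powR_expRN (ltW s0).
have i2 := integrable_powR_expRN (ltW s10).
pose F (t : R) := t `^ s * expR (- t).
pose f (t : R) := s * (t `^ (s - 1) * expR (- t)) - t `^ s * expR (- t).
pose f1 (t : R) : R := t `^ (s - 1) * expR (- t).
have ifE : EFin \o f = ((fun t => s%:E * (EFin \o f1) t) \- (EFin \o F))%E.
  by apply/funext => t; rewrite /f /= EFinB EFinM.
have intf : mu.-integrable D (EFin \o f).
  by rewrite ifE; apply: integrableB => //; exact: integrableZl.
have : (\int[mu]_(t in D) (f t)%:E)%E = (0 - F 0)%:E.
  apply: integral0y_derive => //.
  - move=> x x0.
    have dN : is_derive x (1 : R) (fun t : R => expR (- t)) (- expR (- x)).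
      have dn : is_derive x (1 : R) (-%R : R -> R) (- 1) by exact: is_deriveNid.
      have := is_derive1_comp (is_derive_expR (- x)) dn.
      by rewrite mulrN1.
    have := is_deriveM (is_derive1_powR s x0) dN.
    move=> H; apply: is_derive_eq; rewrite /f /GRing.scale /=; ring.
  - rewrite /F powR0 ?gt_eqF// mul0r -[X in _ --> X](mul0r (expR (- (0:R)))).
    apply: cvgM; first exact: powR_cvg0.
    apply: cvg_at_right_filter.
    apply: (@continuous_comp _ _ _ -%R expR); last exact: continuous_expR.
    exact: oppr_continuous.
  - move=> x; apply: (cvgB _ (@continuous_within_powR_expRN s s0 x)).
    exact: (cvgM (cvg_cst _) (@continuous_within_powR_expRN _ s10 x)).
  - have [m sm] : exists m : nat, s <= m%:R.
      by exists (Num.trunc s).+1; rewrite ltW// truncnS_gt.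
    apply: (@squeeze_cvgr _ _ _ _ (cst 0) (fun t => expR 1 * m.+2`!%:R * (1 + t) `^ (- 1 - 1))).
    + near=> t; rewrite /= mulr_ge0 ?powR_ge0 ?expR_ge0//=.
      apply: powR_expRN_le; first by rewrite ltW//=.
      by near: t; apply: nbhs_pinfty_ge; exact: num_real.
    + exact: cvg_cst.
    + rewrite -[X in _ --> X](mulr0 (expR 1 * m.+2`!%:R)).
      apply: cvgM; first exact: cvg_cst.
      have : - 1 - 1 = - 2 :> R by lra.
      by move=> ->; apply: cvg_onep_powRN; lra.
rewrite /F powR0 ?gt_eqF// mul0r subr0.
have -> : (fun t => (f t)%:E) = (EFin \o f) by [].
rewrite ifE integralB//=; last exact: integrableZl.
rewrite integralZl//= E1 E2 -EFinM -EFinB => -[] H.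
by apply/eqP; rewrite eq_sym -subr_eq0 H.
Unshelve. all: by end_near. Qed.

Lemma Gamma_cvg (s : R^nat) (q : R) : 0 < q -> (forall m, 0 < s m) ->
  s @ \oo --> q -> (Gamma (s m + 1))%:E @[m --> \oo] --> (Gamma (q + 1))%:E.
Proof.
move=> q0 s0 sq.
have [m qm] : exists m : nat, q < m%:R.
  by exists (Num.trunc q).+1; rewrite truncnS_gt.
(* One dominating function must serve every index, so the sequence is shifted by [K], past which all
   [s k] lie below [m]. *)
have [K _ KP] : \forall k \near \oo, s k <= m%:R.
  by near=> k; near: k; apply: (cvgr_le q).
rewrite -GammaE// -(cvg_shiftn K).
have -> : (fun k => (Gamma (s (k + K)%N + 1))%:E) =
  (fun k => \int[mu]_(t in D) (t `^ (s (k + K)%N) * expR (- t))%:E)%E.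
  by apply/funext => k; rewrite -GammaE.
have [| | | | |_ _] := @dominated_convergence _ _ _ mu D (measurable_itv _)
  (fun k => EFin \o (fun t => t `^ (s (k + K)%N) * expR (- t)))
  (EFin \o (fun t => t `^ q * expR (- t)))
  (EFin \o (fun t => expR 1 * m.+2`!%:R * (1 + t) `^ (- 1 - 1))) => //.
- by move=> k; exact: measurable_int (integrable_powR_expRN (ltW (s0 _))).
- exact: measurable_int (integrable_powR_expRN (ltW q0)).
- apply: aeW => t; rewrite /= in_itv/= andbT => t0.
  apply: cvg_EFin; first by near=> k.
  apply: cvgM; last exact: cvg_cst.
  have [->|tn0] := eqVneq t 0.
    rewrite powR0 ?gt_eqF//; apply: cvg_near_cst; near=> k.
    by rewrite powR0// gt_eqF.
  rewrite /powR (negbTE tn0); apply: continuous_cvg; first exact: continuous_expR.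
  apply: cvgM; last exact: cvg_cst.
  by rewrite (cvg_shiftn K s).
- exact: (integrableZl _ _ (integrable_onep_powR ltr01)).
- apply: aeW => t k; rewrite /= in_itv/= andbT => t0.
  rewrite lee_fin ger0_norm ?mulr_ge0 ?powR_ge0 ?expR_ge0//.
  by apply: powR_expRN_le => //; rewrite ltW//= KP//= leq_addl.
Unshelve. all: by end_near. Qed.

End gamma.

(** * Integrals over [R^n] *)

Section tuple_integrals.
Context {R : realType}.
Local Notation lam := (@lebesgue_measure R).
Local Notation mu := (lebesgue_tuple R).
Local Notation tup n := (n.-tuple (measurableTypeR R)).

Definition rowt n (t : n.-tuple R) : 'rV[R]_n := \row_i tnth t i.

Lemma tonelli_lebesgue_tuple n (f : tup n.+1 -> \bar R) :
  measurable_fun [set: tup n.+1] f -> (forall t, 0 <= f t)%E ->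
  (\int[mu n.+1]_t f t = \int[lam]_x \int[mu n]_t f (cons_pair (x, t)))%E.
Proof.
move=> mf f0.
have -> : (\int[mu n.+1]_t f t = \int[pushforward (lam \x mu n)%E (@cons_pair _ (measurableTypeR R) n)]_t f t)%E by [].
have mc := @measurable_cons_pair _ (measurableTypeR R) n.
rewrite ge0_integral_pushforward// preimage_setT fubini_tonelli1//.
- exact: measurableT_comp.
- by move=> z; exact: f0.
Qed.

Lemma fubini_lebesgue_tuple n (f : tup n.+1 -> \bar R) :
  (mu n.+1).-integrable [set: tup n.+1] f ->
  (\int[mu n.+1]_t f t = \int[lam]_x \int[mu n]_t f (cons_pair (x, t)))%E /\
  (\int[mu n.+1]_t f t = \int[mu n]_t \int[lam]_x f (cons_pair (x, t)))%E.
Proof.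
move=> /integrableP[mf fy].
have mc := @measurable_cons_pair _ (measurableTypeR R) n.
have mfc : measurable_fun [set: measurableTypeR R * tup n] (f \o @cons_pair _ (measurableTypeR R) n).
  exact: measurableT_comp.
have intf : (lam \x mu n)%E.-integrable setT (f \o @cons_pair _ (measurableTypeR R) n).
  apply/integrable12ltyP => //.
  by rewrite tonelli_lebesgue_tuple// in fy; exact: measurableT_comp.
have E : (\int[mu n.+1]_t f t = \int[lam \x mu n]_z (f \o @cons_pair _ (measurableTypeR R) n) z)%E.
  have -> : (\int[mu n.+1]_t f t = \int[pushforward (lam \x mu n)%E (@cons_pair _ (measurableTypeR R) n)]_t f t)%E by [].
  by rewrite integral_pushforward.
rewrite E; split; first by rewrite -integral12_prod_meas1.
by rewrite -integral21_prod_meas1.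
Qed.

(** Tuples carry the product sigma-algebra, whereas continuity refers to the topology of row
    vectors. The two are reconciled by writing an open set as the union of the boxes with rational
    centre and radius 1/(m+1) that it contains; these are countably many. *)
Lemma open_rowt_measurable n (U : set 'rV[R]_n) : open U ->
  measurable (@rowt n @^-1` U : set (tup n)).
Proof.
move=> oU.
pose box (qm : n.-tuple rat * nat) : set 'rV[R]_n :=
  [set y | forall i, `|y ord0 i - ratr (tnth qm.1 i)| < qm.2.+1%:R^-1].
pose F qm : set (tup n) := if `[< box qm `<=` U >] then @rowt n @^-1` box qm else set0.
suff -> : @rowt n @^-1` U = \bigcup_qm F qm.
  apply: countable_bigcupT_measurable; first exact: countableP.
  move=> qm; rewrite /F; case: ifP => // _.
  have -> : @rowt n @^-1` box qm = \bigcap_i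
      ((fun t : tup n => tnth t i) @^-1` [set y : R | `|y - ratr (tnth qm.1 i)| < qm.2.+1%:R^-1]).
    apply/seteqP; split => t /=.
      by move=> H i _; have := H i; rewrite mxE.
    by move=> H i; rewrite mxE; exact: H.
  apply: fin_bigcap_measurable => //.
  move=> i _; rewrite -[X in measurable X]setTI; apply: measurable_tnth => //.
  have -> : [set y : R | `|y - ratr (tnth qm.1 i)| < qm.2.+1%:R^-1] =
      ball (ratr (tnth qm.1 i) : R) qm.2.+1%:R^-1.
    by apply/seteqP; split => y /=; rewrite /ball /= distrC.
  exact: measurable_ball.
apply/seteqP; split => t /=; last first.
  by move=> [qm _]; rewrite /F; case: ifPn => // /asboolP bU /bU.
move=> tU; have /nbhs_ballP[e e0 eU] : nbhs (rowt t) U by exact: open_nbhs_nbhs.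
have [m me] : exists m : nat, m.+1%:R^-1 < e / 2.
  exists (Num.trunc (e / 2)^-1); rewrite invf_plt ?posrE ?divr_gt0//.
  exact: truncnS_gt.
have m0 : 0 < m.+1%:R^-1 :> R by rewrite invr_gt0.
pose u (i : 'I_n) : R := tnth t i.
have /fin_all_exists[q Hq] (i : 'I_n) : exists q : rat,
    `|u i - ratr q| < m.+1%:R^-1.
  have /rat_in_itvoo[q] : u i - m.+1%:R^-1 < u i + m.+1%:R^-1.
    by rewrite ltrD2l (lt_trans _ m0)// oppr_lt0.
  rewrite in_itv/= => /andP[q1 q2]; exists q.
  by rewrite distrC ltr_distl q1 q2.
exists ([tuple q i | i < n], m) => //.
have qE i : tnth [tuple q i | i < n] i = q i.
  by rewrite tnth_mktuple.
rewrite /F; case: ifPn => [_|/asboolP] /=.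
  by move=> i; rewrite mxE qE.
case=> y /= yq; apply: eU; split => // i j; rewrite (ord1 i) !mxE.
have := yq j; rewrite /= qE => yqj; rewrite /ball /=.
rewrite (_ : _ - _ = (u j - ratr (q j)) + (ratr (q j) - y ord0 j)); last by rewrite /u; ring.
rewrite (le_lt_trans (ler_normD _ _))//.
rewrite distrC in yqj; rewrite (lt_trans (ltrD (Hq j) yqj))//.
by move: me; set d := m.+1%:R^-1; move: d => d; lra.
Qed.

Lemma measurable_rowt n (f : 'rV[R]_n -> R) : continuous f ->
  measurable_fun [set: tup n] (f \o @rowt n).
Proof.
move=> /continuousP cf; apply: (measurability _ (RGenOpens.measurableE R)).
move=> _ [_ [a [b ->] <-]]; rewrite setTI comp_preimage.
by apply: open_rowt_measurable; apply: cf; apply: interval_open.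
Qed.

End tuple_integrals.

(** A directional derivative sees its function on one line only. This transports derivatives between
    different spaces: from one real variable to row vectors, back, and through slices. *)
Lemma is_derive_along (R : realType) (V V' W : normedModType R)
    (f : V -> W) (g : V' -> W) (x v : V) (y w : V') (df : W) :
  (forall h : R, f (h *: v + x) = g (h *: w + y)) ->
  is_derive x v f df -> is_derive y w g df.
Proof.
move=> E [d1 d2].
have Q : (fun h : R => h^-1 *: ((g \o shift y) (h *: w) - g y)) =
         (fun h : R => h^-1 *: ((f \o shift x) (h *: v) - f x)).
  apply/funext => h /=; rewrite -E.
  by have := E 0; rewrite !scale0r !add0r => ->.
by split; [rewrite /derivable Q|rewrite /derive Q].
Qed.

Lemma continuous_fsum (R : realType) (T : topologicalType) (I : Type)
    (s : seq I) (F : I -> T -> R) :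
  (forall i, continuous (F i)) -> continuous (fun x => \sum_(i <- s) F i x).
Proof.
move=> cF; elim: s => [|i s ih] x.
  rewrite (_ : (fun x => _) = cst 0); first exact: cst_continuous.
  by apply/funext => y; rewrite big_nil.
rewrite (_ : (fun x => _) = (fun x => F i x + \sum_(j <- s) F j x)).
  by apply: continuousD; [exact: cF|exact: ih].
by apply/funext => y; rewrite big_cons.
Qed.

Lemma continuous_funM (R : realType) (T : topologicalType) (f g : T -> R) :
  continuous f -> continuous g -> continuous (fun x => f x * g x).
Proof. by move=> cf cg x; apply: cvgM; [exact: cf|exact: cg]. Qed.

Lemma continuous_funD (R : realType) (T : topologicalType) (f g : T -> R) :
  continuous f -> continuous g -> continuous (fun x => f x + g x).
Proof. by move=> cf cg x; apply: cvgD; [exact: cf|exact: cg]. Qed.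

Lemma continuous_funZ (R : realType) (T : topologicalType) (c : R) (f : T -> R) :
  continuous f -> continuous (fun x => c * f x).
Proof. by move=> cf; apply: continuous_funM => // x; exact: cst_continuous. Qed.

(** * Products of one-variable integrals and the weights (1 + |x|^2)^-N *)

Section weights.
Context {R : realType}.
Local Notation lam := (@lebesgue_measure R).
Local Notation mu := (lebesgue_tuple R).
Local Notation tup n := (n.-tuple (measurableTypeR R)).

Definition sqn n (x : 'rV[R]_n) : R := \sum_k x ord0 k ^+ 2.

Lemma sqn_ge0 n (x : 'rV[R]_n) : 0 <= sqn x.
Proof. by apply: sumr_ge0 => i _; exact: sqr_ge0. Qed.

Lemma sqr_le_sqn n (x : 'rV[R]_n) i : x ord0 i ^+ 2 <= sqn x.
Proof.
rewrite /sqn (bigD1 i)//= lerDl; apply: sumr_ge0 => j _; exact: sqr_ge0.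
Qed.

Lemma continuous_coord n (i : 'I_n) : continuous (fun x : 'rV[R]_n => x ord0 i).
Proof. exact: coord_continuous. Qed.

Lemma continuous_sqn n : continuous (@sqn n).
Proof.
apply: continuous_fsum => i x.
apply: (@continuous_comp _ _ _ (fun x : 'rV[R]_n => x ord0 i) (fun y => y ^+ 2)).
  exact: continuous_coord.
exact: exprn_continuous.
Qed.

Definition rowcons n (x : R) (y : 'rV[R]_n) : 'rV[R]_n.+1 :=
  \row_i oapp (y ord0) x (unlift ord0 i).

Lemma rowcons0 n x (y : 'rV[R]_n) : rowcons x y ord0 ord0 = x.
Proof. by rewrite mxE unlift_none. Qed.

Lemma rowconsS n x (y : 'rV[R]_n) i : rowcons x y ord0 (lift ord0 i) = y ord0 i.
Proof. by rewrite mxE liftK. Qed.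

Lemma rowt_cons n x (t : tup n) : rowt (cons_pair (x, t)) = rowcons x (rowt t).
Proof.
apply/rowP => i; case: (unliftP ord0 i) => [j ->|->].
  by rewrite rowconsS !mxE tnthS.
by rewrite rowcons0 mxE.
Qed.

Lemma sqn_rowcons n x (y : 'rV[R]_n) : sqn (rowcons x y) = x ^+ 2 + sqn y.
Proof.
rewrite /sqn big_ord_recl rowcons0; congr (_ + _).
by apply: eq_bigr => i _; rewrite rowconsS.
Qed.

Lemma continuous_row (T : topologicalType) n (f : T -> 'rV[R]_n) :
  (forall i, continuous (fun z => f z ord0 i)) -> continuous f.
Proof.
move=> cf z A /= [P fP PA].
apply: (@filterS _ _ _ [set z' | forall i, P ord0 i (f z' ord0 i)]).
  by move=> z' Hz'; apply: PA => i j; rewrite (ord1 i); exact: Hz'.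
by apply: filter_forall => i; exact: (cf i z _ (fP ord0 i)).
Qed.

Lemma continuous_rowcons_l n (y : 'rV[R]_n) : continuous (fun x => rowcons x y).
Proof.
apply: continuous_row => i; case: (unliftP ord0 i) => [j ->|->].
  by under eq_fun do rewrite rowconsS; exact: cst_continuous.
by under eq_fun do rewrite rowcons0; by move=> x.
Qed.

Lemma continuous_rowcons_r n (x : R) : continuous (@rowcons n x).
Proof.
apply: continuous_row => i; case: (unliftP ord0 i) => [j ->|->].
  by under eq_fun do rewrite rowconsS; exact: continuous_coord.
by under eq_fun do rewrite rowcons0; exact: cst_continuous.
Qed.

Lemma integral_prod_tuple n (phi : R -> R) (c : R) :
  measurable_fun setT phi -> (forall x, 0 <= phi x) ->
  (\int[lam]_x (phi x)%:E)%E = c%:E ->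
  (\int[mu n]_t (\prod_(i < n) phi (tnth t i))%:E)%E = (c ^+ n)%:E.
Proof.
move=> mphi phi0 phic.
have mprod m : measurable_fun [set: tup m] (fun t => \prod_(i < m) phi (tnth t i)).
  apply: measurable_prod => i _.
  apply: measurableT_comp => //; exact: measurable_tnth.
have mprodE m : measurable_fun [set: tup m] (fun t => (\prod_(i < m) phi (tnth t i))%:E).
  by apply/measurable_EFinP; exact: mprod.
have mphiE : measurable_fun [set: measurableTypeR R] (fun x => (phi x)%:E).
  exact/measurable_EFinP.
elim: n => [|n ih].
  rewrite /= integral_dirac ?diracT ?mul1e//=.
    by rewrite big_ord0 expr0.
  exact: mprodE.
rewrite tonelli_lebesgue_tuple; last 2 first.
- exact: mprodE.
- by move=> t; rewrite lee_fin; apply: prodr_ge0 => i _.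
rewrite exprS EFinM -phic.
rewrite -ge0_integralZr//; last 2 first.
- by move=> x _; rewrite lee_fin.
- by rewrite -ih; apply: integral_ge0 => t _; rewrite lee_fin; apply: prodr_ge0.
apply: eq_integral => x _; rewrite -ih -ge0_integralZl//; last 2 first.
- by move=> t _; rewrite lee_fin; apply: prodr_ge0.
- by rewrite lee_fin.
apply: eq_integral => t _; rewrite -EFinM big_ord_recl; congr EFin.
  by congr (_ * _); apply: eq_bigr => i _; rewrite tnthS.
exact: mprodE.
Qed.

Lemma integral_gauss_tuple n (a : R) : 0 < a ->
  (\int[mu n]_t (expR (- (a * sqn (rowt t))))%:E)%E = ((pi / a) `^ (n%:R / 2))%:E.
Proof.
move=> a0.
have mg : measurable_fun [set: R] (fun x : R => expR (- (a * x ^+ 2))).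
  apply: continuous_measurable_fun => x.
  apply: continuous_comp; last exact: continuous_expR.
  apply: continuousN; apply: continuousM; first exact: cst_continuous.
  exact: exprn_continuous.
have -> : (pi / a) `^ (n%:R / 2) = Num.sqrt (pi / a) ^+ n.
  rewrite (mulrC n%:R) powRrM powR12_sqrt ?powR_mulrn ?sqrtr_ge0//.
  by rewrite divr_ge0 ?pi_ge0 ?ltW.
rewrite -(integral_prod_tuple n mg _ (integral_gauss_scaled a0)); last first.
  by move=> x; exact: expR_ge0.
apply: eq_integral => t _; congr EFin; rewrite -expR_sum; congr expR.
rewrite /sqn mulr_sumr -sumrN; apply: eq_bigr => i _.
by rewrite mxE.
Qed.

Definition wgt N n (x : 'rV[R]_n) : R := (1 + sqn x) ^- N.

Lemma wgt_gt0 N n (x : 'rV[R]_n) : 0 < wgt N x.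
Proof. by rewrite invr_gt0 exprn_gt0// ltr_pwDl// sqn_ge0. Qed.

Lemma continuous_wgt N n : continuous (@wgt N n).
Proof.
move=> x; apply: (@cvgV _ _ _ _ (fun x : 'rV[R]_n => (1 + sqn x) ^+ N)).
- exact: (nbhs_filter x).
- by rewrite expf_neq0// gt_eqF// ltr_pwDl// sqn_ge0.
apply: (@continuous_comp _ _ _ (fun x : 'rV[R]_n => 1 + sqn x) (fun y => y ^+ N)).
  by apply: continuousD; [exact: cst_continuous|exact: continuous_sqn].
exact: exprn_continuous.
Qed.

Lemma le_wgt M N n (x : 'rV[R]_n) : (M <= N)%N -> wgt N x <= wgt M x.
Proof.
move=> MN; have p : 0 < 1 + sqn x by rewrite ltr_pwDl// sqn_ge0.
rewrite lef_pV2 ?posrE ?exprn_gt0//.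
by apply: ler_weXn2l => //; rewrite lerDl sqn_ge0.
Qed.

Lemma integralT_oneDsqr : (\int[lam]_x ((1 + x ^+ 2)^-1)%:E)%E = (pi : R)%:E.
Proof.
rewrite ge0_symfun_integralT//=.
- rewrite (_ : [set x | _] = `[0, +oo[%classic); last first.
    by apply/seteqP; split => x/=; rewrite in_itv/= andbT.
  by rewrite integral0y_oneDsqr -EFinM mulrCA divff// mulr1.
- by move=> x; rewrite invr_ge0 addr_ge0// sqr_ge0.
- exact: continuous_oneDsqrV.
- by move=> x/=; rewrite sqrrN.
Qed.

Lemma measurable_oneDsqrV : measurable_fun [set: R] (fun x : R => (1 + x ^+ 2)^-1).
Proof. by apply: continuous_measurable_fun; exact: continuous_oneDsqrV. Qed.

Lemma measurable_wgt N n :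
  measurable_fun [set: tup n] (EFin \o (@wgt N n \o @rowt R n)).
Proof. by apply/measurable_EFinP; apply: measurable_rowt; exact: continuous_wgt. Qed.

(** Since 1 + x_i^2 <= 1 + |x|^2 for each i, the weight is below the product of the functions 1/(1 +
    x_i^2), each of integral pi. *)
Lemma integrable_wgt N n : (n <= N)%N ->
  (mu n).-integrable setT (EFin \o (@wgt N n \o @rowt R n)).
Proof.
move=> nN; apply/integrableP; split.
  exact: measurable_wgt.
apply: (@le_lt_trans _ _ (\int[mu n]_t (\prod_(i < n) (1 + tnth t i ^+ 2)^-1)%:E)%E).
  apply: ge0_le_integral => //.
  - apply/measurableT_comp => //.
    exact: measurable_wgt.
  - apply/measurable_EFinP; apply: measurable_prod => i _.
    apply: (measurableT_comp measurable_oneDsqrV); exact: measurable_tnth.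
  move=> t _ /=; rewrite lee_fin ger0_norm ?(ltW (wgt_gt0 _ _))//.
  rewrite (le_trans (le_wgt _ nN))// /wgt.
  rewrite prodfV lef_pV2 ?posrE; last 2 first.
  - by rewrite exprn_gt0// ltr_pwDl// sqn_ge0.
  - by apply: prodr_gt0 => i _; rewrite ltr_pwDl// sqr_ge0.
  rewrite -[X in _ ^+ X]card_ord -prodr_const; apply: ler_prod => i _.
  rewrite addr_ge0 ?sqr_ge0//= lerD2l.
  by have := sqr_le_sqn (rowt t) i; rewrite mxE.
rewrite (@integral_prod_tuple _ (fun x => (1 + x ^+ 2)^-1) pi) ?ltry//.
- exact: measurable_oneDsqrV.
- by move=> x; rewrite invr_ge0 addr_ge0// sqr_ge0.
- exact: integralT_oneDsqr.
Qed.

End weights.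

(** * The integral of a partial derivative vanishes *)

Section integral_of_partial.
Context {R : realType}.
Local Notation lam := (@lebesgue_measure R).
Local Notation mu := (lebesgue_tuple R).
Local Notation tup n := (n.-tuple (measurableTypeR R)).

Lemma integrable_wgt_dom n N (C : R) (g : tup n -> R) : (n <= N)%N ->
  measurable_fun setT g -> (forall t, `|g t| <= C * wgt N (rowt t)) ->
  (mu n).-integrable setT (EFin \o g).
Proof.
move=> nN mg gC; apply: (@le_integrable _ (tup n) R (mu n) setT measurableT _
  (EFin \o (fun t : tup n => C * wgt N (rowt t)))).
- exact/measurable_EFinP.
- move=> t _ /=; rewrite lee_fin; apply: (le_trans (gC t)); exact: ler_norm.
- exact: (integrableZl _ _ (integrable_wgt nN)).
Qed.

Lemma scale_delta_rowcons0 n (h x : R) (y : 'rV[R]_n) :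
  h *: delta_mx ord0 ord0 + rowcons x y = rowcons (h *: 1 + x) y.
Proof.
apply/rowP => i; rewrite !mxE eqxx /=; case: (unliftP ord0 i) => [j ->|->].
  by rewrite /= mulr0 add0r.
by rewrite eqxx.
Qed.

Lemma scale_delta_rowconsS n (h x : R) (y : 'rV[R]_n) (i : 'I_n) :
  h *: delta_mx ord0 (lift ord0 i) + rowcons x y =
  rowcons x (h *: delta_mx ord0 i + y).
Proof.
apply/rowP => j; rewrite !mxE eqxx /=; case: (unliftP ord0 j) => [k ->|->].
  by rewrite /= !mxE (inj_eq lift_inj) eqxx.
by rewrite /= mulr0 add0r.
Qed.

Lemma cvg0_oneDsqr_dom (F : R -> R) (C : R) :
  (forall x, `|F x| <= C * (1 + x ^+ 2)^-1) ->
  F x @[x --> +oo] --> 0 /\ F x @[x --> -oo] --> 0.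
Proof.
move=> FC; have C0 : 0 <= C.
  by have := FC 0; rewrite expr0n addr0 invr1 mulr1; apply: le_trans.
have H (e x : R) : 0 < e -> C / e <= `|x| -> `|0 - F x| <= e.
  move=> e0 xe; rewrite sub0r normrN (le_trans (FC x))//.
  have p : 0 < 1 + x ^+ 2 by rewrite ltr_pwDl// sqr_ge0.
  rewrite ler_pdivrMr// mulrC -ler_pdivrMr// (le_trans xe)//.
  rewrite -real_normK ?num_real//; have := normr_ge0 x; nra.
split; apply/cvgrPdist_le => e e0; near=> x; apply: H => //.
- apply: le_trans (ler_norm x).
  by near: x; apply: nbhs_pinfty_ge; exact: num_real.
- rewrite -normrN; apply: le_trans (ler_norm _); rewrite lerNr.
  by near: x; apply: nbhs_ninfty_le; exact: num_real.
Unshelve. all: by end_near. Qed.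

Lemma wgt_rowcons_le1 n N (x : R) (y : 'rV[R]_n) : (0 < N)%N ->
  wgt N (rowcons x y) <= (1 + x ^+ 2)^-1.
Proof.
move=> N0; apply: (le_trans (le_wgt _ N0)); rewrite /wgt expr1 sqn_rowcons.
have := sqr_ge0 x; have := sqn_ge0 y => y0 x0.
by rewrite lef_pV2 ?posrE; lra.
Qed.

Lemma wgt_rowcons_le n N (x : R) (y : 'rV[R]_n) : wgt N (rowcons x y) <= wgt N y.
Proof.
have := sqr_ge0 x; have := sqn_ge0 y => y0 x0.
rewrite /wgt sqn_rowcons lef_pV2 ?posrE ?exprn_gt0//; try lra.
by apply: lerXn2r; rewrite ?nnegrE; lra.
Qed.

(** Induction on n by splitting off coordinate 0. If the derivative is along it, Fubini with this
    coordinate innermost gives 0 by the one-variable theorem. Otherwise coordinate 0 is frozen and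
    the slice has one variable less; freezing a coordinate only increases the weight, so the same
    [N] and [C] serve throughout. *)
Lemma integral_partial0 n (i : 'I_n) N (C : R) (H H' : 'rV[R]_n -> R) :
  (n <= N)%N ->
  (forall x, is_derive x (delta_mx ord0 i : 'rV[R]_n) H (H' x)) ->
  continuous H' ->
  (forall x, `|H x| <= C * wgt N x) -> (forall x, `|H' x| <= C * wgt N x) ->
  (\int[mu n]_t (H' (rowt t))%:E = 0)%E.
Proof.
elim: n i H H' => [[]//|n ih] i H H' nN dH cH' HC H'C.
have N0 : (0 < N)%N by exact: leq_ltn_trans nN.
have C0 : 0 <= C.
  have := HC 0; have := wgt_gt0 N (0 : 'rV[R]_n.+1) => w0.
  by move=> /(le_trans (normr_ge0 _)); rewrite pmulr_lge0.
have intH' : (mu n.+1).-integrable setT (EFin \o (H' \o @rowt R n.+1)).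
  apply: (integrable_wgt_dom nN) => [|t]; last exact: H'C.
  exact: measurable_rowt.
have [F1 F2] := fubini_lebesgue_tuple intH'.
case: (unliftP ord0 i) dH => [j ->|->] dH.
  rewrite [LHS]F1; apply: integral0_eq => x _ /=.
  under eq_integral => t _ do rewrite rowt_cons.
  apply: (ih j (fun y => H (rowcons x y)) (fun y => H' (rowcons x y))).
  - exact: ltnW.
  - move=> y; apply: is_derive_along (dH (rowcons x y)) => h.
    by rewrite scale_delta_rowconsS.
  - move=> y; apply: (@continuous_comp _ _ _ (@rowcons R n x) H').
      exact: continuous_rowcons_r.
    exact: cH'.
  - move=> y; apply: (le_trans (HC _)); apply: ler_wpM2l => //.
    exact: wgt_rowcons_le.
  - move=> y; apply: (le_trans (H'C _)); apply: ler_wpM2l => //.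
    exact: wgt_rowcons_le.
rewrite [LHS]F2; apply: integral0_eq => t _ /=.
under eq_integral => x _ do rewrite rowt_cons.
have [Fy FNy] : H (rowcons x (rowt t)) @[x --> +oo] --> 0 /\
    H (rowcons x (rowt t)) @[x --> -oo] --> 0.
  apply: (@cvg0_oneDsqr_dom _ C) => x.
  by apply: (le_trans (HC _)); apply: ler_wpM2l => //; exact: wgt_rowcons_le1.
have cH1 : continuous (fun x => H' (rowcons x (rowt t))).
  move=> x; apply: (@continuous_comp _ _ _ (fun x => rowcons x (rowt t)) H').
    exact: continuous_rowcons_l.
  exact: cH'.
apply: (@integralT_derive0 _ (fun x => H (rowcons x (rowt t)))) => //.
- move=> x; apply: is_derive_along (dH (rowcons x (rowt t))) => h.
  by rewrite scale_delta_rowcons0.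
- apply: (@le_integrable _ (measurableTypeR R) R lam setT measurableT _
    (EFin \o (fun x : R => C * (1 + x ^+ 2)^-1))).
  + by apply/measurable_EFinP; apply: continuous_measurable_fun.
  + move=> x _ /=; rewrite lee_fin; apply: le_trans (ler_norm _).
    by apply: (le_trans (H'C _)); apply: ler_wpM2l => //; exact: wgt_rowcons_le1.
  + have I1 : lam.-integrable setT (EFin \o (fun x : R => (1 + x ^+ 2)^-1)).
      apply/integrableP; split.
        by apply/measurable_EFinP; exact: measurable_oneDsqrV.
      under eq_integral => x _.
        rewrite /= ger0_norm ?invr_ge0 ?addr_ge0 ?sqr_ge0//.
        over.
      by rewrite integralT_oneDsqr ltry.
    exact: (integrableZl _ _ I1).
Qed.

End integral_of_partial.

(** * The radial powers [r^l] *)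

Section radial_power.
Context {R : realType}.
Local Notation mu := (lebesgue_tuple R).
Local Notation tup n := (n.-tuple (measurableTypeR R)).

(* [|u|^(l/2)] for [u > 0], but [0] at [u = 0] for every [l] (where [powR] gives [1] when [l = 0]) *)
Definition rho (l u : R) : R := u * `|u| `^ (l / 2 - 1).

Lemma rho0 l : rho l 0 = 0.
Proof. by rewrite /rho mul0r. Qed.

Lemma rhoE l u : 0 < u -> rho l u = u `^ (l / 2).
Proof.
move=> u0; rewrite /rho gtr0_norm// -{1}(powRr1 (ltW u0)).
by rewrite -powRD; [rewrite addrC subrK|rewrite (gt_eqF u0) implybT].
Qed.

Lemma rho_ge0 l u : 0 <= u -> 0 <= rho l u.
Proof. by move=> u0; rewrite /rho mulr_ge0// powR_ge0. Qed.

Lemma rhoD l m u : 0 <= u -> rho (l + m) u = rho l u * rho m u.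
Proof.
rewrite le_eqVlt => /predU1P[<-|u0]; first by rewrite !rho0 mul0r.
by rewrite !rhoE// mulrDl powRD// (gt_eqF u0) implybT.
Qed.

Lemma rho2 u : 0 <= u -> rho 2 u = u.
Proof.
rewrite le_eqVlt => /predU1P[<-|u0]; first by rewrite rho0.
by rewrite rhoE// divff// powRr1// ltW.
Qed.

Lemma rhoD2 l u : 0 <= u -> rho (l + 2) u = u * rho l u.
Proof. by move=> u0; rewrite rhoD// rho2// mulrC. Qed.

Lemma rho_le_add l1 l l2 u : 0 <= u -> l1 <= l <= l2 ->
  rho l u <= rho l1 u + rho l2 u.
Proof.
rewrite le_eqVlt => /predU1P[<-|u0] /andP[l1l ll2]; first by rewrite !rho0 addr0.
rewrite !rhoE//; have [u1|u1] := leP u 1.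
  apply: (@le_trans _ _ (u `^ (l1 / 2))); last by rewrite lerDl powR_ge0.
  by apply: ger_powR; [rewrite u0|rewrite ler_pM2r].
apply: (@le_trans _ _ (u `^ (l2 / 2))); last by rewrite lerDr powR_ge0.
by apply: ler_powR; [exact: ltW|rewrite ler_pM2r].
Qed.

Lemma rho_le_exp (l : R) m u : 0 <= u -> 1 <= u -> l <= m%:R * 2 -> rho l u <= (1 + u) ^+ m.
Proof.
move=> u0 u1 lm; rewrite rhoE; last by lra.
apply: (@le_trans _ _ (u `^ m%:R)).
  by apply: ler_powR => //; rewrite ler_pdivrMr.
by rewrite powR_mulrn//; apply: lerXn2r; rewrite ?nnegrE; lra.
Qed.

Lemma rho_le1 l u : 0 <= u <= 1 -> 0 <= l -> rho l u <= 1.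
Proof.
move=> /andP[]; rewrite le_eqVlt => /predU1P[<-|u0] u1 l0; first by rewrite rho0.
rewrite rhoE// -[leRHS](powRr0 u); apply: ger_powR; first by rewrite u0.
by rewrite divr_ge0.
Qed.

Lemma rho_le_poly l m u : 0 <= u -> 0 <= l <= m%:R * 2 -> rho l u <= (1 + u) ^+ m.
Proof.
move=> u0 /andP[l0 lm]; have [u1|u1] := leP u 1.
  apply: (@le_trans _ _ 1); first by rewrite rho_le1// u0.
  by apply: exprn_ege1; lra.
by apply: rho_le_exp => //; exact: ltW.
Qed.

Lemma measurable_rho l : measurable_fun setT (rho l).
Proof.
apply: measurable_funM => //.
apply: (@measurableT_comp _ _ _ _ _ _ (@powR R ^~ (l / 2 - 1))).
  exact: measurable_powR.
exact: normr_measurable.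
Qed.

Lemma continuous_powR_norm (a : R) : 0 < a -> continuous (fun u : R => `|u| `^ a).
Proof.
move=> a0 u; have [->|u0] := eqVneq u 0.
  apply/cvgrPdist_le => e e0; rewrite normr0 powR0 ?gt_eqF//.
  near=> v; rewrite sub0r normrN ger0_norm ?powR_ge0//.
  have [->|v0] := eqVneq v 0; first by rewrite normr0 powR0 ?gt_eqF// ltW.
  rewrite -[leRHS](@powRr1 _ e) ?(ltW e0)// -(@mulVf _ a) ?gt_eqF// powRrM.
  apply: ge0_ler_powR; rewrite ?nnegrE ?powR_ge0//; first exact: ltW.
  near: v; apply/nbhs_ballP; exists (e `^ a^-1); first by rewrite /= powR_gt0.
  by move=> v; rewrite /ball /= sub0r normrN => /ltW.
apply: (@continuous_comp _ _ _ (@Num.norm R R) (@powR R ^~ a)).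
  exact: norm_continuous.
apply: differentiable_continuous; apply/derivable1_diffP.
by apply: derivable_powR; rewrite in_itv/= andbT normr_gt0.
Unshelve. all: by end_near. Qed.

Lemma continuous_rho (l : R) : 2 < l -> continuous (rho l).
Proof.
move=> l2 u; have a0 : 0 < l / 2 - 1 by lra.
have c1 : {for u, continuous (@id R)} by [].
exact: (continuousM c1 (continuous_powR_norm a0 (x:=u))).
Qed.

(** The two-sided derivative at 0 exists because [rho l] is extended to negative arguments as an odd
    function: its difference quotient there is |h|^(l/2-1), which tends to 0 for l > 2. *)
Lemma is_derive_rho (l u : R) : 2 < l -> 0 <= u ->
  is_derive u (1 : R) (rho l) (l / 2 * `|u| `^ (l / 2 - 1)).
Proof.
move=> l2; rewrite le_eqVlt => /predU1P[<-|u0].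
  rewrite normr0 powR0 ?mulr0; last by rewrite gt_eqF; lra.
  have H : (fun h : R => h^-1 *: ((rho l \o shift 0) (h *: (1 : R)) - rho l 0)) @ (0 : R)^' --> (0 : R).
    rewrite rho0.
    have c0 : (fun h : R => `|h| `^ (l / 2 - 1)) @ (0 : R)^' --> (0 : R).
      have la : 0 < l / 2 - 1 by lra.
      have := continuous_powR_norm la (x := 0).
      rewrite /continuous_at /= normr0 powR0 ?gt_eqF// => c.
      apply: cvg_trans c; apply: cvg_app; exact: nbhs_dnbhs.
    apply: cvg_trans c0; apply: near_eq_cvg; near=> h.
    rewrite /= addr0 subr0 /rho [h *: 1]mulr1 /GRing.scale /= mulrA mulVf ?mul1r//.
    by near: h; exact: nbhs_dnbhs_neq.
  by split; [apply/cvg_ex; exists 0|exact: cvg_lim H].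
have d1 := is_derive1_powR (l / 2) u0.
rewrite gtr0_norm//.
have E : \forall v \near u, rho l v = v `^ (l / 2).
  near=> v; rewrite rhoE//; near: v; exact: lt_nbhsr.
split.
  apply: (@near_eq_derivable _ _ _ (@powR R ^~ (l / 2))) => //.
  by near=> v; apply/esym; near: v.
rewrite (near_eq_derive _ E)//.
by have [_ ->] := d1.
Unshelve. all: by end_near. Qed.

Definition rpow (l : R) n (x : 'rV[R]_n) : R := rho l (sqn x).

Lemma rpow_ge0 l n (x : 'rV[R]_n) : 0 <= rpow l x.
Proof. by apply: rho_ge0; exact: sqn_ge0. Qed.

Lemma sqn_line n (i : 'I_n) (x : 'rV[R]_n) (h : R) :
  sqn (h *: delta_mx ord0 i + x) = sqn x + (2 * x ord0 i) * h + h ^+ 2.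
Proof.
rewrite /sqn (bigD1 i)//= [in RHS](bigD1 i)//= !mxE !eqxx /= mulr1.
rewrite (eq_bigr (fun j => x ord0 j ^+ 2)); first by ring.
by move=> j ji; rewrite !mxE (negbTE ji) andbF mulr0 add0r.
Qed.

Lemma is_derive_sqn n (i : 'I_n) (x : 'rV[R]_n) :
  is_derive x (delta_mx ord0 i : 'rV[R]_n) (@sqn R n) (2 * x ord0 i).
Proof.
pose c : R := 2 * x ord0 i.
pose p : R -> R := cst (sqn x) + c \*: (@id R) + (@id R) ^+ 2.
have dp : is_derive (0 : R) (1 : R) p c.
  by apply: is_derive_eq; rewrite /= expr1 /GRing.scale /= mulr1 mulr0 mul0r addr0 add0r.
apply: (is_derive_along _ dp) => h.
by rewrite sqn_line addr0 [h *: 1]mulr1.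
Qed.

Lemma is_derive_rpow (l : R) n (i : 'I_n) (x : 'rV[R]_n) : 4 < l ->
  is_derive x (delta_mx ord0 i : 'rV[R]_n) (@rpow l n)
    (l * x ord0 i * rpow (l - 2) x).
Proof.
move=> l4; pose g (h : R) := sqn (h *: delta_mx ord0 i + x).
have dg : is_derive (0 : R) (1 : R) g (2 * x ord0 i).
  apply: is_derive_along (is_derive_sqn i x) => h.
  by rewrite /g addr0 [h *: 1]mulr1.
have u0 : 0 <= g 0 by exact: sqn_ge0.
have l2 : 2 < l by lra.
have dc := is_derive1_comp (is_derive_rho l2 u0) dg.
have gx : g 0 = sqn x by rewrite /g scale0r add0r.
have -> : l * x ord0 i * rpow (l - 2) x =
    l / 2 * `|g 0| `^ (l / 2 - 1) * (2 * x ord0 i).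
  rewrite /rpow gx; have := sqn_ge0 x.
  rewrite le_eqVlt => /predU1P[<-|s0].
    rewrite rho0 normr0 powR0 ?mulr0 ?mul0r//; first by rewrite gt_eqF; lra.
  rewrite rhoE// gtr0_norm// (_ : (l - 2) / 2 = l / 2 - 1); last by lra.
  by field.
apply: is_derive_along dc => h.
by rewrite /= /g /rpow addr0 [h *: 1]mulr1.
Qed.

Lemma continuous_rpow (l : R) n : 2 < l -> continuous (@rpow l n).
Proof.
move=> l2 x; apply: (@continuous_comp _ _ _ (@sqn R n) (rho l)).
  exact: continuous_sqn.
exact: continuous_rho.
Qed.

Lemma measurable_rpow l n : measurable_fun [set: tup n] (fun t => rpow l (rowt t)).
Proof.
apply: (measurableT_comp (measurable_rho l)).
exact: (measurable_rowt (@continuous_sqn R n)).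
Qed.

Definition rapid n (g : 'rV[R]_n -> R) :=
  forall N, exists C, forall x, `|g x| <= C * wgt N x.

Lemma rapid_ge0 n (g : 'rV[R]_n -> R) N : rapid g ->
  exists2 C, 0 <= C & forall x, `|g x| <= C * wgt N x.
Proof.
move=> /(_ N)[C gC]; exists C => //.
have := gC 0; have w0 := wgt_gt0 N (0 : 'rV[R]_n).
by move=> /(le_trans (normr_ge0 _)); rewrite pmulr_lge0.
Qed.

Lemma wgtM m N n (x : 'rV[R]_n) : (1 + sqn x) ^+ m * wgt (m + N) x = wgt N x.
Proof.
have p : (1 + sqn x) ^+ m != 0 by rewrite expf_neq0// gt_eqF// ltr_pwDl// sqn_ge0.
by rewrite /wgt exprD invfM mulrA divff// mul1r.
Qed.

Lemma rapid_poly n (g h : 'rV[R]_n -> R) m :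
  rapid g -> (forall x, `|h x| <= (1 + sqn x) ^+ m) -> rapid (fun x => h x * g x).
Proof.
move=> /[swap] hm gr N; have [C C0 gC] := rapid_ge0 (m + N) gr; exists C => x.
rewrite normrM -(wgtM m N) mulrCA; apply: ler_pM => //.

Qed.

Lemma coord_le_poly n (i : 'I_n) (x : 'rV[R]_n) : `|x ord0 i| <= (1 + sqn x) ^+ 1.
Proof.
rewrite expr1; have := sqr_le_sqn x i; rewrite -real_normK ?num_real//.
have := normr_ge0 (x ord0 i); nra.
Qed.

Lemma rapid_coord n (i : 'I_n) (g : 'rV[R]_n -> R) :
  rapid g -> rapid (fun x => x ord0 i * g x).
Proof. by move=> gr; apply: (rapid_poly gr) => x; exact: coord_le_poly. Qed.

Lemma rapid_rpow n (l : R) (g : 'rV[R]_n -> R) : 0 <= l ->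
  rapid g -> rapid (fun x => rpow l x * g x).
Proof.
move=> l0 gr; pose m := (Num.trunc l).+1.
apply: (@rapid_poly _ _ _ m gr) => x.
rewrite ger0_norm ?rpow_ge0//; apply: rho_le_poly; first exact: sqn_ge0.
rewrite l0 /=; have := truncnS_gt l; rewrite -/m => lm.
by apply: (le_trans (ltW lm)); rewrite ler_peMr// ler1n.
Qed.

Lemma rapidD n (g h : 'rV[R]_n -> R) :
  rapid g -> rapid h -> rapid (fun x => g x + h x).
Proof.
move=> gr hr N; have [C gC] := gr N; have [C' hC] := hr N.
exists (C + C') => x; rewrite mulrDl (le_trans (ler_normD _ _))//.
exact: lerD.
Qed.

Lemma rapidZ n (a : R) (g : 'rV[R]_n -> R) : rapid g -> rapid (fun x => a * g x).
Proof.
move=> gr N; have [C gC] := gr N; exists (`|a| * C) => x.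
by rewrite normrM -mulrA ler_wpM2l.
Qed.

(** The pairing of r^l with [g]. For rapidly decreasing continuous [g] the integral converges as
    soon as l > -n, by [good_integrable] below. *)
Definition Mint (l : R) n (g : 'rV[R]_n -> R) : R :=
  \int[mu n]_t (rpow l (rowt t) * g (rowt t)).

Lemma rapid_integrable n (g : 'rV[R]_n -> R) : rapid g ->
  measurable_fun [set: tup n] (g \o @rowt R n) ->
  (mu n).-integrable setT (EFin \o (g \o @rowt R n)).
Proof.
move=> /(_ n)[C gC] mg; apply: (@integrable_wgt_dom _ n n C) => // t.
exact: gC.
Qed.

Lemma Rintegral_partial0 n (i : 'I_n) (H H' : 'rV[R]_n -> R) :
  (forall x, is_derive x (delta_mx ord0 i : 'rV[R]_n) H (H' x)) ->
  continuous H' -> rapid H -> rapid H' -> \int[mu n]_t (H' (rowt t)) = 0.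
Proof.
move=> dH cH' rH rH'.
have [C C0 HC] := rapid_ge0 n rH; have [C' C'0 H'C] := rapid_ge0 n rH'.
rewrite /Rintegral (@integral_partial0 _ n i n (C + C') H H')// => x.
  by rewrite (le_trans (HC x))// ler_wpM2r ?(ltW (wgt_gt0 _ _))// lerDl.
by rewrite (le_trans (H'C x))// ler_wpM2r ?(ltW (wgt_gt0 _ _))// lerDr.
Qed.

(** The derivative of [rpow l x * h x] has integral 0. For l > 4 both r^l and r^(l-2) are
    continuous, so this derivative is too. *)
Lemma Mint_by_parts n (i : 'I_n) (l : R) (h h' : 'rV[R]_n -> R) : 4 < l ->
  (forall x, is_derive x (delta_mx ord0 i : 'rV[R]_n) h (h' x)) ->
  continuous h -> continuous h' -> rapid h -> rapid h' ->
  Mint l h' = - l * Mint (l - 2) (fun x => x ord0 i * h x).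
Proof.
move=> l4 dh ch ch' rh rh'.
pose H x := rpow l x * h x.
pose A (x : 'rV[R]_n) := rpow l x * h' x.
pose B (x : 'rV[R]_n) := rpow (l - 2) x * (x ord0 i * h x).
pose H' x := A x + l * B x.
have dH x : is_derive x (delta_mx ord0 i : 'rV[R]_n) H (H' x).
  have := is_deriveM (is_derive_rpow i x l4) (dh x).
  by move=> H1; apply: is_derive_eq; rewrite /H' /A /B /GRing.scale /=; ring.
have cA : continuous A.
  by move=> x; apply: continuousM; [apply: continuous_rpow; lra|exact: ch'].
have cB : continuous B.
  move=> x; apply: continuousM; first by apply: continuous_rpow; lra.
  by apply: continuousM; [exact: continuous_coord|exact: ch].
have cH' : continuous H'.
  move=> x; apply: continuousD; first exact: cA.
  by apply: continuousM; [exact: cst_continuous|exact: cB].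
have rA : rapid A by apply: rapid_rpow => //; lra.
have rB : rapid B by apply: rapid_rpow; [lra|exact: rapid_coord].
have rH' : rapid H' by apply: rapidD => //; exact: rapidZ.
have rH : rapid H by apply: rapid_rpow => //; lra.
have iA := rapid_integrable rA (measurable_rowt cA).
have iB := rapid_integrable rB (measurable_rowt cB).
have := Rintegral_partial0 dH cH' rH rH'.
rewrite RintegralD//; last exact: (integrableZl _ _ iB).
rewrite RintegralZl// => /eqP; rewrite addr_eq0 => /eqP E.
by rewrite mulNr; exact: E.
Qed.

End radial_power.

(** * The pairing of r^(-2s) with a Gaussian *)

Section gaussian_asymptotics.
Context {R : realType}.
Local Notation lam := (@lebesgue_measure R).
Local Notation mu := (lebesgue_tuple R).
Local Notation tup n := (n.-tuple (measurableTypeR R)).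
Local Notation D := (`[0%R : R, +oo[%classic : set R).

Lemma Rintegral_sum d (T : measurableType d) (nu : {measure set T -> \bar R})
    (I : Type) (s : seq I) (F : I -> T -> R) :
  (forall i, nu.-integrable setT (EFin \o F i)) ->
  \int[nu]_t (\sum_(i <- s) F i t) = \sum_(i <- s) \int[nu]_t F i t.
Proof.
move=> iF; elim: s => [|i s ih].
  rewrite big_nil /Rintegral; under eq_integral do rewrite big_nil.
  by rewrite integral0.
rewrite big_cons -ih -RintegralD//.
  by apply: eq_Rintegral => t _; rewrite big_cons.
have -> : EFin \o (fun t => \sum_(j <- s) F j t) = (fun t => \sum_(j <- s) (EFin \o F j) t)%E.
  by apply/funext => t /=; rewrite sumEFin.
exact: integrable_sum.
Qed.

Lemma rapid_gauss n (a : R) : 0 < a -> rapid (fun x : 'rV[R]_n => expR (- (a * sqn x))).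
Proof.
(* The constant comes from (a(1+u))^N / N! <= e^(a(1+u)) with u = |x|^2, after separating the factor
   e^a. *)
move=> a0 N; exists (expR a * N`!%:R / a ^+ N) => x.
have u0 := sqn_ge0 x; set u := sqn x in u0 *.
have f0 : 0 < N`!%:R :> R by rewrite ltr0n fact_gt0.
have aN : 0 < a ^+ N by exact: exprn_gt0.
have p : 0 < (1 + u) ^+ N by rewrite exprn_gt0//; lra.
rewrite ger0_norm ?expR_ge0// /wgt -/u ler_pdivlMr// ler_pdivlMr//.
have -> : - (a * u) = a - a * (1 + u) by ring.
rewrite expRB -!mulrA ler_pM2l ?expR_gt0// mulrC ler_pdivrMr ?expR_gt0//.
rewrite -exprMn -ler_pdivrMl// mulrC (mulrC a).
have a1 : 0 <= (1 + u) * a by rewrite mulr_ge0//; lra.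
case: N {f0 aN p} => [|N]; first by rewrite expr0 fact0 mulr1n divr1 -[leLHS]expR0 ler_expR.
by apply: le_trans (expR_ge1Dxn N a1); rewrite lerDr.
Qed.

Lemma continuous_gauss n (a : R) : continuous (fun x : 'rV[R]_n => expR (- (a * sqn x))).
Proof.
move=> x; apply: continuous_comp; last exact: continuous_expR.
apply: continuousN; apply: continuousM; first exact: cst_continuous.
exact: continuous_sqn.
Qed.

Lemma is_derive_gauss n (i : 'I_n) (a : R) (x : 'rV[R]_n) :
  is_derive x (delta_mx ord0 i : 'rV[R]_n) (fun x => expR (- (a * sqn x)))
    (- (2 * a * x ord0 i) * expR (- (a * sqn x))).
Proof.
pose g (h : R) := sqn (h *: delta_mx ord0 i + x).
have dg : is_derive (0 : R) (1 : R) (- (a \*: g)) (- (a * (2 * x ord0 i))).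
  have dg0 : is_derive (0 : R) (1 : R) g (2 * x ord0 i).
    apply: is_derive_along (is_derive_sqn i x) => h.
    by rewrite /g addr0 [h *: 1]mulr1.
  exact: is_deriveN.
have dc := is_derive1_comp (is_derive_expR _) dg.
rewrite (_ : - (2 * a * x ord0 i) * expR (- (a * sqn x)) = expR ((- (a \*: g)) 0) * - (a * (2 * x ord0 i))); last first.
  rewrite /g /= (_ : (- _) 0 = - (a * sqn x)); first by ring.
  by rewrite -[LHS]/(- (a * sqn (0 *: delta_mx ord0 i + x))) scale0r add0r.
apply: is_derive_along dc => h.
by rewrite /= addr0 [h *: 1]mulr1.
Qed.

(** The derivative of x_i e^(-a|x|^2) in direction i integrates to 0, which expresses the moment of
    x_i^2 through the total mass. Summing over i produces the factor n. *)
Lemma integral_gauss_moment n (a : R) : 0 < a ->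
  (\int[mu n]_t (sqn (rowt t) * expR (- (a * sqn (rowt t))))%:E)%E =
  (n%:R / 2 / a * (pi / a) `^ (n%:R / 2))%:E.
Proof.
move=> a0.
pose E (x : 'rV[R]_n) := expR (- (a * sqn x)).
have rE : rapid E by exact: rapid_gauss.
have cE : continuous E by exact: continuous_gauss.
have iE := rapid_integrable rE (measurable_rowt cE).
have rx i : rapid (fun x => x ord0 i * (x ord0 i * E x)).
  by do 2 apply: rapid_coord.
have cx i : continuous (fun x : 'rV[R]_n => x ord0 i * (x ord0 i * E x)).
  apply: continuous_funM; first exact: continuous_coord.
  by apply: continuous_funM; first exact: continuous_coord.
have ix i := rapid_integrable (rx i) (measurable_rowt (cx i)).
have J : \int[mu n]_t E (rowt t) = (pi / a) `^ (n%:R / 2).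
  by rewrite /Rintegral integral_gauss_tuple.
have Ji i : \int[mu n]_t (rowt t ord0 i * (rowt t ord0 i * E (rowt t))) =
    (2 * a)^-1 * (pi / a) `^ (n%:R / 2).
  pose H' (x : 'rV[R]_n) := E x - 2 * a * (x ord0 i * (x ord0 i * E x)).
  have dH x : is_derive x (delta_mx ord0 i : 'rV[R]_n) (fun x => x ord0 i * E x) (H' x).
    have dx : is_derive x (delta_mx ord0 i : 'rV[R]_n) (fun x : 'rV[R]_n => x ord0 i) 1.
      pose c : R := x ord0 i.
      have dp : is_derive (0 : R) (1 : R) (cst c + (@id R)) 1.
        by apply: is_derive_eq; rewrite add0r.
      apply: (is_derive_along _ dp) => h.
      by rewrite addr0 [h *: 1]mulr1 !mxE !eqxx mulr1 addrC.
    have := is_deriveM dx (is_derive_gauss i a x).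
    by move=> H1; apply: is_derive_eq; rewrite /H' /E /GRing.scale /=; ring.
  have cH' : continuous H'.
    move=> x; apply: continuousB; first exact: cE.
    by apply: continuous_funZ; exact: cx.
  have rH' : rapid H'.
    have -> : H' = (fun x => E x + (- (2 * a)) * (x ord0 i * (x ord0 i * E x))).
      by apply/funext => x; rewrite /H' mulNr.
    by apply: rapidD => //; exact: rapidZ.
  have := Rintegral_partial0 dH cH' (rapid_coord i rE) rH'.
  rewrite RintegralB//; last exact: (integrableZl _ _ (ix i)).
  rewrite RintegralZl//; last exact: (ix i).
  move=> /eqP; rewrite subr_eq0 => /eqP E1.
  by rewrite -J [in RHS]E1 mulrA mulVf ?mul1r// gt_eqF// mulr_gt0.
have S : \int[mu n]_t (sqn (rowt t) * E (rowt t)) =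
    n%:R / 2 / a * (pi / a) `^ (n%:R / 2).
  transitivity (\int[mu n]_t (\sum_(i < n) rowt t ord0 i * (rowt t ord0 i * E (rowt t)))).
    apply: eq_Rintegral => t _; rewrite /sqn mulr_suml.
    by apply: eq_bigr => i _; rewrite mulrA -expr2.
  rewrite Rintegral_sum; last exact: ix.
  rewrite (eq_bigr (fun=> (2 * a)^-1 * (pi / a) `^ (n%:R / 2))); last by move=> i _.
  rewrite sumr_const card_ord -(mulr_natl (_ * _)) mulrA; congr (_ * _).
  by field; rewrite gt_eqF.
have rS : rapid (fun x => sqn x * E x).
  apply: (@rapid_poly _ _ _ _ 1 rE) => x.
  by rewrite expr1 ger0_norm ?sqn_ge0// lerDr.
have cS : continuous (fun x : 'rV[R]_n => sqn x * E x).
  by apply: continuous_funM; first exact: continuous_sqn.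
have iS := rapid_integrable rS (measurable_rowt cS).
by rewrite -S /Rintegral fineK//; exact: integrable_fin_num iS.
Qed.

Lemma onep_powR_sub (a b c t : R) : 0 <= t -> a + b = c ->
  (1 + t) `^ c = (1 + t) `^ a * (1 + t) `^ b.
Proof.
by move=> t0 <-; rewrite powRD// (@gt_eqF _ _ (1 + t)) ?implybT//; lra.
Qed.

(** The integral is the Beta function B(s+1, q-s). Only its blow-up as s tends to q matters, so
    two-sided bounds replace its evaluation. With v = 1/(1+t) the integrand is (1-v)^s
    (1+t)^(-(q-s)-1); bound (1-v)^s above by 1 and below by 1 - m v. *)
Lemma beta_bounds (s q : R) (m : nat) : 0 < s < q -> s <= m%:R -> (0 < m)%N ->
  exists2 B, (q - s)^-1 - m%:R <= B <= (q - s)^-1 &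
  (\int[lam]_(t in D) (t `^ s * (1 + t) `^ (- q - 1))%:E = B%:E)%E.
Proof.
move=> /andP[s0 sq] sm m0; set e := q - s.
have e0 : 0 < e by rewrite /e; lra.
pose f (t : R) := t `^ s * (1 + t) `^ (- q - 1).
have f0 t : 0 <= f t by rewrite mulr_ge0 ?powR_ge0.
have mp (a : R) : measurable_fun D (fun t : R => (1 + t) `^ a).
  apply: measurable_funTS.
  apply: (@measurableT_comp _ _ _ _ _ _ (@powR R ^~ a) _ (fun t : R => 1 + t)).
    exact: measurable_powR.
  exact: measurable_funD.
have mf : measurable_fun D f.
  apply: measurable_funM => //; apply: measurable_funTS; exact: measurable_powR.
have mpE (a : R) : measurable_fun D (fun t : R => ((1 + t) `^ a)%:E).
  exact/measurable_EFinP.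
have mfE : measurable_fun D (fun t => (f t)%:E) by exact/measurable_EFinP.
have fE t : 0 <= t -> f t = (t / (1 + t)) `^ s * (1 + t) `^ (- e - 1).
  move=> t0; rewrite powRM ?invr_ge0//; last by lra.
  rewrite /f -mulrA; congr (_ * _); rewrite -powR_inv1; last by lra.
  rewrite -powRrM; apply: onep_powR_sub => //; rewrite /e; lra.
have I1 := integral0y_onep_powR e0.
have e10 : 0 < e + 1 by lra.
have I2 := integral0y_onep_powR e10.
have le1 : (\int[lam]_(t in D) (f t)%:E <= (e^-1)%:E)%E.
  rewrite -I1; apply: ge0_le_integral => //.
  - by move=> t _; rewrite lee_fin.
  - exact: mpE.
  - move=> t; rewrite /= in_itv/= andbT => t0; rewrite lee_fin fE//.
    have one : 1 `^ s = 1 :> R by rewrite powR1.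
    rewrite ler_piMl ?powR_ge0// -[leRHS]one; apply: ge0_ler_powR; rewrite ?nnegrE//.
    + exact: ltW.
    + by rewrite divr_ge0//; lra.
    + by rewrite ler_pdivrMr; lra.
have ge1 : ((e^-1)%:E <= \int[lam]_(t in D) (f t)%:E + (m%:R / (e + 1))%:E)%E.
  rewrite -I1 EFinM -I2 -ge0_integralZl//; last 2 first.
  - exact: mpE.
  - by move=> t _; rewrite lee_fin powR_ge0.
  rewrite -ge0_integralD//; last 3 first.
  - by move=> t _; rewrite lee_fin.
  - by move=> t _; rewrite mule_ge0// lee_fin ?powR_ge0.
  - by apply: measurable_funeM; exact: mpE.
  apply: ge0_le_integral => //.
  - by move=> t _; rewrite lee_fin powR_ge0.
  - exact: mpE.
  - by apply: emeasurable_funD => //; apply: measurable_funeM; exact: mpE.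
  move=> t; rewrite /= in_itv/= andbT => t0; rewrite -EFinM -EFinD lee_fin fE//.
  have W0 : 0 <= (1 + t) `^ (- e - 1) by exact: powR_ge0.
  have -> : (1 + t) `^ (- (e + 1) - 1) = (1 + t) `^ (- e - 1) * (1 + t)^-1.
    by rewrite -powR_inv1; [apply: onep_powR_sub => //|]; lra.
  set W := (1 + t) `^ _ in W0 *.
  rewrite -[leLHS]mul1r mulrCA (mulrC W) -mulrDl; apply: ler_wpM2r => //.
  (* Bernoulli's inequality; it bounds (1-v)^s from below because (1-v)^s >= (1-v)^m for s <= m. *)
  have Bern (v : R) : 0 <= v <= 1 -> 1 - m%:R * v <= (1 - v) ^+ m.
    move=> /andP[v0 v1]; elim: (m) => [|j ih]; first by rewrite mul0r subr0 expr0.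
    rewrite exprS; apply: (@le_trans _ _ ((1 - v) * (1 - j%:R * v))).
      rewrite -natr1; have : 0 <= j%:R * v * v by rewrite !mulr_ge0.
      by move: (j%:R : R) => y; lra.
    by apply: ler_wpM2l => //; lra.
  have v01 : 0 <= (1 + t)^-1 <= 1.
    by rewrite invr_ge0 invf_le1; lra.
  have vE : t / (1 + t) = 1 - (1 + t)^-1 by field; lra.
  rewrite -lerBlDr (le_trans (Bern _ v01))// -vE.
  (* At t = 0 the left side is 0^m, which is 0 because m > 0. *)
  have [->|tn0] := eqVneq t 0.
    by rewrite mul0r expr0n gtn_eqF// powR_ge0.
  have tp : 0 < t by rewrite lt_neqAle eq_sym tn0.
  rewrite -powR_mulrn ?divr_ge0//; last by lra.
  apply: ger_powR => //; rewrite divr_gt0//; last by lra.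
  by rewrite ler_pdivrMr; lra.
have fin : (\int[lam]_(t in D) (f t)%:E)%E \is a fin_num.
  rewrite ge0_fin_numE; first by rewrite (le_lt_trans le1)// ltry.
  by apply: integral_ge0 => t _; rewrite lee_fin.
exists (fine (\int[lam]_(t in D) (f t)%:E)%E); last by rewrite fineK.
move: le1 ge1; rewrite -(fineK fin) -EFinD !lee_fin /= => -> ge1.
rewrite andbT lerBlDr (le_trans ge1)// lerD2l ler_pdivrMr//.
by rewrite ler_peMr//; lra.
Qed.

(** Tonelli for the function |x|^2 t^s e^(-(1+t)|x|^2) of x and t > 0. Integrating in t first gives
    Gamma(s+1) |x|^(-2s) e^(-|x|^2); integrating in x first gives, by the Gaussian second moment, a
    multiple of the Beta integrand. The factor |x|^2 is what allows the weight t^s instead of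
    t^(s-1), which is singular at 0 for s < 1. *)
Lemma integral_rpow_gauss n (s : R) (m : nat) : 0 < s < n%:R / 2 -> s <= m%:R -> (0 < m)%N ->
  exists2 B, (n%:R / 2 - s)^-1 - m%:R <= B <= (n%:R / 2 - s)^-1 &
  (\int[mu n]_t (rpow (- (2 * s)) (rowt t) * expR (- sqn (rowt t)))%:E)%E =
  (n%:R / 2 * pi `^ (n%:R / 2) * B / Gamma (s + 1))%:E.
Proof.
set q := n%:R / 2 => s0q sm m0.
have [B Bb IB] := beta_bounds s0q sm m0; exists B => //.
have /andP[s0 sq] := s0q.
have G0 := Gamma_gt0 s0.
have q0 : 0 < q by lra.
pose F (z : tup n * measurableTypeR R) : \bar R :=
  (sqn (rowt z.1) * (z.2 `^ s * expR (- ((1 + z.2) * sqn (rowt z.1)))) * \1_D z.2)%:E.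
have F0 z : (0 <= F z)%E.
  by rewrite lee_fin !mulr_ge0 ?sqn_ge0 ?powR_ge0 ?expR_ge0// indicE ler0n.
have msq : measurable_fun [set: tup n * measurableTypeR R] (fun z => sqn (rowt z.1)).
  apply: (measurableT_comp (measurable_rowt (@continuous_sqn R n))).
  exact: measurable_fst.
have mF : measurable_fun setT F.
  apply/measurable_EFinP; apply: measurable_funM.
    apply: measurable_funM => //; apply: measurable_funM.
      apply: (measurableT_comp (measurable_powR s)); exact: measurable_snd.
    apply: measurableT_comp => //; apply: measurableT_comp => //.
    apply: measurable_funM => //; apply: measurable_funD => //.
  apply: (@measurableT_comp _ _ _ _ _ _ (\1_D : R -> R) _ snd).
    by apply: measurable_indic.
  exact: measurable_snd.
have E1 t : (\int[lam]_x F (t, x) =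
    (Gamma (s + 1))%:E * (rpow (- (2 * s)) (rowt t) * expR (- sqn (rowt t)))%:E)%E.
  have u0 := sqn_ge0 (rowt t); rewrite /rpow; set u := sqn (rowt t) in u0 *.
  transitivity (\int[lam]_(x in D) (u * (x `^ s * expR (- ((1 + x) * u))))%:E)%E.
    rewrite [RHS]integral_mkcond; apply: eq_integral => x _.
    rewrite /F /= -/u patchE indicE.
    by case: ifPn => _; rewrite ?mulr1 ?mulr0.
  (* At the origin the factor |x|^2 is 0 on one side, and [rpow] is 0 by convention on the other. *)
  move: u0; rewrite le_eqVlt => /predU1P[<-|u0].
    rewrite rho0 mul0r mule0; apply: integral0_eq => x _.
    by rewrite mul0r.
  have Gs := Gamma_scale u0 s0.
  transitivity (\int[lam]_(x in D) ((u * expR (- u))%:E * (x `^ s * expR (- (u * x)))%:E))%E.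
    apply: eq_integral => x _; rewrite -EFinM; congr EFin.
    rewrite (_ : - ((1 + x) * u) = - u + - (u * x)); last by ring.
    by rewrite expRD; ring.
  rewrite ge0_integralZl//; last 3 first.
  - by apply/measurable_EFinP; apply: measurable_powR_expRN; exact: measurable_itv.
  - by move=> x _; rewrite lee_fin mulr_ge0 ?powR_ge0 ?expR_ge0.
  - by rewrite lee_fin mulr_ge0 ?expR_ge0 ?ltW.
  rewrite Gs -!EFinM; congr EFin.
  rewrite /rho gtr0_norm// (_ : - (2 * s) / 2 - 1 = - s - 1); first by ring.
  by field.
have E2 x : (\int[mu n]_t F (t, x) =
    (q * pi `^ q)%:E * ((x `^ s * (1 + x) `^ (- q - 1)) * \1_D x)%:E)%E.
  have [xD|xD] := boolP (x \in D); last first.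
    rewrite indicE (negbTE xD) mulr0 mule0; apply: integral0_eq => t _.
    by rewrite /F /= indicE (negbTE xD) mulr0.
  have x0 : 0 <= x by move: xD; rewrite inE/= in_itv/= andbT.
  have x1 : 0 < 1 + x by lra.
  transitivity (\int[mu n]_t ((x `^ s)%:E *
     (sqn (rowt t) * expR (- ((1 + x) * sqn (rowt t))))%:E))%E.
    apply: eq_integral => t _; rewrite /F /= indicE xD mulr1 -EFinM.
    by congr EFin; ring.
  rewrite ge0_integralZl//; last 3 first.
  - apply/measurable_EFinP.
    apply: (@measurable_rowt _ n (fun y => sqn y * expR (- ((1 + x) * sqn y)))).
    by apply: continuous_funM; [exact: continuous_sqn|exact: continuous_gauss].
  - by move=> t _; rewrite lee_fin mulr_ge0 ?sqn_ge0 ?expR_ge0.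
  - by rewrite lee_fin powR_ge0.
  rewrite integral_gauss_moment// -!EFinM indicE xD mulr1; congr EFin.
  rewrite -/q powRM ?pi_ge0 ?invr_ge0 ?(ltW x1)//.
  rewrite -(powR_inv1 (ltW x1)) -powRrM mulN1r.
  rewrite (@onep_powR_sub (- q) (- 1) (- q - 1))//; ring.
have := @fubini_tonelli _ _ (tup n) (measurableTypeR R) R (mu n) lam F mF F0.
under eq_integral => t _ do rewrite E1.
under [RHS]eq_integral => x _ do rewrite E2.
have mg : measurable_fun [set: tup n]
    (fun t => (rpow (- (2 * s)) (rowt t) * expR (- sqn (rowt t)))%:E).
  apply/measurable_EFinP; apply: measurable_funM; first exact: measurable_rpow.
  apply: (@measurable_rowt _ n (fun y => expR (- sqn y))) => y.
  apply: continuous_comp; last exact: continuous_expR.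
  by apply: continuousN; exact: continuous_sqn.
rewrite ge0_integralZl//; last 2 first.
- by move=> t _; rewrite lee_fin mulr_ge0 ?rpow_ge0 ?expR_ge0.
- by rewrite lee_fin ltW.
rewrite ge0_integralZl//; last 3 first.
- apply/measurable_EFinP; apply: measurable_funM; last exact: measurable_indic.
  apply: measurable_funM; first exact: measurable_powR.
  apply: (@measurableT_comp _ _ _ _ _ _ (@powR R ^~ (- q - 1)) _ (fun t : R => 1 + t)).
    exact: measurable_powR.
  exact: measurable_funD.
- by move=> x _; rewrite lee_fin !mulr_ge0 ?powR_ge0// indicE ler0n.
- by rewrite lee_fin mulr_ge0 ?powR_ge0// ltW.
have -> : (\int[lam]_x (x `^ s * (1 + x) `^ (- q - 1) * \1_D x)%:E = B%:E)%E.
  rewrite -IB [RHS]integral_mkcond; apply: eq_integral => x _.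
  by rewrite patchE indicE; case: ifPn => _; rewrite ?mulr1 ?mulr0.
set X := (\int[mu n]_t _)%E => XE.
have : ((Gamma (s + 1))^-1%:E * ((Gamma (s + 1))%:E * X) = X)%E.
  by rewrite muleA -EFinM mulVf ?mul1e// gt_eqF.
by rewrite XE => <-; rewrite -!EFinM mulrC.
Qed.

End gaussian_asymptotics.

(** * Convergence and analyticity of the pairing for l > -n *)

Section radial_integral.
Context {R : realType}.
Local Notation mu := (lebesgue_tuple R).
Local Notation tup n := (n.-tuple (measurableTypeR R)).

Lemma integrable_rpow_gauss n (s : R) : 0 < s < n%:R / 2 ->
  (mu n).-integrable setT
    (EFin \o (fun t => rpow (- (2 * s)) (rowt t) * expR (- sqn (rowt t)))).
Proof.
move=> sq; have [m sm] : exists m : nat, s <= m.+1%:R.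
  by exists (Num.trunc s); rewrite ltW// truncnS_gt.
have [B _ IB] := integral_rpow_gauss sq sm (ltn0Sn m).
apply/integrableP; split.
  apply/measurable_EFinP; apply: measurable_funM; first exact: measurable_rpow.
  apply: (@measurable_rowt _ n (fun y => expR (- sqn y))) => y.
  apply: continuous_comp; last exact: continuous_expR.
  by apply: continuousN; exact: continuous_sqn.
rewrite [ltLHS](_ : _ = (n%:R / 2 * pi `^ (n%:R / 2) * B / Gamma (s + 1))%:E) ?ltry//.
rewrite -IB; apply: eq_integral => t _ /=.
by rewrite ger0_norm// mulr_ge0 ?rpow_ge0 ?expR_ge0.
Qed.

(** Inside the unit ball r^l is compared with r^(-2s) e^(-|x|^2), already known to be integrable;
    outside, r^l <= (1+|x|^2)^m is absorbed by the decay of [g]. *)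
Lemma integrable_rpow n (l : R) (g : 'rV[R]_n -> R) : (0 < n)%N -> - n%:R < l ->
  rapid g -> measurable_fun [set: tup n] (g \o @rowt R n) ->
  (mu n).-integrable setT (EFin \o (fun t => rpow l (rowt t) * g (rowt t))).
Proof.
move=> n0 nl gr mg; have nR : 0 < n%:R :> R by rewrite ltr0n.
have [m lm] : exists m : nat, l <= m%:R * 2.
  exists (Num.trunc l).+1; apply: (le_trans (ltW (truncnS_gt l))).
  by rewrite ler_peMr// ler1n.
(* The maximum with n/4 keeps s positive when l >= 0. *)
have [s [s0q sl]] : exists s : R, 0 < s < n%:R / 2 /\ - (2 * s) <= l.
  exists (Num.max (- l / 2) (n%:R / 4)).
  have [h|h] := leP (- l / 2) (n%:R / 4); split; lra.
have [C C0 gC] := rapid_ge0 (m + n) gr.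
apply: (@le_integrable _ (tup n) R (mu n) setT measurableT _ (EFin \o (fun t : tup n =>
  C * (expR 1 * (rpow (- (2 * s)) (rowt t) * expR (- sqn (rowt t))) + wgt n (rowt t))))).
- by apply/measurable_EFinP; apply: measurable_funM => //; exact: measurable_rpow.
- move=> t _ /=; rewrite lee_fin; apply: le_trans (ler_norm _).
  rewrite normrM ger0_norm ?rpow_ge0//.
  apply: (@le_trans _ _ (rpow l (rowt t) * (C * wgt (m + n) (rowt t)))).
    by rewrite ler_wpM2l ?rpow_ge0.
  rewrite mulrCA ler_wpM2l//.
  have u0 := sqn_ge0 (rowt t); have w0 := wgt_gt0 n (rowt t).
  have w1 := wgt_gt0 (m + n) (rowt t).
  have [u1|u1] := leP (sqn (rowt t)) 1.
    apply: (@le_trans _ _ (expR 1 * (rpow (- (2 * s)) (rowt t) * expR (- sqn (rowt t)))));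
      last by rewrite lerDl ltW.
    rewrite mulrCA -expRD /rpow; set u := sqn (rowt t) in u0 u1 *.
    apply: ler_pM; rewrite ?rho_ge0//; first exact: ltW.
      move: u0; rewrite le_eqVlt => /predU1P[<-|u0]; first by rewrite !rho0.
      rewrite !rhoE//; apply: ger_powR; first by rewrite u0.
      by rewrite ler_pM2r.
    apply: (@le_trans _ _ 1).
      by have := le_wgt (rowt t) (leq0n (m + n)); rewrite [X in _ <= X]/wgt expr0 invr1.
    by rewrite -[leLHS]expR0 ler_expR; lra.
  apply: (@le_trans _ _ (wgt n (rowt t))).
    rewrite -(wgtM m n) ler_wpM2r ?(ltW w1)//.
    by apply: rho_le_exp => //; exact: ltW.
  by rewrite lerDr !mulr_ge0 ?rpow_ge0 ?expR_ge0.
- apply: (integrableZl _ _ (f := EFin \o _)) => //.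
  rewrite (_ : EFin \o _ = (fun t : tup n => (expR 1)%:E *
     (EFin \o (fun t => rpow (- (2 * s)) (rowt t) * expR (- sqn (rowt t)))%R) t)
     \+ (EFin \o (@wgt R n n \o @rowt R n)))%E; last first.
    by apply/funext => t; rewrite /= EFinD EFinM.
  apply: integrableD => //; last exact: integrable_wgt.
  by apply: integrableZl => //; exact: integrable_rpow_gauss.
Qed.

Definition good n (g : 'rV[R]_n -> R) := rapid g /\ continuous g.

Lemma good_integrable n (l : R) (g : 'rV[R]_n -> R) : (0 < n)%N -> - n%:R < l ->
  good g ->
  (mu n).-integrable setT (EFin \o (fun t => rpow l (rowt t) * g (rowt t))).
Proof.
by move=> n0 nl [rg cg]; apply: integrable_rpow => //; exact: measurable_rowt.
Qed.

Lemma MintD n (l : R) (g h : 'rV[R]_n -> R) : (0 < n)%N -> - n%:R < l ->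
  good g -> good h -> Mint l (fun x => g x + h x) = Mint l g + Mint l h.
Proof.
move=> n0 nl gg gh; rewrite /Mint -RintegralD//; try exact: good_integrable.
by apply: eq_Rintegral => t _; rewrite mulrDr.
Qed.

Lemma MintZ n (l c : R) (g : 'rV[R]_n -> R) : (0 < n)%N -> - n%:R < l ->
  good g -> Mint l (fun x => c * g x) = c * Mint l g.
Proof.
move=> n0 nl gg; rewrite /Mint -RintegralZl//; last exact: good_integrable.
by apply: eq_Rintegral => t _; rewrite mulrCA.
Qed.

Lemma goodD n (g h : 'rV[R]_n -> R) : good g -> good h -> good (fun x => g x + h x).
Proof.
by move=> [? ?] [? ?]; split; [exact: rapidD|exact: continuous_funD].
Qed.

Lemma goodZ n (c : R) (g : 'rV[R]_n -> R) : good g -> good (fun x => c * g x).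
Proof.
by move=> [? ?]; split; [exact: rapidZ|exact: continuous_funZ].
Qed.

Lemma good_coord n (i : 'I_n) (g : 'rV[R]_n -> R) : good g ->
  good (fun x => x ord0 i * g x).
Proof.
move=> [? ?]; split; first exact: rapid_coord.
by apply: continuous_funM => //; exact: continuous_coord.
Qed.

Lemma expR_norm_le (x : R) : expR `|x| <= expR x + expR (- x).
Proof.
have [x0|x0] := leP 0 x; first by rewrite ger0_norm// lerDl expR_ge0.
by rewrite ltr0_norm// lerDr expR_ge0.
Qed.

Lemma exp_coeff_le (x : R) m : 0 <= x -> x ^+ m / m`!%:R <= expR x.
Proof.
case: m => [|m] x0; first by rewrite expr0 fact0 mulr1n divr1 -[leLHS]expR0 ler_expR.
by apply: le_trans (expR_ge1Dxn m x0); rewrite lerDr.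
Qed.

Lemma norm_series_exp_le (x : R) K :
  `|series (exp_coeff x) K| <= expR x + expR (- x).
Proof.
apply: le_trans (expR_norm_le x).
apply: (@le_trans _ _ (series (exp_coeff `|x|) K)).
  rewrite /series /=; apply: (le_trans (ler_norm_sum _ _ _)); apply: ler_sum => i _.
  by rewrite /exp_coeff /= normrM normrX normfV normr_nat.
apply: nondecreasing_cvgn_le; last exact: is_cvg_series_exp_coeff.
apply/nondecreasing_seqP => k; rewrite seriesSr lerDl.
exact: exp_coeff_ge0.
Qed.

Lemma rho_shift (l y u : R) : 0 <= u ->
  rho (l + y) u = rho l u * expR (y * (ln u / 2)).
Proof.
rewrite le_eqVlt => /predU1P[<-|u0]; first by rewrite !rho0 mul0r.
rewrite rhoD ?ltW// [rho y u]rhoE// /powR gt_eqF//; congr (_ * expR _); ring.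
Qed.

(** Expand r^(l0+y) = r^l0 e^(y ln r) and integrate term by term, with [L] = ln r. All partial sums
    are dominated by |g| (r^(l0+y) + r^(l0-y)), since e^|z| <= e^z + e^(-z). The radius (l0+n)/2
    keeps both exponents above -n. *)
Lemma Mint_analytic n (l0 : R) (g : 'rV[R]_n -> R) : (0 < n)%N -> - n%:R < l0 ->
  good g -> exists a : nat -> R, exists2 e : R, 0 < e & forall y, `|y| < e ->
    series (fun m => a m * y ^+ m) @ \oo --> Mint (l0 + y) g.
Proof.
move=> n0 nl [rg cg]; have mg := measurable_rowt cg.
pose e := (l0 + n%:R) / 2; have e0 : 0 < e by rewrite /e; lra.
pose L (t : tup n) := ln (sqn (rowt t)) / 2.
have mL : measurable_fun setT L.
  apply: measurable_funM => //; apply: (measurableT_comp (@measurable_ln R)).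
  exact: (measurable_rowt (@continuous_sqn R n)).
have rgn : rapid (fun x => `|g x|).
  by move=> N; have [C gC] := rg N; exists C => x; rewrite normr_id.
have mgn : measurable_fun [set: tup n] ((fun x => `|g x|) \o @rowt R n).
  exact: (measurableT_comp (@normr_measurable R _) mg).
have iD y : `|y| <= e -> (mu n).-integrable setT (EFin \o (fun t =>
    rpow (l0 + y) (rowt t) * `|g (rowt t)| + rpow (l0 - y) (rowt t) * `|g (rowt t)|)).
  rewrite ler_norml => /andP[y1 y2].
  rewrite (_ : EFin \o _ = ((EFin \o (fun t : tup n => rpow (l0 + y) (rowt t) * `|g (rowt t)|)%R)
     \+ (EFin \o (fun t => rpow (l0 - y) (rowt t) * `|g (rowt t)|)%R))%E); last first.
    by apply/funext => t; rewrite /= EFinD.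
  apply: integrableD => //.
    by apply: (@integrable_rpow n (l0 + y) (fun x => `|g x|)) => //; rewrite /e in y1 y2; lra.
  by apply: (@integrable_rpow n (l0 - y) (fun x => `|g x|)) => //; rewrite /e in y1 y2; lra.
pose b m (t : tup n) := rpow l0 (rowt t) * g (rowt t) * (L t ^+ m / m`!%:R).
have mb m : measurable_fun setT (b m).
  apply: measurable_funM; first by apply: measurable_funM => //; exact: measurable_rpow.
  by apply: measurable_funM => //; exact: measurable_funX.
have domE y t : rpow l0 (rowt t) * `|g (rowt t)| * (expR (y * L t) + expR (- (y * L t))) =
    rpow (l0 + y) (rowt t) * `|g (rowt t)| + rpow (l0 - y) (rowt t) * `|g (rowt t)|.
  by rewrite /rpow !rho_shift ?sqn_ge0// mulNr /L; ring.
have ib m : (mu n).-integrable setT (EFin \o b m).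
  have := iD e; rewrite gtr0_norm// lexx => /(_ isT) iDe.
  apply: (@le_integrable _ (tup n) R (mu n) setT measurableT _ (EFin \o (fun t : tup n =>
    e ^- m * (rpow (l0 + e) (rowt t) * `|g (rowt t)| + rpow (l0 - e) (rowt t) * `|g (rowt t)|)))).
  - exact/measurable_EFinP.
  - move=> t _ /=; rewrite lee_fin; apply: le_trans (ler_norm _).
    rewrite -domE /b normrM normrM [`|rpow _ _|]ger0_norm ?rpow_ge0// mulrCA.
    apply: ler_wpM2l; first by rewrite mulr_ge0 ?rpow_ge0.
    rewrite [leRHS]mulrC ler_pdivlMr ?exprn_gt0// normrM normfV normr_nat normrX.
    rewrite mulrAC -exprMn.
    apply: (le_trans (exp_coeff_le m _)); first by rewrite mulr_ge0 ?(ltW e0).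
    have := expR_norm_le (e * L t).
    by rewrite normrM (gtr0_norm e0) mulrC.
  - by apply: (integrableZl _ _ iDe).
exists (fun m => \int[mu n]_t b m t); exists e => // y ye.
have iDy := iD y (ltW ye).
have SE K t : \sum_(0 <= m < K) y ^+ m * b m t =
    rpow l0 (rowt t) * g (rowt t) * series (exp_coeff (y * L t)) K.
  rewrite /series /= mulr_sumr; apply: eq_bigr => m _.
  rewrite /b /exp_coeff /= (exprMn _ y); set A := rpow _ _ * _.
  by rewrite mulrCA -!mulrA.
have ibm K m : (mu n).-integrable setT (EFin \o (fun t => y ^+ m * b m t)).
  by apply: (integrableZl _ _ (ib m)).
have -> : series (fun m => (\int[mu n]_t b m t) * y ^+ m) =
    (fun K => \int[mu n]_t (\sum_(0 <= m < K) y ^+ m * b m t)).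
  apply/funext => K; rewrite Rintegral_sum; last exact: ibm.
  apply: eq_bigr => m _; rewrite RintegralZl// 1?mulrC//; exact: ib.
have [| | | | |i1 _] := @dominated_convergence _ (tup n) R (mu n) setT measurableT
  (fun K => EFin \o (fun t => \sum_(0 <= m < K) y ^+ m * b m t))
  (EFin \o (fun t => rpow (l0 + y) (rowt t) * g (rowt t)))
  (EFin \o (fun t => rpow (l0 + y) (rowt t) * `|g (rowt t)| +
                     rpow (l0 - y) (rowt t) * `|g (rowt t)|)).
- move=> K; apply/measurable_EFinP; apply: measurable_sum => m.
  exact: measurable_funM.
- by apply/measurable_EFinP; apply: measurable_funM => //; exact: measurable_rpow.
- apply: aeW => t _; apply: cvg_EFin; first by near=> K.
  rewrite [X in X @ _](_ : _ = (fun K => rpow l0 (rowt t) * g (rowt t) *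
      series (exp_coeff (y * L t)) K)); last first.
    by apply/funext => K /=; rewrite SE.
  rewrite /= (_ : rpow (l0 + y) _ * _ = rpow l0 (rowt t) * g (rowt t) * expR (y * L t)).
    by apply: cvgM; [exact: cvg_cst|exact: is_cvg_series_exp_coeff].
  by rewrite /rpow rho_shift ?sqn_ge0// -/(L t); ring.
- exact: iDy.
- apply: aeW => t K _ /=; rewrite lee_fin SE -domE 2!normrM.
  rewrite [`|rpow _ _|]ger0_norm ?rpow_ge0//.
  apply: ler_wpM2l; first by rewrite mulr_ge0 ?rpow_ge0.
  exact: norm_series_exp_le.
rewrite /Mint /Rintegral => H; apply: fine_cvg.
rewrite fineK//.
exact: (integrable_fin_num measurableT i1).
Unshelve. all: by end_near. Qed.

End radial_integral.

(** * The residue of r^l at l = -n *)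

Section radial_residue.
Context {R : realType}.
Local Notation mu := (lebesgue_tuple R).
Local Notation tup n := (n.-tuple (measurableTypeR R)).

Lemma integrable_funD d (T : measurableType d) (nu : {measure set T -> \bar R})
    (f g : T -> R) :
  nu.-integrable setT (EFin \o f) -> nu.-integrable setT (EFin \o g) ->
  nu.-integrable setT (EFin \o (fun t => f t + g t)).
Proof.
move=> if_ ig; have -> : EFin \o (fun t => f t + g t) = ((EFin \o f) \+ (EFin \o g))%E.
  by apply/funext => t; rewrite /= EFinD.
exact: integrableD.
Qed.

Lemma integrable_funZ d (T : measurableType d) (nu : {measure set T -> \bar R})
    (c : R) (f : T -> R) : nu.-integrable setT (EFin \o f) ->
  nu.-integrable setT (EFin \o (fun t => c * f t)).
Proof. by move=> if_; apply: (integrableZl _ _ if_). Qed.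

Definition sphere_area n : R := n%:R * pi `^ (n%:R / 2) / Gamma (n%:R / 2 + 1).

Let gauss n (x : 'rV[R]_n) : R := expR (- sqn x).

Lemma good_gauss n : good (@gauss n).
Proof.
have -> : @gauss n = (fun x => expR (- (1 * sqn x))).
  by apply/funext => x; rewrite mul1r.
by split; [exact: rapid_gauss|exact: continuous_gauss].
Qed.

Variables (n : nat) (l : nat -> R).
Hypotheses (n0 : (0 < n)%N) (l0 : forall m, - n%:R < l m < 0).
Hypothesis ll : l @ \oo --> (- n%:R : R).

Let nl m : - n%:R < l m. Proof. by have /andP[] := l0 m. Qed.

(** Put s = -l/2, which is positive because l < 0, and q = n/2. Then l + n = 2(q - s) cancels the
    pole of the Beta factor [B], leaving the limit 1, while Gamma(s+1) tends to Gamma(q+1). *)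
Lemma Mint_gauss_cvg :
  (l m + n%:R) * Mint (l m) (@gauss n) @[m --> \oo] --> sphere_area n.
Proof.
set q := n%:R / 2 : R.
have q0 : 0 < q by rewrite divr_gt0// ltr0n.
have [M qM] : exists M : nat, q <= M.+1%:R.
  by exists (Num.trunc q); rewrite ltW// truncnS_gt.
pose s m := - l m / 2.
have s0 m : 0 < s m < q.
  by have /andP[h1 h2] := l0 m; rewrite /s /q; apply/andP; split; lra.
have s0' m : 0 < s m by have /andP[] := s0 m.
have sq : s @ \oo --> q.
  have -> : q = - (- n%:R) / 2 by rewrite opprK.
  by apply: cvgM; [exact: cvgN|exact: cvg_cst].
have /choice[B HB] m : exists B, (q - s m)^-1 - M.+1%:R <= B <= (q - s m)^-1 /\
    Mint (l m) (@gauss n) = q * pi `^ q * B / Gamma (s m + 1).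
  have sM : s m <= M.+1%:R by have /andP[_ h] := s0 m; lra.
  have [B HB IB] := integral_rpow_gauss (s0 m) sM (ltn0Sn M).
  exists B; split => //; rewrite /Mint /Rintegral.
  have -> : l m = - (2 * s m) by rewrite /s; field.
  by rewrite IB.
have Gq := Gamma_gt0 q0.
have cG : Gamma (s m + 1) @[m --> \oo] --> Gamma (q + 1).
  exact: fine_cvg (Gamma_cvg q0 s0' sq).
have cB : (q - s m) * B m @[m --> \oo] --> (1 : R).
  have ce : q - s m @[m --> \oo] --> (0 : R).
    rewrite -(subrr q); apply: cvgB => //; exact: cvg_cst.
  apply: (@squeeze_cvgr _ _ _ _ (fun m => 1 - M.+1%:R * (q - s m)) (cst 1)).
  - near=> m; have [/andP[b1 b2] _] := HB m; have /andP[_ h] := s0 m.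
    have e0 : 0 < q - s m by lra.
    have E : (q - s m) * (q - s m)^-1 = 1 by rewrite divff// gt_eqF.
    apply/andP; split.
      have -> : 1 - M.+1%:R * (q - s m) = (q - s m) * ((q - s m)^-1 - M.+1%:R).
        by rewrite [RHS]mulrBr E mulrC.
      by rewrite ler_pM2l.
    by rewrite /= -E ler_pM2l.
  - rewrite -[X in _ --> X]subr0 -(mulr0 M.+1%:R); apply: cvgB; first exact: cvg_cst.
    by apply: cvgM => //; exact: cvg_cst.
  - exact: cvg_cst.
have -> : (fun m => (l m + n%:R) * Mint (l m) (@gauss n)) =
    (fun m => n%:R * pi `^ q * ((q - s m) * B m) / Gamma (s m + 1)).
  apply/funext => m; have [_ ->] := HB m.
  have -> : l m + n%:R = 2 * (q - s m) by rewrite /s /q; field.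
  have -> : n%:R = 2 * q :> R by rewrite /q; field.
  by rewrite !mulrA; congr (_ / _); ring.
rewrite /sphere_area -/q -[X in X / _](mulr1 (n%:R * pi `^ q)).
apply: cvgM; last by apply: cvgV => //; rewrite gt_eqF.
by apply: cvgM => //; exact: cvg_cst.
Unshelve. all: by end_near. Qed.

Lemma Mint_ge0 (l1 : R) (g : 'rV[R]_n -> R) : (forall x, 0 <= g x) -> 0 <= Mint l1 g.
Proof. by move=> g0; apply: Rintegral_ge0 => t _; rewrite mulr_ge0 ?rpow_ge0. Qed.

(** Near the origin [f] is small by continuity; at distance at least r from it, |x|^2 / r^2 >= 1.
    The factor |x|^2 raises the exponent l to l + 2, so the second term has no pole at l = -n. *)
Lemma near_gauss (f : 'rV[R]_n -> R) (e : R) : continuous f -> f 0 = 0 -> 0 < e ->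
  exists2 d, 0 < d & forall x, `|f x| <= e * gauss x + d * (sqn x * `|f x|).
Proof.
move=> cf f0 e0.
pose psi x := f x * expR (sqn x).
have cpsi : continuous psi.
  apply: continuous_funM => // x.
  by apply: continuous_comp; [exact: continuous_sqn|exact: continuous_expR].
have psi0 : psi 0 = 0 by rewrite /psi f0 mul0r.
have /nbhs_ballP[r r0 rpsi] : nbhs (0 : 'rV[R]_n) [set x | `|psi x| < e].
  have := cpsi 0; rewrite /continuous_at psi0 => /cvgrPdist_lt /(_ _ e0).
  by apply: filterS => x; rewrite sub0r normrN.
exists (r ^- 2); first by rewrite invr_gt0 exprn_gt0.
move=> x; have g0 : 0 < gauss x by exact: expR_gt0.
have [xr|xr] := ltP (sqn x) (r ^+ 2).
  apply: (@le_trans _ _ (e * gauss x)).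
    have : `|psi x| < e.
      apply: rpsi; split => // i j; rewrite (ord1 i) mxE /ball /= sub0r normrN.
      rewrite -(@ltr_pXn2r _ 2)// ?nnegrE ?(ltW r0)// real_normK ?num_real//.
      exact: le_lt_trans (sqr_le_sqn x j) xr.
    rewrite /psi normrM (ger0_norm (expR_ge0 _)) => /ltW.
    by rewrite /gauss expRN -ler_pdivlMr ?invr_gt0 ?expR_gt0// invrK.
  by rewrite lerDl !mulr_ge0 ?sqn_ge0// invr_ge0 exprn_ge0// ltW.
apply: (@le_trans _ _ (r ^- 2 * (sqn x * `|f x|))); last by rewrite lerDr mulr_ge0 ?ltW.
by rewrite mulrA ler_peMl// mulrC ler_pdivlMr ?exprn_gt0// mul1r.
Qed.

Lemma Mint_vanishing_cvg (f : 'rV[R]_n -> R) : good f -> f 0 = 0 ->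
  (l m + n%:R) * Mint (l m) f @[m --> \oo] --> (0 : R).
Proof.
move=> gf f0; have [rf cf] := gf.
have gfn : good (fun x => `|f x|).
  split.
    by move=> N; have [C fC] := rf N; exists C => x; rewrite normr_id.
  by move=> x; apply: (@continuous_comp _ _ _ f (@Num.norm R R)); [exact: cf|exact: norm_continuous].
have nR : 0 < n%:R :> R by rewrite ltr0n.
(* As l lies in (-n, 0), the power r^(l+2) is at most r^(2-n) + r^2, so [K] bounds its pairing with
   |f| uniformly in the sequence. *)
pose K := Mint (2 - n%:R) (fun x => `|f x|) + Mint 2 (fun x => `|f x|).
have K0 : 0 <= K by rewrite addr_ge0// Mint_ge0.
have Gg n' : good (@gauss n') by exact: good_gauss.
have A0 : 0 <= sphere_area n.
  rewrite /sphere_area divr_ge0 ?mulr_ge0 ?powR_ge0//.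
  by rewrite ltW// Gamma_gt0// divr_gt0.
apply/cvgrPdist_le => e e0; set A := sphere_area n in A0.
(* The Gaussian term will be at most (A+1) e/(A+2), because (l+n) times the Gaussian pairing is
   eventually below A+1; the term with [K] will be at most e/(A+2). *)
have e1 : 0 < e / (A + 2) by rewrite divr_gt0//; lra.
have [d d0 fd] := near_gauss cf f0 e1.
have dK0 : 0 <= d * K by rewrite mulr_ge0// ltW.
have e2 : 0 < e / (A + 2) / (d * K + 1) by rewrite divr_gt0//; lra.
near=> m; rewrite sub0r normrN.
have /andP[l1 l2] := l0 m.
have h0 : 0 < l m + n%:R by lra.
have n2 : - n%:R < 2 - n%:R :> R by lra.
have n2' : - n%:R < 2 :> R by lra.
have gl : (mu n).-integrable setT (EFin \o (fun t => rpow (l m) (rowt t) * f (rowt t))).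
  exact: good_integrable.
have MK : `|Mint (l m) f| <= e / (A + 2) * Mint (l m) (@gauss n) + d * K.
  have iG := good_integrable n0 l1 (Gg n).
  have i1 := good_integrable n0 n2 gfn.
  have i2 := good_integrable n0 n2' gfn.
  apply: (le_trans (le_normr_Rintegral _ gl)) => //.
  have i12 := integrable_funD i1 i2.
  have E1 : d * K = \int[mu n]_t (d * (rpow (2 - n%:R) (rowt t) * `|f (rowt t)| +
      rpow 2 (rowt t) * `|f (rowt t)|)).
    by rewrite RintegralZl// RintegralD.
  have E2 : e / (A + 2) * Mint (l m) (@gauss n) =
      \int[mu n]_t (e / (A + 2) * (rpow (l m) (rowt t) * gauss (rowt t))).
    by rewrite RintegralZl.
  have iG' := integrable_funZ (e / (A + 2)) iG.
  have i12' := integrable_funZ d i12.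
  rewrite E1 E2 -RintegralD//; apply: le_Rintegral => //.
  - exact: integrable_norm gl.
  - exact: integrable_funD.
  - move=> t _; rewrite normrM ger0_norm ?rpow_ge0//.
    apply: (le_trans (ler_wpM2l (rpow_ge0 _ _) (fd _))).
    rewrite mulrDr mulrCA lerD2l mulrCA ler_wpM2l ?(ltW d0)//.
    rewrite -mulrDl mulrA ler_wpM2r// /rpow -[X in _ * X <= _](rho2 (sqn_ge0 (rowt t))).
    rewrite -rhoD ?sqn_ge0//; apply: rho_le_add; first exact: sqn_ge0.
    by apply/andP; split; lra.
rewrite normrM gtr0_norm//.
apply: (le_trans (ler_wpM2l (ltW h0) MK)).
rewrite mulrDr mulrCA.
have H1 : (l m + n%:R) * Mint (l m) (@gauss n) <= A + 1.
  by near: m; apply: (cvgr_le A Mint_gauss_cvg); rewrite ltrDl.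
have H2 : (l m + n%:R) * (d * K) <= e / (A + 2).
  apply: (@le_trans _ _ (e / (A + 2) / (d * K + 1) * (d * K))).
    rewrite ler_wpM2r//; near: m.
    have c0 : l m + n%:R @[m --> \oo] --> (0 : R).
      by rewrite -(addNr n%:R); apply: cvgD => //; exact: cvg_cst.
    exact: (cvgr_le 0 c0).
  rewrite -mulrA ler_piMr ?(ltW e1)// mulrC ler_pdivrMr; lra.
apply: (@le_trans _ _ (e / (A + 2) * (A + 1) + e / (A + 2))).
  by apply: lerD => //; rewrite ler_pM2l.
rewrite -[X in _ + X]mulr1 -mulrDr -mulrA ler_piMr ?(ltW e0)//.
rewrite mulrC ler_pdivrMr; lra.
Unshelve. all: by end_near. Qed.

Lemma Mint_cvg (g : 'rV[R]_n -> R) : good g ->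
  (l m + n%:R) * Mint (l m) g @[m --> \oo] --> sphere_area n * g 0.
Proof.
move=> gg.
have gf : good (fun x => g x + (- g 0) * gauss x).
  by apply: goodD => //; apply: goodZ; exact: good_gauss.
have f0 : g 0 + (- g 0) * gauss (0 : 'rV[R]_n) = 0.
  have -> : gauss (0 : 'rV[R]_n) = 1.
    rewrite /gauss /sqn big1 ?oppr0 ?expR0// => i _.
    by rewrite mxE expr0n.
  by rewrite mulr1 subrr.
rewrite (_ : (fun m => _) = (fun m =>
    (l m + n%:R) * Mint (l m) (fun x => g x + (- g 0) * gauss x) +
    (l m + n%:R) * Mint (l m) (@gauss n) * g 0)); last first.
  apply/funext => m.
  rewrite MintD//; last by apply: goodZ; exact: good_gauss.
  by rewrite MintZ//; [ring|exact: good_gauss].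
rewrite -[X in _ --> X]add0r; apply: cvgD; first exact: Mint_vanishing_cvg.
by apply: cvgM; [exact: Mint_gauss_cvg|exact: cvg_cst].
Qed.

End radial_residue.

(** * Meromorphic functions on the real line *)

Section meromorphic.
Context {R : realType}.
Implicit Types (h : R -> R) (a : nat -> R).

Definition laurent_coef h (x0 : R) (N : nat) a := exists2 e : R, 0 < e &
  forall y, 0 < `|y| < e ->
    series (fun m => a m * y ^+ m) @ \oo --> y ^+ N * h (x0 + y).

(** Nothing is said about [h x0], since the continuation may take any value at a pole. For the same
    reason [eventually_zero] concerns a punctured interval. *)
Definition mero h (x0 : R) := exists N a, laurent_coef h x0 N a.

Definition eventually_zero h (x0 : R) := exists2 e : R, 0 < e &
  forall y, 0 < `|y| < e -> h (x0 + y) = 0.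

Lemma sum_expr_le2 (t : R) K : 0 <= t <= 2^-1 -> \sum_(i < K) t ^+ i <= 2.
Proof.
move=> /andP[t0 t1]; have := subrX1 t K; set S := \sum_(i < K) _ => E.
have S0 : 0 <= S by apply: sumr_ge0 => i _; exact: exprn_ge0.
have : 0 <= t ^+ K by exact: exprn_ge0.
nra.
Qed.

(** Convergence at radius r = e/2 bounds the coefficients by C / r^m. For |y| < r/2 the tail is then
    dominated by a geometric series of ratio at most 1/2, whose sum accounts for the factor 2. *)
Lemma power_series_leading a (e : R) (phi : R -> R) (m0 : nat) :
  0 < e -> (forall y, 0 < `|y| < e -> series (fun m => a m * y ^+ m) @ \oo --> phi y) ->
  (forall m, (m < m0)%N -> a m = 0) ->
  exists C d : R, [/\ 0 < d, 0 <= C &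
    forall y, 0 < `|y| < d -> `|phi y - a m0 * y ^+ m0| <= C * `|y| ^+ m0.+1].
Proof.
move=> e0 aphi am0.
pose r := e / 2; have r0 : 0 < r by rewrite divr_gt0.
have rn0 : r != 0 by rewrite gt_eqF.
have re : 0 < `|r| < e by rewrite gtr0_norm// r0 /r ltr_pdivrMr//; lra.
have [C C0 aC] : exists2 C, 0 <= C & forall m, `|a m| <= C / r ^+ m.
  have cs : cvgn (series (fun m => a m * r ^+ m)) by apply/cvg_ex; exists (phi r); exact: aphi.
  have /cvg_seq_bounded[M [_ HM]] : cvgn (fun m => a m * r ^+ m).
    by apply/cvg_ex; exists 0; exact: cvg_series_cvg_0 cs.
  have HM1 := HM (`|M| + 1) _.
  exists (`|M| + 1); first by rewrite addr_ge0.
  move=> m; rewrite ler_pdivlMr ?exprn_gt0// -{1}(gtr0_norm r0) -normrX -normrM.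
  by apply: HM1 => //; rewrite (le_lt_trans (ler_norm _))// ltrDl.
exists (2 * C / r ^+ m0.+1), (r / 2); split.
- by rewrite divr_gt0.
- by rewrite divr_ge0 ?mulr_ge0// exprn_ge0// ltW.
move=> y /andP[y0 yr].
have ye : 0 < `|y| < e by rewrite y0/= (lt_trans yr)// /r; lra.
have cy := aphi y ye.
have cd : `|series (fun m => a m * y ^+ m) K - a m0 * y ^+ m0| @[K --> \oo] -->
    `|phi y - a m0 * y ^+ m0|.
  by apply: cvg_norm; apply: cvgB => //; exact: cvg_cst.
apply: (ler_cvg_to cd (cvg_cst _)); near=> K.
have mK : (m0 < K)%N by near: K; exact: nbhs_infty_gt.
pose t := `|y| / r.
have t01 : 0 <= t <= 2^-1.
  by rewrite divr_ge0 ?(ltW r0)//= ler_pdivrMr// mulrC ltW.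
have -> : series (fun m => a m * y ^+ m) K - a m0 * y ^+ m0 =
    \sum_(m0.+1 <= m < K) a m * y ^+ m.
  rewrite /series /= (big_cat_nat (n := m0)) ?(ltnW mK)//= big_nat_cond big1.
    by rewrite add0r big_ltn// addrAC subrr add0r.
  by move=> m; rewrite andbT => /andP[_ /am0 ->]; rewrite mul0r.
apply: (le_trans (ler_norm_sum _ _ _)).
apply: (@le_trans _ _ (\sum_(m0.+1 <= m < K) C * t ^+ m)).
  apply: ler_sum => m _; rewrite normrM normrX /t expr_div_n mulrA mulrAC.
  by rewrite ler_wpM2r// exprn_ge0.
rewrite -mulr_sumr -{1}(add0n m0.+1) big_addn big_mkord.
rewrite (eq_bigr (fun i : 'I__ => t ^+ m0.+1 * t ^+ i)); last first.
  by move=> i _; rewrite exprD mulrC.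
rewrite -mulr_sumr.
apply: (@le_trans _ _ (C * (t ^+ m0.+1 * 2))).
  apply: ler_wpM2l => //; apply: ler_wpM2l; last exact: sum_expr_le2.
  by rewrite exprn_ge0//; have /andP[] := t01.
by rewrite /t expr_div_n le_eqVlt; apply/orP; left; apply/eqP; field; rewrite expf_neq0.
Unshelve. all: by end_near. Qed.

(** Either all coefficients vanish, or the first nonzero one dominates the rest of the series close
    to [x0]. *)
Lemma laurent_dichotomy h (x0 : R) : mero h x0 ->
  eventually_zero h x0 \/
  exists2 e : R, 0 < e & forall y, 0 < `|y| < e -> h (x0 + y) != 0.
Proof.
move=> [N [a [e e0 ha]]].
have [a0|/existsNP[m1 am1]] := pselect (forall m, a m = 0).
  left; exists e => // y ye; have y0 : y != 0.
    by move: ye => /andP[y0 _]; rewrite -normr_gt0.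
  have c0 : series (fun m => a m * y ^+ m) @ \oo --> (0 : R).
    apply: cvg_near_cst; near=> K; rewrite /series /= big1// => m _.
    by rewrite a0 mul0r.
  have : y ^+ N * h (x0 + y) = 0 by exact: norm_cvg_unique (ha y ye) c0.
  move/eqP.
  by rewrite mulf_eq0 expf_eq0 (negbTE y0) andbF /= => /eqP.
right.
have ex : exists m, a m != 0 by exists m1; exact/eqP.
have [m0 am0 minm] := ex_minnP ex.
have am m : (m < m0)%N -> a m = 0.
  by move=> mm; apply/eqP; apply: contraTT mm => /minm; rewrite -leqNgt.
have [C [d [d0 C0 H]]] := power_series_leading e0 ha am.
have A0 : 0 < `|a m0| by rewrite normr_gt0.
exists (Num.min d (`|a m0| / (C + 1))).
  by rewrite lt_min d0 divr_gt0//; lra.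
move=> y /andP[y0]; rewrite lt_min => /andP[yd yC].
apply/eqP => hy0.
have := H y; rewrite y0 yd hy0 mulr0 sub0r normrN normrM normrX => /(_ isT).
rewrite exprS mulrA ler_pM2r ?exprn_gt0//.
move: yC; rewrite ltr_pdivlMr; last by lra.
have := normr_ge0 y; nra.
Unshelve. all: by end_near. Qed.

(** Let s be the supremum of the points above c around which [h] is not eventually zero; it exists
    because no such point exceeds L. Both cases of the dichotomy at s are contradictory. *)
Lemma mero_identity h (c L : R) : (forall x, c < x -> mero h x) ->
  (forall x, L < x -> h x = 0) -> forall x, c < x -> eventually_zero h x.
Proof.
move=> hm hL x0 cx0; apply: contrapT => nZ.
pose S := [set x | c < x /\ ~ eventually_zero h x].
have SL x : S x -> x <= L.
  move=> [_ nZx]; rewrite leNgt; apply/negP => Lx; apply: nZx.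
  exists (x - L) => [|y /andP[_ yL]]; first by rewrite subr_gt0.
  apply: hL; rewrite -ltrBlDl; move: yL; rewrite ltr_norml => /andP[+ _]; lra.
have Sx0 : S x0 by [].
have supS : has_sup S by split; [exists x0|exists L => x /SL].
pose s := sup S.
have x0s : x0 <= s by apply: sup_upper_bound.
have cs : c < s by exact: lt_le_trans cx0 x0s.
have [[e e0 ze]|[e e0 nze]] := laurent_dichotomy (hm s cs).
  (* If [h] vanishes around s, then it vanishes around every point close enough to s, including some
     point of [S]. *)
  have [x Sx xe] := sup_adherent e0 supS.
  have xs : x <= s by apply: sup_upper_bound.
  have [xE|xns] := eqVneq x s.
    by case: Sx => _; apply; exists e => // y ye; rewrite xE; exact: ze.
  have xls : x < s by rewrite lt_neqAle xns.
  case: Sx => _; apply; exists (Num.min (s - x) (x - (s - e))).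
    by rewrite lt_min !subr_gt0 xls.
  move=> y /andP[y0]; rewrite lt_min => /andP[y1 y2].
  have -> : x + y = s + (x + y - s) by ring.
  apply: ze; move: y1 y2; rewrite !ltr_norml => /andP[y1 y1'] /andP[y2 y2'].
  rewrite normr_gt0; apply/andP; split; last by rewrite -/s in xe y2 y2' *; apply/andP; split; lra.
  by rewrite subr_eq0 lt_eqF//; lra.
(* If [h] has no zero close to s, take a point just to the right of s: it lies outside [S], so [h]
   vanishes around it. *)
pose x := s + e / 2.
have sx : s < x by rewrite ltrDl divr_gt0.
have [e' e'0 zx] : eventually_zero h x.
  apply: contrapT => nZx.
  have : x <= s by apply: sup_upper_bound => //; split => //; exact: lt_trans cs sx.
  by rewrite leNgt sx.
pose y := Num.min (e / 4) (e' / 2).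
have y0 : 0 < y by rewrite lt_min !divr_gt0.
have y1 : y <= e / 4 by rewrite ge_min lexx.
have y2 : y <= e' / 2 by rewrite ge_min lexx orbT.
have : h (x + y) = 0 by apply: zx; rewrite gtr0_norm// y0/=; lra.
apply/eqP; rewrite /x -addrA; apply: nze; rewrite gtr0_norm; last by lra.
by apply/andP; split; lra.
Qed.

(** Raising the order brings two expansions to a common [N], so that they can be added. *)
Lemma laurent_pad h x0 N a : laurent_coef h x0 N a ->
  laurent_coef h x0 N.+1 (fun m => if m is m'.+1 then a m' else 0).
Proof.
move=> [e e0 ha]; exists e => // y ye.
rewrite exprS -mulrA -(cvg_shiftS (series _)).
rewrite (_ : (fun K => _) = (fun K => y * series (fun m => a m * y ^+ m) K)); last first.
  apply/funext => K; rewrite /series /= big_nat_recl// mul0r add0r mulr_sumr.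
  by apply: eq_bigr => i _; rewrite exprS; ring.
by apply: cvgM; [exact: cvg_cst|exact: ha].
Qed.

Lemma laurent_pad_le h x0 N N' a : laurent_coef h x0 N a -> (N <= N')%N ->
  exists a', laurent_coef h x0 N' a'.
Proof.
move=> ha /subnK <-; elim: (N' - N)%N => [|k [a' ih]]; first by exists a.
by rewrite addSn; eexists; exact: laurent_pad ih.
Qed.

Lemma laurentD h1 h2 x0 N a1 a2 : laurent_coef h1 x0 N a1 ->
  laurent_coef h2 x0 N a2 ->
  laurent_coef (fun x => h1 x + h2 x) x0 N (fun m => a1 m + a2 m).
Proof.
move=> [e1 e10 ha1] [e2 e20 ha2]; exists (Num.min e1 e2); first by rewrite lt_min e10.
move=> y /andP[y0]; rewrite lt_min => /andP[y1 y2].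
rewrite (_ : series _ = series (fun m => a1 m * y ^+ m) + series (fun m => a2 m * y ^+ m)).
  by rewrite mulrDr; apply: cvgD; [apply: ha1; rewrite y0|apply: ha2; rewrite y0].
by apply/funext => K; rewrite /series /= fctE -big_split /=; apply: eq_bigr => i _; rewrite mulrDl.
Qed.

Lemma laurentZ h x0 N a (c : R) : laurent_coef h x0 N a ->
  laurent_coef (fun x => c * h x) x0 N (fun m => c * a m).
Proof.
move=> [e e0 ha]; exists e => // y ye.
rewrite (_ : series _ = (fun K => c * series (fun m => a m * y ^+ m) K)).
  by rewrite mulrCA; apply: cvgM; [exact: cvg_cst|exact: ha].
apply/funext => K; rewrite /series /= mulr_sumr; apply: eq_bigr => i _.
by rewrite mulrA.
Qed.

Lemma meroD h1 h2 x0 : mero h1 x0 -> mero h2 x0 -> mero (fun x => h1 x + h2 x) x0.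
Proof.
move=> [N1 [a1 H1]] [N2 [a2 H2]].
have [a1' H1'] := laurent_pad_le H1 (leq_addr N2 N1).
have [a2' H2'] := laurent_pad_le H2 (leq_addl N1 N2).
by exists (N1 + N2)%N; eexists; exact: laurentD H1' H2'.
Qed.

Lemma meroZ (c : R) h x0 : mero h x0 -> mero (fun x => c * h x) x0.
Proof. by move=> [N [a H]]; exists N; eexists; exact: laurentZ H. Qed.

Lemma mero_mulX h x0 : mero h x0 -> mero (fun x => x * h x) x0.
Proof.
move=> [N [a H]].
have H1 : mero (fun x => (x - x0) * h x) x0.
  exists N; exists (fun m => if m is m'.+1 then a m' else 0).
  have [e e0 He] := laurent_pad H; exists e => // y ye.
  by rewrite (_ : x0 + y - x0 = y) ?mulrA -?exprSr; [exact: He|ring].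
have := meroD H1 (meroZ x0 (ex_intro _ N (ex_intro _ a H))).
by congr mero; apply/funext => x; ring.
Qed.

Lemma mero_linear (c : R) h x0 : mero h x0 -> mero (fun x => (x + c) * h x) x0.
Proof.
move=> H; have := meroD (mero_mulX H) (meroZ c H).
by congr mero; apply/funext => x; ring.
Qed.

Lemma mero_power_series h x0 a (e : R) : 0 < e ->
  (forall y, `|y| < e -> series (fun m => a m * y ^+ m) @ \oo --> h (x0 + y)) ->
  mero h x0.
Proof.
move=> e0 H; exists 0%N, a, e => // y /andP[_ ye].
by rewrite expr0 mul1r; exact: H.
Qed.

Lemma laurent_simple_pole h x0 a (l : nat -> R) : laurent_coef h x0 1 a ->
  (forall m, 0 < l m) -> l @ \oo --> (0 : R) ->
  l m * h (x0 + l m) @[m --> \oo] --> a 0%N.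
Proof.
move=> [e e0 H] l0 ll.
have H' y : 0 < `|y| < e -> series (fun m => a m * y ^+ m) @ \oo --> y * h (x0 + y).
  by move=> /H; rewrite expr1.
have am m : (m < 0)%N -> a m = 0 by [].
have [C [d [d0 C0 Hd]]] := power_series_leading e0 H' am.
have c1 : C * l m @[m --> \oo] --> (0 : R).
  by rewrite -(mulr0 C); apply: cvgM => //; exact: cvg_cst.
have c2 : - (C * l m) @[m --> \oo] --> (0 : R) by rewrite -oppr0; exact: cvgN.
apply/subr_cvg0; apply: (squeeze_cvgr _ c2 c1); near=> m.
have lm0 := l0 m; have lmd : l m < d by near: m; exact: (cvgr_lt 0 ll).
rewrite -ler_norml; have := Hd (l m); rewrite gtr0_norm// lm0 lmd expr0 mulr1 expr1.
exact.
Unshelve. all: by end_near. Qed.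

End meromorphic.

(** * Schwartz functions *)

Section schwarz_theorem.
Context {R : realType} {n : nat}.
Implicit Types (x : 'rV[R]_n) (i j : 'I_n).

Local Notation ei i := (delta_mx ord0 i : 'rV[R]_n).

Lemma is_derive_on_line (g g' : 'rV[R]_n -> R) i x (s : R) :
  (forall y, is_derive y (ei i) g (g' y)) ->
  is_derive s (1 : R) (fun s => g (s *: ei i + x)) (g' (s *: ei i + x)).
Proof.
move=> dg; apply: is_derive_along (dg (s *: ei i + x)) => h.
by rewrite [h *: 1]mulr1 scalerDl addrA.
Qed.

Lemma MVT_line (g g' : 'rV[R]_n -> R) i x (h : R) : 0 < h ->
  (forall y, is_derive y (ei i) g (g' y)) ->
  exists2 s, 0 <= s <= h & g (h *: ei i + x) - g x = g' (s *: ei i + x) * h.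
Proof.
move=> h0 dg.
have dl s := is_derive_on_line x s dg.
have [|c] := @MVT R (fun s => g (s *: ei i + x)) (fun s => g' (s *: ei i + x)) 0 h h0 (fun s _ => dl s).
  apply: continuous_subspaceT => s; apply: differentiable_continuous.
  by apply/derivable1_diffP; apply: ex_derive.
rewrite in_itv/= => /andP[c0 ch] E; exists c; first by rewrite !ltW.
by move: E; rewrite scale0r add0r subr0.
Qed.

(** The second difference of [g] over a square of side h equals h^2 times either mixed derivative at
    some point of the square, by the mean value theorem applied twice in either order. Continuity of
    both derivatives then lets h shrink. *)
Lemma schwarz_partials (g gi gj gij gji : 'rV[R]_n -> R) i j x :
  (forall y, is_derive y (ei i) g (gi y)) ->
  (forall y, is_derive y (ei j) g (gj y)) ->
  (forall y, is_derive y (ei j) gi (gij y)) ->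
  (forall y, is_derive y (ei i) gj (gji y)) ->
  continuous gij -> continuous gji -> gij x = gji x.
Proof.
move=> dgi dgj dgij dgji cij cji.
have key h : 0 < h -> exists s t s' t', [/\ 0 <= s <= h, 0 <= t <= h, 0 <= s' <= h, 0 <= t' <= h &
    gij (t *: ei j + (s *: ei i + x)) = gji (s' *: ei i + (t' *: ei j + x))].
  move=> h0.
  have dphi y : is_derive y (ei i) (fun y => g (h *: ei j + y) - g y)
      (gi (h *: ei j + y) - gi y).
    apply: is_deriveB; apply: is_derive_along (dgi (h *: ei j + y)) => k.
    by rewrite addrCA.
  have dpsi y : is_derive y (ei j) (fun y => g (h *: ei i + y) - g y)
      (gj (h *: ei i + y) - gj y).
    apply: is_deriveB; apply: is_derive_along (dgj (h *: ei i + y)) => k.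
    by rewrite addrCA.
  have [s sh E1] := MVT_line x h0 dphi.
  have [t th E2] := MVT_line (s *: ei i + x) h0 dgij.
  have [t' th' E3] := MVT_line x h0 dpsi.
  have [s' sh' E4] := MVT_line (t' *: ei j + x) h0 dgji.
  exists s, t, s', t'; split => //.
  have : gij (t *: ei j + (s *: ei i + x)) * h * h = gji (s' *: ei i + (t' *: ei j + x)) * h * h.
    rewrite -E2 -E1 -E4 -E3 (addrCA (h *: ei i)); ring.
  have hn : h != 0 by rewrite gt_eqF.
  by move=> /(mulIf hn)/(mulIf hn).
apply/eqP; rewrite -subr_eq0 -normr_le0; apply/ler_addgt0Pr => e e0.
have e2 : 0 < e / 2 by rewrite divr_gt0.
have near (f : 'rV[R]_n -> R) : continuous f -> exists2 d, 0 < d &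
    forall s t k l, 0 <= s <= d -> 0 <= t <= d ->
    `|f x - f (s *: ei k + (t *: ei l + x))| < e / 2.
  move=> cf.
  have /nbhs_ballP[r r0 Hr] : nbhs x [set y | `|f x - f y| < e / 2].
    by have := cf x; move=> /cvgrPdist_lt /(_ _ e2).
  (* The two displacements add up in one coordinate when k = l; r/4 keeps their sum below r. *)
  exists (r / 4); first by rewrite divr_gt0.
  move=> s t k l /andP[s0 sr] /andP[t0 tr]; apply: Hr; split => // a b.
  rewrite (ord1 a) !mxE /ball /=.
  rewrite (_ : _ - _ = - (s * (b == k)%:R + t * (b == l)%:R)); last by ring.
  rewrite normrN ger0_norm; last by rewrite addr_ge0// mulr_ge0.
  have r0' : 0 < r by [].
  by case: (b == k); case: (b == l); rewrite /= ?mulr1 ?mulr0; lra.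
have [d1 d10 H1] := near _ cij; have [d2 d20 H2] := near _ cji.
have h0 : 0 < Num.min d1 d2 by rewrite lt_min d10.
have [s [t [s' [t' [/andP[s0 sh] /andP[t0 th] /andP[s'0 sh'] /andP[t'0 th'] E]]]]] := key _ h0.
move: sh th sh' th'; rewrite !le_min.
move=> /andP[sh _] /andP[th _] /andP[_ sh'] /andP[_ th'].
have A1 : `|gij x - gij (t *: ei j + (s *: ei i + x))| < e / 2.
  by apply: H1; apply/andP; split.
have A2 : `|gji x - gji (s' *: ei i + (t' *: ei j + x))| < e / 2.
  by apply: H2; apply/andP; split.
rewrite add0r -E distrC in A2 *.
rewrite (_ : _ - _ = (gij x - gij (t *: ei j + (s *: ei i + x))) +
  (gij (t *: ei j + (s *: ei i + x)) - gji x)); last by ring.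
rewrite (le_trans (ler_normD _ _))//; lra.
Qed.

End schwarz_theorem.

Local Open Scope complex_scope.

Section test_functions.
Context {R : realType} {n : nat}.
Implicit Types (f g u v : cfun R n) (x : 'rV[R]_n).

Local Notation ei i := (delta_mx ord0 i : 'rV[R]_n).

Definition derivable_all f := forall k x,
  derivable (reP f) x (ei k) /\ derivable (imP f) x (ei k).

Definition lin2 (a : R[i]) f g : cfun R n := fun x => a * f x + g x.

Definition coordM (j : 'I_n) f : cfun R n := fun x => (x ord0 j)%:C * f x.

Lemma complex_eq (z w : R[i]) :
  complex.Re z = complex.Re w -> complex.Im z = complex.Im w -> z = w.
Proof. by case: z w => [a b] [c d] /= -> ->. Qed.

Lemma cReM (z w : R[i]) : complex.Re (z * w) =
  complex.Re z * complex.Re w - complex.Im z * complex.Im w.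
Proof. by case: z w => [a b] [c d]. Qed.

Lemma cImM (z w : R[i]) : complex.Im (z * w) =
  complex.Re z * complex.Im w + complex.Im z * complex.Re w.
Proof. by case: z w => [a b] [c d]. Qed.

Lemma cReD (z w : R[i]) : complex.Re (z + w) = complex.Re z + complex.Re w.
Proof. by case: z w => [a b] [c d]. Qed.

Lemma cImD (z w : R[i]) : complex.Im (z + w) = complex.Im z + complex.Im w.
Proof. by case: z w => [a b] [c d]. Qed.

Lemma is_derive_re f k x : derivable_all f ->
  is_derive x (ei k) (reP f) (reP (partial k f) x).
Proof. by move=> /(_ k x)[d _]; split. Qed.

Lemma is_derive_im f k x : derivable_all f ->
  is_derive x (ei k) (imP f) (imP (partial k f) x).
Proof. by move=> /(_ k x)[_ d]; split. Qed.

Lemma partialP f g k x : is_derive x (ei k) (reP f) (complex.Re (g x)) ->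
  is_derive x (ei k) (imP f) (complex.Im (g x)) -> partial k f x = g x.
Proof. by move=> [_ E1] [_ E2]; apply: complex_eq. Qed.

Lemma is_derive_lin2_re a f g k x : derivable_all f -> derivable_all g ->
  is_derive x (ei k) (reP (lin2 a f g))
    (complex.Re (lin2 a (partial k f) (partial k g) x)).
Proof.
move=> df dg.
have -> : reP (lin2 a f g) =
    (complex.Re a \*: reP f - complex.Im a \*: imP f) + reP g.
  by apply/funext => y; rewrite /reP /lin2 cReD cReM.
have d1 := is_derive_re k x df; have d2 := is_derive_im k x df.
have d3 := is_derive_re k x dg.
by apply: is_derive_eq; rewrite /lin2 cReD cReM.
Qed.

Lemma is_derive_lin2_im a f g k x : derivable_all f -> derivable_all g ->
  is_derive x (ei k) (imP (lin2 a f g))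
    (complex.Im (lin2 a (partial k f) (partial k g) x)).
Proof.
move=> df dg.
have -> : imP (lin2 a f g) =
    (complex.Re a \*: imP f + complex.Im a \*: reP f) + imP g.
  by apply/funext => y; rewrite /imP /lin2 cImD cImM.
have d1 := is_derive_re k x df; have d2 := is_derive_im k x df.
have d3 := is_derive_im k x dg.
by apply: is_derive_eq; rewrite /lin2 cImD cImM.
Qed.

Lemma derivable_lin2 a f g : derivable_all f -> derivable_all g ->
  derivable_all (lin2 a f g).
Proof.
move=> df dg k x; split.
  by have [] := is_derive_lin2_re a k x df dg.
by have [] := is_derive_lin2_im a k x df dg.
Qed.

Lemma partial_lin2 a f g k : derivable_all f -> derivable_all g ->
  partial k (lin2 a f g) = lin2 a (partial k f) (partial k g).
Proof.
move=> df dg; apply/funext => x; apply: partialP.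
- exact: is_derive_lin2_re.
- exact: is_derive_lin2_im.
Qed.

Lemma is_derive_coord k j x :
  is_derive x (ei k) (fun x : 'rV[R]_n => x ord0 j) (k == j)%:R.
Proof.
pose c : R := x ord0 j; pose b : R := (k == j)%:R.
have dp : is_derive (0 : R) (1 : R) (cst c + b \*: (@id R)) b.
  by apply: is_derive_eq; rewrite add0r [b *: 1]mulr1.
apply: (is_derive_along _ dp) => h.
rewrite addr0 [h *: 1]mulr1 !mxE eqxx /= eq_sym addrC mulrC.
by [].
Qed.

Lemma reP_coordM j f x : reP (coordM j f) x = x ord0 j * reP f x.
Proof. by rewrite /reP /coordM cReM /= mul0r subr0. Qed.

Lemma imP_coordM j f x : imP (coordM j f) x = x ord0 j * imP f x.
Proof. by rewrite /imP /coordM cImM /= mul0r addr0. Qed.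

Lemma is_derive_coordM_re j f k x : derivable_all f ->
  is_derive x (ei k) (reP (coordM j f))
    (complex.Re (lin2 (k == j)%:R f (coordM j (partial k f)) x)).
Proof.
move=> df; have -> : reP (coordM j f) = (fun x : 'rV[R]_n => x ord0 j) * reP f.
  by apply/funext => y; rewrite reP_coordM.
have d1 := is_derive_re k x df; have d2 := is_derive_coord k j x.
apply: is_derive_eq; rewrite /lin2 cReD cReM -/(reP (coordM j (partial k f)) x) reP_coordM /GRing.scale /=.
by rewrite /reP; case: eqP => _ /=; rewrite ?mul0r ?mul1r ?mulr0 ?mulr1 ?subr0 ?sub0r ?oppr0 addrC.
Qed.

Lemma is_derive_coordM_im j f k x : derivable_all f ->
  is_derive x (ei k) (imP (coordM j f))
    (complex.Im (lin2 (k == j)%:R f (coordM j (partial k f)) x)).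
Proof.
move=> df; have -> : imP (coordM j f) = (fun x : 'rV[R]_n => x ord0 j) * imP f.
  by apply/funext => y; rewrite imP_coordM.
have d1 := is_derive_im k x df; have d2 := is_derive_coord k j x.
apply: is_derive_eq; rewrite /lin2 cImD cImM -/(imP (coordM j (partial k f)) x) imP_coordM /GRing.scale /=.
by rewrite /imP; case: eqP => _ /=; ring.
Qed.

Lemma derivable_coordM j f : derivable_all f -> derivable_all (coordM j f).
Proof.
move=> df k x; split.
  by have [] := is_derive_coordM_re j k x df.
by have [] := is_derive_coordM_im j k x df.
Qed.

Lemma partial_coordM j f k : derivable_all f ->
  partial k (coordM j f) = lin2 (k == j)%:R f (coordM j (partial k f)).
Proof.
move=> df; apply/funext => x; apply: partialP.
- exact: is_derive_coordM_re.
- exact: is_derive_coordM_im.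
Qed.

(* Working in this class instead of [schwartz] makes stability under [partial]
   a one-line induction. *)
Inductive tclass f : cfun R n -> Prop :=
| tc_partials s : tclass f (partials s f)
| tc_lin2 a u v : tclass f u -> tclass f v -> tclass f (lin2 a u v)
| tc_coordM j u : tclass f u -> tclass f (coordM j u).

Definition regular u := [/\ good (reP u), good (imP u) & derivable_all u].

Lemma norm_Re_le (z : R[i]) : `|complex.Re z| <= Normc.normc z.
Proof.
case: z => a b /=; rewrite -sqrtr_sqr ler_wsqrtr// lerDl; exact: sqr_ge0.
Qed.

Lemma norm_Im_le (z : R[i]) : `|complex.Im z| <= Normc.normc z.
Proof.
case: z => a b /=; rewrite -sqrtr_sqr ler_wsqrtr// lerDr; exact: sqr_ge0.
Qed.

Lemma rnormE x : rnorm x = Num.sqrt (sqn x).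
Proof. by []. Qed.

Lemma schwartz_bound f s N : schwartz f ->
  exists C, forall x, Normc.normc (partials s f x) <= C * wgt N x.
Proof.
(* The index must reach [size s] to cover this derivative, and 2N because (1 + r^2)^N <= (1 +
   r)^(2N). *)
move=> [_ /(_ (maxn (size s) (2 * N)))[C HC]]; exists C => x.
have u0 := sqn_ge0 x.
have r0 : 0 <= rnorm x by exact: sqrtr_ge0.
have p : 0 < 1 + sqn x by lra.
rewrite /wgt ler_pdivlMr ?exprn_gt0// mulrC.
apply: le_trans (HC _ _); last first.
  by exists s, x; split; [exact: leq_maxl|].
apply: ler_wpM2r; first by case: (partials s f x) => a b; exact: sqrtr_ge0.
apply: (@le_trans _ _ ((1 + rnorm x) ^+ (2 * N))).
  rewrite exprM; apply: lerXn2r; rewrite ?nnegrE ?exprn_ge0; try lra.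
  have : rnorm x ^+ 2 = sqn x by rewrite rnormE sqr_sqrtr.
  nra.
by apply: ler_weXn2l; [lra|exact: leq_maxr].
Qed.

Lemma regular_partials f s : schwartz f -> regular (partials s f).
Proof.
move=> sf; have [/(_ s)[cr ci dri] _] := sf; split => //.
- split => // N; have [C HC] := schwartz_bound s N sf; exists C => x.
  exact: le_trans (norm_Re_le _) (HC x).
- split => // N; have [C HC] := schwartz_bound s N sf; exists C => x.
  exact: le_trans (norm_Im_le _) (HC x).
Qed.

Lemma good_ext (g h : 'rV[R]_n -> R) : g =1 h -> good g -> good h.
Proof. by move=> /funext ->. Qed.

Lemma regular_lin2 a u v : regular u -> regular v -> regular (lin2 a u v).
Proof.
move=> [ru iu du] [rv iv dv]; split; last exact: derivable_lin2.
- apply: (@good_ext (fun x => (complex.Re a * reP u x + - complex.Im a * imP u x) + reP v x)).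
    by move=> x; rewrite /reP /lin2 cReD cReM mulNr.
  by apply: goodD => //; apply: goodD; exact: goodZ.
- apply: (@good_ext (fun x => (complex.Re a * imP u x + complex.Im a * reP u x) + imP v x)).
    by move=> x; rewrite /imP /lin2 cImD cImM.
  by apply: goodD => //; apply: goodD; exact: goodZ.
Qed.

Lemma regular_coordM j u : regular u -> regular (coordM j u).
Proof.
move=> [ru iu du]; split; last exact: derivable_coordM.
- apply: (@good_ext (fun x => x ord0 j * reP u x)); last exact: good_coord.
  by move=> x; rewrite reP_coordM.
- apply: (@good_ext (fun x => x ord0 j * imP u x)); last exact: good_coord.
  by move=> x; rewrite imP_coordM.
Qed.

Section class_of_a_schwartz_function.
Variable f : cfun R n.
Hypothesis sf : schwartz f.
Local Notation P := (tclass f).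

Lemma tclass_self : P f.
Proof. exact: (tc_partials f [::]). Qed.

Lemma tclass_regular u : P u -> regular u.
Proof.
elim=> [s|a u' v' _ ru _ rv|j u' _ ru].
- exact: regular_partials.
- exact: regular_lin2.
- exact: regular_coordM.
Qed.

Lemma tclass_derivable u : P u -> derivable_all u.
Proof. by move=> /tclass_regular[]. Qed.

Lemma tclass_partial u k : P u -> P (partial k u).
Proof.
elim=> [s|a u' v' Pu pu Pv pv|j u' Pu pu].
- exact: (tc_partials f (k :: s)).
- by rewrite partial_lin2; [exact: tc_lin2|exact: tclass_derivable..].
- rewrite partial_coordM; last exact: tclass_derivable.
  by apply: tc_lin2 => //; exact: tc_coordM.
Qed.

Lemma tclass0 : P (fun=> 0).
Proof.
have -> : (fun=> 0) = lin2 (-1) f f.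
  by apply/funext => x; rewrite /lin2 mulN1r addNr.
by apply: tc_lin2; exact: tclass_self.
Qed.

Lemma tclassZ a u : P u -> P (fun x => a * u x).
Proof.
move=> Pu; have -> : (fun x => a * u x) = lin2 a u (fun=> 0).
  by apply/funext => x; rewrite /lin2 addr0.
by apply: tc_lin2 => //; exact: tclass0.
Qed.

Lemma tclassD u v : P u -> P v -> P (fun x => u x + v x).
Proof.
move=> Pu Pv; have -> : (fun x => u x + v x) = lin2 1 u v.
  by apply/funext => x; rewrite /lin2 mul1r.
exact: tc_lin2.
Qed.

Lemma tclass_sum (I : Type) (s : seq I) (F : I -> cfun R n) :
  (forall i, P (F i)) -> P (fun x => \sum_(i <- s) F i x).
Proof.
move=> PF; elim: s => [|i s ih].
  rewrite (_ : (fun x => _) = (fun=> 0)); first exact: tclass0.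
  by apply/funext => x; rewrite big_nil.
rewrite (_ : (fun x => _) = (fun x => F i x + \sum_(j <- s) F j x)).
  exact: tclassD.
by apply/funext => x; rewrite big_cons.
Qed.

Lemma partialZ a u k : P u ->
  partial k (fun x => a * u x) = (fun x => a * partial k u x).
Proof.
move=> Pu; have E w : (fun x => a * w x) = lin2 a w (fun=> 0) :> cfun R n.
  by apply/funext => x; rewrite /lin2 addr0.
rewrite E partial_lin2; [|exact: tclass_derivable|exact: tclass_derivable tclass0].
apply/funext => x; rewrite /lin2 (_ : partial k (fun=> 0) x = 0) ?addr0//.
apply: (@partialP _ (fun=> 0)); exact: is_derive_cst.
Qed.

Lemma partialD u v k : P u -> P v ->
  partial k (fun x => u x + v x) = (fun x => partial k u x + partial k v x).
Proof.
move=> Pu Pv; have E w w' : (fun x => w x + w' x) = lin2 1 w w' :> cfun R n.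
  by apply/funext => x; rewrite /lin2 mul1r.
by rewrite !E partial_lin2//; exact: tclass_derivable.
Qed.

Lemma partial_sum (I : Type) (s : seq I) (F : I -> cfun R n) k :
  (forall i, P (F i)) -> partial k (fun x => \sum_(i <- s) F i x) =
  (fun x => \sum_(i <- s) partial k (F i) x).
Proof.
move=> PF; elim: s => [|i s ih].
  rewrite (_ : (fun x => _) = (fun=> 0)); last by apply/funext => x; rewrite big_nil.
  apply/funext => x; rewrite big_nil.
  apply: (@partialP _ (fun=> 0)); exact: is_derive_cst.
rewrite (_ : (fun x => _) = (fun x => F i x + \sum_(j <- s) F j x)); last first.
  by apply/funext => x; rewrite big_cons.
rewrite partialD//; last exact: tclass_sum.
by rewrite ih; apply/funext => x; rewrite big_cons.
Qed.

Lemma partialC u i j : P u -> partial i (partial j u) = partial j (partial i u).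
Proof.
move=> Pu; have du := tclass_derivable Pu.
have dp k := tclass_derivable (tclass_partial k Pu).
have rp k l := tclass_regular (tclass_partial k (tclass_partial l Pu)).
apply/funext => x; apply: complex_eq.
- have [[_ c1] _ _] := rp i j; have [[_ c2] _ _] := rp j i.
  exact: (@schwarz_partials _ _ (reP u) (reP (partial j u)) (reP (partial i u)) _ _ j i x
    (fun y => is_derive_re j y du) (fun y => is_derive_re i y du)
    (fun y => is_derive_re i y (dp j)) (fun y => is_derive_re j y (dp i)) c1 c2).
- have [_ [_ c1] _] := rp i j; have [_ [_ c2] _] := rp j i.
  exact: (@schwarz_partials _ _ (imP u) (imP (partial j u)) (imP (partial i u)) _ _ j i x
    (fun y => is_derive_im j y du) (fun y => is_derive_im i y du)
    (fun y => is_derive_im i y (dp j)) (fun y => is_derive_im j y (dp i)) c1 c2).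
Qed.

End class_of_a_schwartz_function.
End test_functions.

(** * The Laplacian against [r^l] *)

Lemma realCE (R : realType) (a : R) (z : R[i]) :
  complex.Re (a%:C * z) = a * complex.Re z /\ complex.Im (a%:C * z) = a * complex.Im z.
Proof. by rewrite cReM cImM /= !mul0r subr0 addr0. Qed.

Section laplacian.
Context {R : realType} {n : nat}.
Variable f : cfun R n.
Hypothesis sf : schwartz f.
Implicit Types (u v : cfun R n) (x : 'rV[R]_n).
Local Notation P := (tclass f).

Definition lap u : cfun R n := fun x => \sum_i partial i (partial i u) x.

Lemma tclass_lap u : P u -> P (lap u).
Proof.
by move=> Pu; apply: tclass_sum => // i; do 2 apply: tclass_partial => //.
Qed.

Lemma tclass_iter_lap k u : P u -> P (iter k lap u).
Proof. by move=> Pu; elim: k => //= k; exact: tclass_lap. Qed.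

Lemma lapZ a u : P u -> lap (fun x => a * u x) = (fun x => a * lap u x).
Proof.
move=> Pu; apply/funext => x; rewrite /lap mulr_sumr; apply: eq_bigr => i _.
by rewrite (partialZ sf)// (partialZ sf)//; exact: tclass_partial.
Qed.

Lemma lapD u v : P u -> P v -> lap (fun x => u x + v x) = (fun x => lap u x + lap v x).
Proof.
move=> Pu Pv; apply/funext => x; rewrite /lap -big_split; apply: eq_bigr => i _ /=.
by rewrite (partialD sf)// (partialD sf)//; exact: tclass_partial.
Qed.

Lemma lap_partial u j : P u -> lap (partial j u) = partial j (lap u).
Proof.
move=> Pu; rewrite /lap (partial_sum sf); last by move=> i; do 2 apply: tclass_partial => //.
apply/funext => x; apply: eq_bigr => i _.
rewrite (partialC sf i j Pu) (partialC sf i j)//; exact: tclass_partial.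
Qed.

Lemma iter_lap_partial k u j : P u -> iter k lap (partial j u) = partial j (iter k lap u).
Proof.
by move=> Pu; elim: k => //= k ->; rewrite lap_partial//; exact: tclass_iter_lap.
Qed.

Lemma iter_lapZ k a u : P u -> iter k lap (fun x => a * u x) = (fun x => a * iter k lap u x).
Proof. by move=> Pu; elim: k => //= k ->; rewrite lapZ//; exact: tclass_iter_lap. Qed.

Lemma lap_coordM j u : P u ->
  lap (coordM j u) = (fun x => coordM j (lap u) x + 2 * partial j u x).
Proof.
move=> Pu; have du := tclass_derivable sf Pu.
have Pp i := tclass_partial sf i Pu.
apply/funext => x; rewrite /lap.
have E i : partial i (partial i (coordM j u)) x =
    (x ord0 j)%:C * partial i (partial i u) x + (i == j)%:R * (2 * partial i u x).
  rewrite partial_coordM// partial_lin2//; last first.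
    by apply: derivable_coordM; exact: (tclass_derivable sf).
  rewrite partial_coordM; last exact: (tclass_derivable sf).
  by rewrite /lin2 /coordM; ring.
under eq_bigr => i _ do rewrite E.
rewrite big_split /= /coordM mulr_sumr; congr (_ + _).
rewrite (bigD1 j)//= eqxx mul1r big1 ?addr0// => i /negbTE ->.
by rewrite mul0r.
Qed.

(** The commutator of Lap^k with multiplication by x_j is 2k d_j Lap^(k-1). It is all that survives
    at the origin, where x_j = 0. For k = 0 the factor 2k makes the truncated [k.-1] harmless. *)
Lemma iter_lap_coordM k j u : P u -> iter k lap (coordM j u) =
  (fun x => coordM j (iter k lap u) x + (2 * k%:R) * partial j (iter k.-1 lap u) x).
Proof.
move=> Pu; elim: k => [|k ih].
  by apply/funext => x; rewrite mulr0 mul0r addr0.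
have Pk := tclass_iter_lap k Pu.
have Pk1 := tclass_partial sf j (tclass_iter_lap k.-1 Pu).
rewrite iterS ih lapD; last 2 first.
- exact: tc_coordM.
- exact: tclassZ.
rewrite lap_coordM// lapZ// lap_partial; last exact: tclass_iter_lap.
apply/funext => x; rewrite -addrA -iterS; congr (_ + _).
case: k {ih Pk Pk1} => [|k] /=; first by rewrite mulr0 mul0r addr0 mulr1.
by rewrite -[in RHS]natr1; ring.
Qed.

(** As l is real, the pairing with a complex function splits into real and imaginary parts. *)
Definition MC (l : R) u : R[i] := Mint l (reP u) +i* Mint l (imP u).

Hypothesis n0 : (0 < n)%N.

Lemma MC_lin2 (l : R) a u v : - n%:R < l -> P u -> P v ->
  MC l (lin2 a u v) = a * MC l u + MC l v.
Proof.
move=> nl Pu Pv; have [ru iu _] := tclass_regular sf Pu.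
have [rv iv _] := tclass_regular sf Pv.
apply: complex_eq; rewrite ?cReD ?cImD ?cReM ?cImM /MC /=.
  have -> : reP (lin2 a u v) =
      (fun x => (complex.Re a * reP u x + - complex.Im a * imP u x) + reP v x).
    by apply/funext => x; rewrite /reP /lin2 cReD cReM mulNr.
  have g1 := goodZ (complex.Re a) ru; have g2 := goodZ (- complex.Im a) iu.
  by rewrite !MintD//; [rewrite !MintZ// mulNr|exact: goodD].
have -> : imP (lin2 a u v) =
    (fun x => (complex.Re a * imP u x + complex.Im a * reP u x) + imP v x).
  by apply/funext => x; rewrite /imP /lin2 cImD cImM.
have g1 := goodZ (complex.Re a) iu; have g2 := goodZ (complex.Im a) ru.
by rewrite !MintD//; [rewrite !MintZ|exact: goodD].
Qed.

Lemma MC0 (l : R) : - n%:R < l -> MC l (fun=> 0) = 0.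
Proof.
move=> nl; have Pf := tclass_self f.
have -> : (fun=> 0) = lin2 (-1) f f.
  by apply/funext => x; rewrite /lin2 mulN1r addNr.
by rewrite MC_lin2// mulN1r addNr.
Qed.

Lemma MCZ (l : R) a u : - n%:R < l -> P u -> MC l (fun x => a * u x) = a * MC l u.
Proof.
move=> nl Pu; have -> : (fun x => a * u x) = lin2 a u (fun=> 0).
  by apply/funext => x; rewrite /lin2 addr0.
by rewrite MC_lin2 ?MC0 ?addr0//; exact: tclass0.
Qed.

Lemma MCD (l : R) u v : - n%:R < l -> P u -> P v ->
  MC l (fun x => u x + v x) = MC l u + MC l v.
Proof.
move=> nl Pu Pv; have -> : (fun x => u x + v x) = lin2 1 u v.
  by apply/funext => x; rewrite /lin2 mul1r.
by rewrite MC_lin2// mul1r.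
Qed.

Lemma MC_sum (I : Type) (s : seq I) (F : I -> cfun R n) (l : R) : - n%:R < l ->
  (forall i, P (F i)) -> MC l (fun x => \sum_(i <- s) F i x) = \sum_(i <- s) MC l (F i).
Proof.
move=> nl PF; elim: s => [|i s ih].
  rewrite big_nil (_ : (fun x => _) = (fun=> 0)) ?MC0//.
  by apply/funext => x; rewrite big_nil.
rewrite (_ : (fun x => _) = (fun x => F i x + \sum_(j <- s) F j x)); last first.
  by apply/funext => x; rewrite big_cons.
by rewrite MCD ?big_cons ?ih//; exact: tclass_sum.
Qed.

Lemma MC_by_parts (l : R) i u : 4 < l -> P u ->
  MC l (partial i u) = - l%:C * MC (l - 2) (coordM i u).
Proof.
move=> l4 Pu; have [[r1 c1] [r2 c2] du] := tclass_regular sf Pu.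
have [[r1' c1'] [r2' c2'] _] := tclass_regular sf (tclass_partial sf i Pu).
rewrite -rmorphN; apply: complex_eq; rewrite ((realCE _ _).1, (realCE _ _).2) /=.
  rewrite (@Mint_by_parts _ _ i l (reP u) (reP (partial i u)) l4
    (fun x => is_derive_re i x du) c1 c1' r1 r1').
  by congr (_ * Mint _ _); apply/funext => x; exact/esym/reP_coordM.
rewrite (@Mint_by_parts _ _ i l (imP u) (imP (partial i u)) l4
  (fun x => is_derive_im i x du) c2 c2' r2 r2').
by congr (_ * Mint _ _); apply/funext => x; exact/esym/imP_coordM.
Qed.

Lemma MC_sqn (l : R) u :
  MC (l - 2) (fun x => \sum_i coordM i (coordM i u) x) = MC l u.
Proof.
have E x : \sum_i coordM i (coordM i u) x = (sqn x)%:C * u x.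
  rewrite /coordM /sqn raddf_sum /= mulr_suml; apply: eq_bigr => i _.
  by rewrite mulrA -rmorphM -expr2.
have r x : rpow l x = sqn x * rpow (l - 2) x.
  by rewrite /rpow -rhoD2 ?sqn_ge0// subrK.
apply: complex_eq => /=; apply: eq_Rintegral => t _.
  by rewrite /reP E (realCE _ _).1 r; ring.
by rewrite /imP E (realCE _ _).2 r; ring.
Qed.

Lemma MC_lap (l : R) u : 4 < l -> P u ->
  MC (l + 2) (lap u) = ((l + 2) * (l + n%:R))%:C * MC l u.
Proof.
move=> l4 Pu; have nR : 0 <= n%:R :> R by [].
have Pp i := tclass_partial sf i Pu.
rewrite /lap MC_sum; [|lra|by move=> i; apply: tclass_partial].
have E i : MC (l + 2) (partial i (partial i u)) =
    (l + 2)%:C * (l%:C * MC (l - 2) (coordM i (coordM i u)) + MC l u).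
  rewrite MC_by_parts//; last by lra.
  (* Writing x_i d_i u = d_i (x_i u) - u permits a second integration by parts; the n copies of u
     left over turn the factor l into l + n. *)
  have -> : coordM i (partial i u) = lin2 (-1) u (partial i (coordM i u)).
    rewrite partial_coordM ?eqxx; last exact: (tclass_derivable sf).
    by apply/funext => x; rewrite /lin2 /= mul1r mulN1r addKr.
  rewrite addrK MC_lin2//; last 2 first.
  - lra.
  - by apply: tclass_partial => //; exact: tc_coordM.
  rewrite MC_by_parts//; last exact: tc_coordM.
  by ring.
rewrite (eq_bigr _ (fun i _ => E i)) -mulr_sumr big_split /= -mulr_sumr.
rewrite -(MC_sum _ (F := fun i => coordM i (coordM i u))); last 2 first.
- lra.
- by move=> i; do 2 apply: tc_coordM.
rewrite MC_sqn sumr_const card_ord -(mulr_natl (MC l u)) !rmorphM /=.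
by rewrite (rmorphD _ l n%:R) /= rmorph_nat -mulrDl mulrA.
Qed.

Definition lapfactor k (l : R) : R :=
  \prod_(j < k) ((l + 2 * j%:R + 2) * (l + 2 * j%:R + n%:R)).

Lemma MC_iter_lap k (l : R) u : 4 < l -> P u ->
  MC (l + 2 * k%:R) (iter k lap u) = (lapfactor k l)%:C * MC l u.
Proof.
move=> l4 Pu; elim: k => [|k ih].
  by rewrite mulr0 addr0 /lapfactor big_ord0 mul1r.
rewrite -[k.+1%:R]natr1 mulrDr mulr1 addrA iterS MC_lap; last 2 first.
- by rewrite (lt_le_trans l4)// lerDl mulr_ge0.
- exact: tclass_iter_lap.
rewrite ih mulrA -rmorphM /=; congr (_%:C * _).
by rewrite /lapfactor big_ord_recr /= mulrC.
Qed.

End laplacian.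

(** * Exterior algebra and the Branson-Gover operator *)

Section exterior_algebra.
Context {R : realType} {n : nat}.
Implicit Types (w : ext R n) (J : {set 'I_n}) (x : 'rV[R]_n) (i j k : 'I_n).

Lemma ext_scaleE (a : R[i]) w J : (a *: w) J = a * w J.
Proof. by rewrite ffunE. Qed.

Lemma ext_sumE (I : Type) (s : seq I) (F : I -> ext R n) J :
  (\sum_(i <- s) F i) J = \sum_(i <- s) F i J.
Proof.
by elim: s => [|i s ih]; rewrite ?big_nil ?big_cons ?ffunE// ih.
Qed.

Lemma wedge_is_linear k : linear (@wedge R n k).
Proof.
move=> a u v; apply/ffunP => J; rewrite !ffunE; case: ifP => _.
  by rewrite mulrDr; congr (_ + _); exact: mulrCA.
by rewrite addr0; exact/esym/mulr0.
Qed.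

HB.instance Definition _ k :=
  GRing.isLinear.Build R[i] (ext R n) (ext R n) _ (wedge k) (wedge_is_linear k).

Lemma contr_is_linear k : linear (@contr R n k).
Proof.
move=> a u v; apply/ffunP => J; rewrite !ffunE; case: ifP => _.
  by rewrite addr0; exact/esym/mulr0.
by rewrite mulrDr; congr (_ + _); exact: mulrCA.
Qed.

HB.instance Definition _ k :=
  GRing.isLinear.Build R[i] (ext R n) (ext R n) _ (contr k) (contr_is_linear k).

(* [front_sign k] changes sign when an index [i < k] is added or removed *)
Definition swap_sign i k : R[i] := (-1) ^+ (i < k)%N.

Lemma front_signU1 i k J : i \notin J ->
  front_sign k (i |: J) = swap_sign i k * front_sign (R := R) k J.
Proof.
move=> iJ; rewrite /front_sign /swap_sign -exprD; congr (_ ^+ _).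
have [ik|ik] := ltnP i k; last first.
  rewrite add0n; congr #|pred_of_set _|; apply/setP => j; rewrite !inE.
  by case: eqP => [->|//]; rewrite ltnNge ik !andbF.
rewrite (_ : finset _ = i |: [set j in J | (j < k)%N]).
  by rewrite cardsU1 inE (negbTE iJ) /=.
by apply/setP => j; rewrite !inE; case: eqP => [->|//]; rewrite ik.
Qed.

Lemma swap_signK i k : swap_sign i k * swap_sign i k = 1.
Proof. by rewrite /swap_sign -expr2 sqrr_sign. Qed.

Lemma front_signD1 i k J : i \in J ->
  front_sign k (J :\ i) = swap_sign i k * front_sign (R := R) k J.
Proof.
move=> iJ; rewrite -{2}(finset.setD1K iJ) front_signU1 ?inE ?eqxx//.
by rewrite mulrA swap_signK mul1r.
Qed.

Lemma swap_sign_id k : swap_sign k k = 1.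
Proof. by rewrite /swap_sign ltnn. Qed.

Lemma swap_signC i k : i != k -> swap_sign i k = - swap_sign k i.
Proof.
rewrite /swap_sign neq_ltn => /orP[] h; rewrite h ltnNge (ltnW h) /=.
  by rewrite expr0 expr1.
by rewrite expr0 expr1 opprK.
Qed.

Lemma front_signK k J : front_sign k J * front_sign k J = 1 :> R[i].
Proof. by rewrite /front_sign -expr2 sqrr_sign. Qed.

Lemma wedgeE k w J :
  wedge k w J = if k \in J then front_sign k J * w (J :\ k) else 0.
Proof. by rewrite ffunE. Qed.

Lemma contrE k w J :
  contr k w J = if k \in J then 0 else front_sign k J * w (k |: J).
Proof. by rewrite ffunE. Qed.

(** For i = j exactly one of the two terms is nonzero, according to whether i is in J. For i != j
    the terms live on the same index set and their signs differ by [swap_signC]. *)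
Lemma wedge_contr_anticomm i j w :
  wedge i (contr j w) + contr j (wedge i w) = (i == j)%:R *: w.
Proof.
apply/ffunP => J; rewrite ext_scaleE [LHS]ffunE wedgeE !contrE wedgeE.
have [->|ij] := eqVneq i j.
  rewrite mul1r !inE eqxx /=; case: ifPn => jJ.
    rewrite addr0 front_signD1// swap_sign_id mul1r mulrA front_signK mul1r.
    by rewrite finset.setD1K.
  rewrite add0r front_signU1// swap_sign_id mul1r mulrA front_signK mul1r.
  by rewrite setU1K.
rewrite mul0r !inE (negbTE ij) eq_sym (negbTE ij) /=.
case: ifPn => iJ; case: ifPn => jJ; rewrite ?mulr0 ?addr0//.
rewrite front_signD1// front_signU1// swap_signC//.
rewrite (_ : (j |: J) :\ i = j |: (J :\ i)).
  by ring.
apply/setP => k; rewrite !inE.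
by case: (k =P i) => [->|]; rewrite ?(negbTE ij) ?andbT.
Qed.

Lemma wedgeC i j w : wedge i (wedge j w) = - wedge j (wedge i w).
Proof.
apply/ffunP => J; rewrite [RHS]ffunE !wedgeE.
have [->|ij] := eqVneq i j.
  by rewrite !inE eqxx /=; case: ifP; rewrite ?mulr0 oppr0.
rewrite !inE (negbTE ij) eq_sym (negbTE ij) /=.
case: ifPn => iJ; case: ifPn => jJ; rewrite ?mulr0 ?oppr0//.
rewrite !front_signD1// (swap_signC ij) !mulNr mulrN; congr (- _).
rewrite (_ : (J :\ j) :\ i = (J :\ i) :\ j); first by ring.
by apply/setP => k; rewrite !inE andbCA.
Qed.

Lemma contrC i j w : contr i (contr j w) = - contr j (contr i w).
Proof.
apply/ffunP => J; rewrite [RHS]ffunE !contrE.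
have [->|ij] := eqVneq i j.
  by rewrite !inE eqxx /=; case: ifP; rewrite ?mulr0 oppr0.
rewrite !inE (negbTE ij) eq_sym (negbTE ij) /=.
case: ifPn => iJ; case: ifPn => jJ; rewrite ?mulr0 ?oppr0//.
rewrite !front_signU1// (swap_signC ij) !mulNr mulrN; congr (- _).
by rewrite finset.setUCA; ring.
Qed.

Lemma sum_wedge_contr w J : \sum_i wedge i (contr i w) J = #|J|%:R * w J.
Proof.
rewrite (bigID (fun i => i \in J)) /= [X in _ + X]big1 ?addr0; last first.
  by move=> i /negbTE iJ; rewrite wedgeE iJ.
rewrite (eq_bigr (fun=> w J)).
  by rewrite sumr_const -[LHS]mulr_natl.
move=> i iJ; rewrite wedgeE iJ contrE !inE eqxx /= front_signD1// swap_sign_id mul1r.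
by rewrite mulrA front_signK mul1r finset.setD1K.
Qed.

Lemma pforms_coord p w J : w \in pforms p -> #|J| != p -> w J = 0.
Proof.
move=> wp Jp; have := coord_span wp => ->.
rewrite ext_sumE big1// => i _; rewrite ext_scaleE.
set X := map_tuple _ _; have : X`_i \in (X : seq _) by rewrite mem_nth// size_tuple.
move=> /mapP[K]; rewrite mem_enum inE => /eqP Kp ->.
rewrite ffunE; case: eqP => [JK|]; last by rewrite mulr0.
by rewrite JK Kp eqxx in Jp.
Qed.

(** The sum of e_i /\ i_{e_i} is the degree operator. Through it the degree p enters the residue,
    and hence is matched with [alpha] and [beta]. *)
Lemma sum_wedge_contr_pform p (b : pform R n p) J :
  \sum_i wedge i (contr i (vsval b)) J = p%:R * vsval b J.
Proof.
rewrite sum_wedge_contr; have [->//|Jp] := eqVneq #|J| p.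
by rewrite (pforms_coord (subvsP b) Jp) !mulr0.
Qed.

(** The anticommutation relation gives i_x eps_x + eps_x i_x = |x|^2, so the difference is |x|^2 - 2
    eps_x i_x, a quadratic polynomial in x. *)
Lemma symbol_kernel x w J :
  (contrx x (wedgex x w) - wedgex x (contrx x w)) J =
  (sqn x)%:C * w J - 2 * \sum_i \sum_j
    ((x ord0 i)%:C * (x ord0 j)%:C) * wedge i (contr j w) J.
Proof.
have E1 : contrx x (wedgex x w) = \sum_i \sum_j
    ((x ord0 i)%:C * (x ord0 j)%:C) *: contr j (wedge i w).
  rewrite /contrx exchange_big; apply: eq_bigr => j _ /=.
  rewrite /wedgex linear_sum scaler_sumr; apply: eq_bigr => i _.
  by rewrite linearZ /= scalerA mulrC.
have E2 : wedgex x (contrx x w) = \sum_i \sum_j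
    ((x ord0 i)%:C * (x ord0 j)%:C) *: wedge i (contr j w).
  rewrite /wedgex; apply: eq_bigr => i _ /=.
  rewrite /contrx linear_sum scaler_sumr; apply: eq_bigr => j _.
  by rewrite linearZ /= scalerA.
have E3 : contrx x (wedgex x w) + wedgex x (contrx x w) = (sqn x)%:C *: w.
  rewrite E1 E2 -big_split /=.
  rewrite (eq_bigr (fun i => ((x ord0 i)%:C * (x ord0 i)%:C) *: w)); last first.
    move=> i _; rewrite -big_split /= (bigD1 i)//= -scalerDr addrC big1 ?add0r.
      by rewrite addrC wedge_contr_anticomm eqxx scale1r.
    move=> j ji; rewrite -scalerDr addrC wedge_contr_anticomm eq_sym (negbTE ji).
    by rewrite scale0r scaler0.
  rewrite -scaler_suml; congr (_ *: _); rewrite /sqn raddf_sum /=.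
  by apply: eq_bigr => i _; rewrite -rmorphM -expr2.
have lin (A B C : ext R n) : A + B = C -> (A - B) J = C J - 2 * B J.
  by move=> <-; rewrite !ffunE; ring.
rewrite (lin _ _ _ E3) ext_scaleE E2; congr (_ - 2 * _).
rewrite ext_sumE; apply: eq_bigr => i _; rewrite ext_sumE.
by apply: eq_bigr => j _; rewrite ext_scaleE.
Qed.

End exterior_algebra.

(** * Iterated differential operators on distributions *)

Section differential_operators.
Context {R : realType} {n : nat}.
Variable f : cfun R n.
Hypothesis sf : schwartz f.
Implicit Types (S T : form_distr R n) (u v : cfun R n).
Local Notation P := (tclass f).

Lemma extdE S u : extd S u = - \sum_k wedge k (S (partial k u)).
Proof.
by rewrite /extd /dpartial -sumrN; apply: eq_bigr => k _; rewrite linearN.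
Qed.

Lemma codiffE S u : codiff S u = \sum_k contr k (S (partial k u)).
Proof.
by rewrite /codiff /dpartial -sumrN; apply: eq_bigr => k _; rewrite linearN opprK.
Qed.

(** Identities between distributions hold only on the test functions in the class. The class is
    stable under partial derivatives, so such identities may be used underneath a differential
    operator. *)
Lemma extd_ext S T u : (forall v, P v -> S v = T v) -> P u -> extd S u = extd T u.
Proof.
move=> ST Pu; rewrite !extdE; congr (- _); apply: eq_bigr => k _.
by rewrite ST//; exact: tclass_partial.
Qed.

Lemma codiff_ext S T u : (forall v, P v -> S v = T v) -> P u -> codiff S u = codiff T u.
Proof.
move=> ST Pu; rewrite !codiffE; apply: eq_bigr => k _.
by rewrite ST//; exact: tclass_partial.
Qed.

Lemma extd_lap S (c : R[i]) k u : P u ->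
  extd (fun v => c *: S (iter k lap v)) u = c *: extd S (iter k lap u).
Proof.
move=> Pu; rewrite !extdE scalerN scaler_sumr; congr (- _); apply: eq_bigr => j _.
by rewrite (iter_lap_partial sf)// linearZ.
Qed.

Lemma codiff_lap S (c : R[i]) k u : P u ->
  codiff (fun v => c *: S (iter k lap v)) u = c *: codiff S (iter k lap u).
Proof.
move=> Pu; rewrite !codiffE scaler_sumr; apply: eq_bigr => j _.
by rewrite (iter_lap_partial sf)// linearZ.
Qed.

Lemma extd_sub S T u : extd (fun v => S v - T v) u = extd S u - extd T u.
Proof.
rewrite !extdE (eq_bigr (fun k => wedge k (S (partial k u)) - wedge k (T (partial k u)))).
  by rewrite sumrB opprB opprK addrC.
by move=> k _; rewrite linearB.
Qed.

Lemma codiff_sub S T u : codiff (fun v => S v - T v) u = codiff S u - codiff T u.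
Proof. by rewrite !codiffE -sumrB; apply: eq_bigr => k _; rewrite linearB. Qed.

Lemma antisym_sum0 (V : lmodType R[i]) (F : 'I_n -> 'I_n -> V) :
  (forall i j, F i j = - F j i) -> \sum_i \sum_j F i j = 0.
Proof.
move=> FN; have E : \sum_i \sum_j F i j = - \sum_i \sum_j F i j.
  rewrite [LHS]exchange_big /= -sumrN; apply: eq_bigr => i _.
  by rewrite -sumrN; apply: eq_bigr => j _.
move/eqP: E; rewrite -addr_eq0 -mulr2n -scaler_nat scaler_eq0 pnatr_eq0 /=.
by move/eqP.
Qed.

(** Wedge factors anticommute while partial derivatives commute, so the double sum is
    antisymmetric. *)
Lemma extd_extd S u : P u -> extd (extd S) u = 0.
Proof.
move=> Pu; rewrite extdE.
rewrite (eq_bigr (fun k => - \sum_j wedge k (wedge j (S (partial j (partial k u)))))); last first.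
  by move=> k _; rewrite extdE linearN linear_sum.
rewrite sumrN opprK; apply: antisym_sum0 => i j.
by rewrite wedgeC (partialC sf i j Pu).
Qed.

Lemma codiff_codiff S u : P u -> codiff (codiff S) u = 0.
Proof.
move=> Pu; rewrite codiffE.
rewrite (eq_bigr (fun k => \sum_j contr k (contr j (S (partial j (partial k u)))))); last first.
  by move=> k _; rewrite codiffE linear_sum.
apply: antisym_sum0 => i j.
by rewrite contrC (partialC sf i j Pu).
Qed.

Lemma extd_codiffE S u :
  extd (codiff S) u = - \sum_i \sum_j wedge i (contr j (S (partial j (partial i u)))).
Proof.
rewrite extdE; congr (- _); apply: eq_bigr => i _.
by rewrite codiffE linear_sum.
Qed.

(** Once the partial derivatives are commuted, the anticommutation relation cancels every term with
    i != j and leaves S itself on the diagonal. *)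
Lemma hodge_laplacian S u : P u ->
  codiff (extd S) u + extd (codiff S) u = - \sum_i S (partial i (partial i u)).
Proof.
move=> Pu; rewrite extd_codiffE codiffE.
rewrite (eq_bigr (fun i => - \sum_j contr i (wedge j (S (partial j (partial i u)))))); last first.
  by move=> i _; rewrite extdE linearN linear_sum.
rewrite sumrN -opprD; congr (- _); rewrite exchange_big -big_split /=.
apply: eq_bigr => i _; rewrite -big_split /= (bigD1 i)//= big1 ?addr0.
  by rewrite addrC wedge_contr_anticomm eqxx scale1r.
move=> j ji; rewrite (partialC sf j i Pu) addrC wedge_contr_anticomm.
by rewrite eq_sym (negbTE ji) scale0r.
Qed.

Section iterates.
Variable T : form_distr R n.
(** The type [form_distr] carries no linearity; this is the one instance of additivity that moves
    the Laplacian onto the test function. *)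
Hypothesis Tlap : forall u, P u -> \sum_i T (partial i (partial i u)) = T (lap u).

(** Replace the inner d delta by - Lap - delta d; the second summand dies under the next delta. *)
Lemma extd_codiff_twice u : P u ->
  extd (codiff (extd (codiff T))) u = - extd (codiff T) (lap u).
Proof.
move=> Pu.
rewrite (@extd_ext _ (fun v => (-1) *: codiff T (iter 1 lap v)))//.
  by rewrite extd_lap// scaleN1r.
move=> v Pv.
rewrite (@codiff_ext _ (fun w => (-1) *: T (iter 1 lap w) - codiff (extd T) w))//.
  by rewrite codiff_sub codiff_codiff// subr0 codiff_lap.
move=> w Pw; rewrite /= -Tlap// scaleN1r -hodge_laplacian//.
by rewrite addrC addKr.
Qed.

Lemma codiff_extd_twice u : P u ->
  codiff (extd (codiff (extd T))) u = - codiff (extd T) (lap u).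
Proof.
move=> Pu.
rewrite (@codiff_ext _ (fun v => (-1) *: extd T (iter 1 lap v)))//.
  by rewrite codiff_lap// scaleN1r.
move=> v Pv.
rewrite (@extd_ext _ (fun w => (-1) *: T (iter 1 lap w) - extd (codiff T) w))//.
  by rewrite extd_sub extd_extd// subr0 extd_lap.
move=> w Pw; rewrite /= -Tlap// scaleN1r -hodge_laplacian//.
by rewrite addrK.
Qed.

Lemma iter_extd_codiff k u : P u ->
  iter k.+1 (extd \o codiff) T u = (-1) ^+ k *: extd (codiff T) (iter k lap u).
Proof.
elim: k u => [|k ih] u Pu; first by rewrite expr0 scale1r.
have Pk := tclass_iter_lap sf k Pu.
rewrite iterS /=.
rewrite (@extd_ext _ (fun v => (-1) ^+ k *: codiff (extd (codiff T)) (iter k lap v)))//.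
  by rewrite (@extd_lap (codiff (extd (codiff T))) _ k u Pu) extd_codiff_twice// scalerN exprS mulN1r scaleNr.
move=> v Pv.
rewrite (@codiff_ext _ (fun w => (-1) ^+ k *: extd (codiff T) (iter k lap w)))//.
by rewrite codiff_lap.
Qed.

Lemma iter_codiff_extd k u : P u ->
  iter k.+1 (codiff \o extd) T u = (-1) ^+ k *: codiff (extd T) (iter k lap u).
Proof.
elim: k u => [|k ih] u Pu; first by rewrite expr0 scale1r.
have Pk := tclass_iter_lap sf k Pu.
rewrite iterS /=.
rewrite (@codiff_ext _ (fun v => (-1) ^+ k *: extd (codiff (extd T)) (iter k lap v)))//.
  by rewrite (@codiff_lap (extd (codiff (extd T))) _ k u Pu) codiff_extd_twice// scalerN exprS mulN1r scaleNr.
move=> v Pv.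
rewrite (@extd_ext _ (fun w => (-1) ^+ k *: codiff (extd T) (iter k lap w)))//.
by rewrite extd_lap.
Qed.

End iterates.

(** Since beta_k = alpha_k - 2k, the operator is alpha_k times the sum of the two powers minus 2k (d
    delta)^k. The sum is a power of - Lap, and the remainder is a Hessian at 0. For k = 0 the factor
    2k removes the Hessian term, in agreement with the convention for L_0. *)
Lemma branson_gover_dirac p k (b : pform R n p) J :
  branson_gover p k (dirac_form b) f J = (-1) ^+ k *
    ((alpha R n p k)%:C * (iter k lap f 0 * vsval b J) -
     2 * k%:R * \sum_i \sum_j partial j (partial i (iter k.-1 lap f)) 0 *
       wedge i (contr j (vsval b)) J).
Proof.
have Pf := tclass_self f.
have Tlap u : P u -> \sum_i dirac_form b (partial i (partial i u)) = dirac_form b (lap u).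
  by move=> _; rewrite /dirac_form /lap scaler_suml.
case: k => [|k].
  by rewrite /branson_gover expr0 mul1r mulr0 mul0r subr0 !ext_scaleE.
rewrite /branson_gover iter_codiff_extd// iter_extd_codiff//.
have Pk := tclass_iter_lap sf k Pf; set u := iter k lap f in Pk *.
have -> : codiff (extd (dirac_form b)) u = - dirac_form b (lap u) - extd (codiff (dirac_form b)) u.
  by rewrite -Tlap// -hodge_laplacian// addrK.
have DJ : extd (codiff (dirac_form b)) u J = - \sum_i \sum_j partial j (partial i u) 0 *
       wedge i (contr j (vsval b)) J.
  rewrite extd_codiffE ffunE ext_sumE; congr (- _); apply: eq_bigr => i _.
  rewrite ext_sumE; apply: eq_bigr => j _.
  by rewrite /dirac_form linearZ /= linearZ /= ext_scaleE.
set D := extd _ u in DJ *; set X := \sum_i _ in DJ *.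
have TJ : dirac_form b (lap u) J = iter k.+1 lap f 0 * vsval b J.
  by rewrite /dirac_form ext_scaleE iterS.
have NJ (A B : ext R n) : (- A - B) J = - A J - B J by rewrite !ffunE.
rewrite [LHS]ffunE !ext_scaleE NJ TJ DJ exprS.
have -> : (beta R n p k.+1)%:C = (alpha R n p k.+1)%:C - 2 * k.+1%:R.
  have -> : 2 * k.+1%:R = (2 * k.+1%:R : R)%:C by rewrite rmorphM !rmorph_nat.
  by rewrite -rmorphB; congr (_%:C); rewrite /alpha /beta; ring.
by ring.
Qed.

End differential_operators.

(** * The residue *)

Section kernel.
Context {R : realType} {n : nat}.
Implicit Types (x : 'rV[R]_n).

Lemma cpower_real (r l : R) : cpower r l%:C = (r `^ l)%:C.
Proof. by rewrite /cpower /= mul0r cos0 sin0 mulr1. Qed.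

(** At the origin [powR] is 1 for exponent 0, while [rpow] is 0; hence the exclusion, which becomes
    [l != 2] for the kernel. *)
Lemma rnorm_powR (l : R) x : l != 0 -> rnorm x `^ l = rpow l x.
Proof.
move=> l0; rewrite rnormE /rpow; have := sqn_ge0 x.
rewrite le_eqVlt => /predU1P[<-|x0].
  by rewrite sqrtr0 powR0// rho0.
by rewrite rhoE// -powR12_sqrt ?(ltW x0)// -powRrM mulrC.
Qed.

Variable f : cfun R n.
Hypotheses (sf : schwartz f) (n0 : (0 < n)%N).
Variables (p : nat) (b : pform R n p) (J : {set 'I_n}).
Local Notation P := (tclass f).
Local Notation w := (vsval b).
Local Notation c i j := (wedge i (contr j w) J).

Lemma integral_kernelE (l : R) : l != 2 ->
  integral_Rn (fun x => f x * Rkernel l%:C x w J) =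
  MC (l - 2) (fun x => w J * (\sum_i coordM i (coordM i f) x) +
    (- 2) * \sum_i \sum_j c i j * coordM i (coordM j f) x).
Proof.
move=> l2; rewrite /integral_Rn /MC.
have E x : f x * Rkernel l%:C x w J = (rpow (l - 2) x)%:C *
    (w J * (\sum_i coordM i (coordM i f) x) +
    (- 2) * \sum_i \sum_j c i j * coordM i (coordM j f) x).
  rewrite /Rkernel ext_scaleE symbol_kernel.
  have -> : l%:C - 2 = (l - 2)%:C by rewrite rmorphB rmorph_nat.
  rewrite cpower_real rnorm_powR ?subr_eq0//.
  have -> : \sum_i coordM i (coordM i f) x = (sqn x)%:C * f x.
    rewrite /coordM /sqn raddf_sum /= mulr_suml; apply: eq_bigr => i _.
    by rewrite mulrA -rmorphM -expr2.
  rewrite mulrCA; congr (_ * _); rewrite mulrBr mulNr; congr (_ - _); first by ring.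
  rewrite mulrCA; congr (_ * _); rewrite mulr_sumr; apply: eq_bigr => i _.
  by rewrite mulr_sumr; apply: eq_bigr => j _; rewrite /coordM; ring.
by apply: complex_eq => /=; apply: eq_Rintegral => t _; rewrite /reP /imP E
  ((realCE _ _).1, (realCE _ _).2).
Qed.

(** [kernel_lead] and [kernel_rest] are the U and V of the overview, in the component J. The term
    with 2p in V is the Kronecker part of d_i (x_j f), summed by the degree operator. *)
Definition kernel_lead : cfun R n := fun x => w J * f x.
Definition kernel_rest : cfun R n := fun x => (2 * p%:R * w J) * f x +
  2 * \sum_i \sum_j c i j * coordM j (partial i f) x.

Lemma tclass_kernel_lead : P kernel_lead.
Proof. by apply: tclassZ => //; exact: tclass_self. Qed.

Lemma tclass_kernel_rest : P kernel_rest.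
Proof.
have Pf := tclass_self f.
apply: tclassD; first exact: tclassZ.
apply: tclassZ; apply: tclass_sum => i; apply: tclass_sum => j.
by apply: tclassZ; apply: tc_coordM; exact: tclass_partial.
Qed.

(* As [l x_i r^(l-2)] is the [i]-th partial derivative of [r^l], one integration
   by parts replaces [r^(l-2)] by [r^l]. *)
Lemma integral_kernel (l : R) : 4 < l ->
  l%:C * integral_Rn (fun x => f x * Rkernel l%:C x w J) =
  l%:C * MC l kernel_lead + MC l kernel_rest.
Proof.
move=> l4; have Pf := tclass_self f; have nR : 0 <= n%:R :> R by [].
have nl : - n%:R < l by lra.
have nl2 : - n%:R < l - 2 by lra.
have Pc i j : P (coordM i (coordM j f)) by do 2 apply: tc_coordM.
have Pd i j : P (coordM j (partial i f)) by apply: tc_coordM; exact: tclass_partial.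
have S1 := fun i => tclass_sum (index_enum 'I_n) (fun j => tclassZ (c i j) (Pc i j)).
have S2 := fun i => tclass_sum (index_enum 'I_n) (fun j => tclassZ (c i j) (Pd i j)).
have T1 := tclass_sum (index_enum 'I_n) S1.
have T2 := tclass_sum (index_enum 'I_n) S2.
have T0 := tclass_sum (index_enum 'I_n) (fun i => Pc i i).
rewrite integral_kernelE; last by rewrite gt_eqF//; lra.
rewrite (MCD sf n0 nl2 (tclassZ _ T0) (tclassZ _ T1)).
rewrite (MCZ sf n0 _ nl2 T0) (MCZ sf n0 _ nl2 T1) MC_sqn.
rewrite (MC_sum sf n0 _ nl2 S1).
rewrite /kernel_rest (MCD sf n0 nl (tclassZ _ Pf) (tclassZ _ T2)).
rewrite (MCZ sf n0 _ nl Pf) (MCZ sf n0 _ nl T2) (MC_sum sf n0 _ nl S2).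
rewrite /kernel_lead (MCZ sf n0 _ nl Pf).
rewrite mulrDr; congr (_ + _).
have E i j : l%:C * MC (l - 2) (fun x => c i j * coordM i (coordM j f) x) =
    - (c i j * ((i == j)%:R * MC l f + MC l (coordM j (partial i f)))).
  rewrite (MCZ sf n0 _ nl2 (Pc i j)) mulrCA -[in RHS]mulrN; congr (_ * _).
  apply: oppr_inj; rewrite opprK -mulNr -(MC_by_parts sf i l4 (tc_coordM j Pf)).
  by rewrite partial_coordM ?(MC_lin2 sf n0)//; exact: (tclass_derivable sf).
have -> : l%:C * (- 2 * \sum_i MC (l - 2) (fun x => \sum_j c i j * coordM i (coordM j f) x)) =
   2 * (\sum_i (c i i * MC l f + \sum_j c i j * MC l (coordM j (partial i f)))).
  rewrite mulrCA mulNr -mulrN; congr (_ * _); rewrite mulr_sumr -sumrN.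
  apply: eq_bigr => i _.
  rewrite (MC_sum sf n0 _ nl2 (fun j => tclassZ (c i j) (Pc i j))) mulr_sumr.
  rewrite (eq_bigr _ (fun j _ => E i j)) sumrN opprK.
  rewrite (eq_bigr (fun j => c i j * (i == j)%:R * MC l f + c i j * MC l (coordM j (partial i f)))); last first.
    by move=> j _; rewrite mulrDr mulrA.
  rewrite big_split /= (bigD1 i)//= eqxx mulr1 [X in _ + X + _]big1 ?addr0//.
  by move=> j; rewrite eq_sym => /negbTE ->; rewrite mulr0 mul0r.
rewrite big_split /= -mulr_suml sum_wedge_contr_pform mulrDr !mulrA; congr (_ + _ * _).
apply: eq_bigr => i _.
rewrite (MC_sum sf n0 _ nl (fun j => tclassZ (c i j) (Pd i j))).
by apply: eq_bigr => j _; rewrite (MCZ sf n0 _ nl (Pd i j)).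
Qed.

End kernel.

(** * Real and imaginary parts along the real line *)

Section real_trace.
Context {R : realType}.
Implicit Types (g : R[i] -> R[i]) (a : nat -> R[i]).

Lemma norm_realC (y : R) : `|y%:C| = `|y|%:C.
Proof. by rewrite normc_def /= expr0n addr0 sqrtr_sqr. Qed.

Lemma cvg_realC (phi : R[i] -> R) (u : nat -> R[i]) (z : R[i]) :
  (forall v w, phi v - phi w = phi (v - w)) -> (forall v, `|phi v| <= Normc.normc v) ->
  (u : nat -> R[i]^o) @ \oo --> (z : R[i]^o) -> phi (u m) @[m --> \oo] --> phi z.
Proof.
move=> phiB le_phi uz; apply/cvgrPdist_lt => e e0.
have e0' : 0 < e%:C by rewrite ltcR.
move/cvgrPdist_lt: uz => /(_ _ e0'); apply: filterS => m /=.
rewrite normc_def ltcR => ue; rewrite phiB; apply: le_lt_trans ue.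
by have := le_phi (z - u m); case: (z - u m).
Qed.

(** [phi] stands for the real or the imaginary part. Being real-linear and 1-Lipschitz, it commutes
    with the partial sums at real points and with their limit. *)
Lemma laurent_real (phi : R[i] -> R) g (c : R) N a :
  (forall v w, phi v - phi w = phi (v - w)) -> (forall v, `|phi v| <= Normc.normc v) ->
  (forall (x : R) v, phi (x%:C * v) = x * phi v) ->
  laurent_at g c%:C N a -> laurent_coef (fun x => phi (g x%:C)) c N (phi \o a).
Proof.
move=> phiB le_phi phiZ [e [e0 H]].
have phi0 : phi 0 = 0 by rewrite -[0]subr0 -phiB subrr.
have phiD v w : phi (v + w) = phi v + phi w.
  by rewrite -{1}[w]opprK -phiB -[- w]sub0r -phiB phi0 sub0r opprK.
(* In the order of [R[i]], a positive element has imaginary part 0. *)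
have eE : e = (complex.Re e)%:C by move: e0; case: (e) => x y /andP[/eqP /= ->].
exists (complex.Re e) => [|y ye]; first by move: e0; rewrite eE ltcR.
have := H (c + y)%:C.
have -> : (c + y)%:C - c%:C = y%:C by rewrite -rmorphB addrAC subrr add0r.
rewrite norm_realC {1}eE !ltcR => /(_ ye) /(cvg_realC phiB le_phi).
rewrite -rmorphXn phiZ.
have -> : series (fun m => (phi \o a) m * y ^+ m) =
    (fun K => phi (series (fun m => a m * y%:C ^+ m) K)).
  apply/funext => K; rewrite /series /= (big_morph phi phiD phi0).
  by apply: eq_bigr => m _; rewrite -rmorphXn mulrC -phiZ mulrC.
exact.
Qed.

Lemma laurent_Re g (c : R) N a : laurent_at g c%:C N a ->
  laurent_coef (fun x => complex.Re (g x%:C)) c N (fun m => complex.Re (a m)).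
Proof.
apply: laurent_real => [[v1 v2] [w1 w2]//||x v]; first exact: norm_Re_le.
exact: (realCE x v).1.
Qed.

Lemma laurent_Im g (c : R) N a : laurent_at g c%:C N a ->
  laurent_coef (fun x => complex.Im (g x%:C)) c N (fun m => complex.Im (a m)).
Proof.
apply: laurent_real => [[v1 v2] [w1 w2]//||x v]; first exact: norm_Im_le.
exact: (realCE x v).2.
Qed.

Lemma holomorphic_laurent g c : holomorphic_at g c -> exists a, laurent_at g c 0 a.
Proof.
move=> [a [e [e0 H]]]; exists a, e; split => // z /andP[_ ze].
by rewrite expr0 mul1r; exact: H.
Qed.

End real_trace.

(** * Passing to the limit in the functional equation, and the constant *)

Section residue.
Context {R : realType} {n k : nat}.
Hypothesis n0 : (0 < n)%N.
Local Notation lapf := (@lapfactor R n).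
Local Notation c := (- (n%:R + 2 * k%:R) : R).

Lemma mero_lapfactor (g : R -> R) x : mero g x -> mero (fun l => lapf k l * g l) x.
Proof.
move=> mg; elim: k => [|j ih].
  by congr (mero _ x): mg; apply/funext => l; rewrite /lapfactor big_ord0 mul1r.
have -> : (fun l => lapf j.+1 l * g l) =
    (fun l => (l + (2 * j%:R + 2)) * ((l + (2 * j%:R + n%:R)) * (lapf j l * g l))).
  by apply/funext => l; rewrite /lapfactor big_ord_recr /=; ring.
by do 2 apply: mero_linear.
Qed.

Lemma cvg_lapfactor (u : nat -> R) (l : R) : u @ \oo --> l ->
  lapf k (u m) @[m --> \oo] --> lapf k l.
Proof.
move=> ul; elim: k => [|j ih].
  rewrite /lapfactor big_ord0; under eq_cvg => m do rewrite big_ord0.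
  exact: cvg_cst.
rewrite /lapfactor big_ord_recr /=; under eq_cvg => m do rewrite big_ord_recr /=.
apply: cvgM => //; apply: cvgM; do ?(apply: cvgD => //); exact: cvg_cst.
Qed.

Lemma mero_Mint (g : 'rV[R]_n -> R) x : good g -> c < x ->
  mero (fun l => Mint (l + 2 * k%:R) g) x.
Proof.
move=> gg cx; have nx : - n%:R < x + 2 * k%:R by lra.
have [a [e e0 H]] := Mint_analytic n0 nx gg.
apply: (mero_power_series (a := a) e0) => y /H.
by rewrite [x + y + _]addrAC.
Qed.

(* Both sides of the equation are meromorphic on [l > c], so it persists near [c];
   multiply it by [l - c] and let [l] decrease to [c]. *)
Lemma residue_of_functional_equation (g : R -> R) (U V : 'rV[R]_n -> R) (a : nat -> R) :
  good U -> good V -> (forall l, c < l -> mero g l) -> laurent_coef g c 1 a ->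
  (forall l, 4 < l ->
    l * (lapf k l * g l) = l * Mint (l + 2 * k%:R) U + Mint (l + 2 * k%:R) V) ->
  c * (lapf k c * a 0%N) = sphere_area n * (c * U 0 + V 0).
Proof.
move=> gU gV mg ga E.
pose h l := l * (lapf k l * g l) +
  (-1) * (l * Mint (l + 2 * k%:R) U + Mint (l + 2 * k%:R) V).
have mh x : c < x -> mero h x.
  move=> cx; apply: meroD; first by apply/mero_mulX/mero_lapfactor/mg.
  by apply/meroZ/meroD; [apply: mero_mulX|]; exact: mero_Mint.
have hz x : 4 < x -> h x = 0 by move=> x4; rewrite /h E// mulN1r subrr.
(* [mero_identity] says nothing about [h] at the point itself, so the zero is taken at a small
   offset [d] from c + r/2; the choice d <= r/4 keeps it within distance r of c. *)
have /(_ _)/cid-/all_sig[y Hy] (m : nat) : exists y : R, [/\ 0 < y, y < m.+1%:R^-1 & h (c + y) = 0].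
  pose r : R := m.+1%:R^-1; have r0 : 0 < r by rewrite invr_gt0 ltr0n.
  have cx : c < c + r / 2 by rewrite ltrDl divr_gt0.
  have [e e0 He] := mero_identity mh hz cx.
  pose d := Num.min (e / 2) (r / 4).
  have d0 : 0 < d by rewrite lt_min !divr_gt0.
  have d1 : d <= e / 2 by rewrite ge_min lexx.
  have d2 : d <= r / 4 by rewrite ge_min lexx orbT.
  exists (r / 2 + d); rewrite addrA He ?gtr0_norm ?d0//=; last by lra.
  by split => //; rewrite -?/r; lra.
have y0 m : 0 < y m by have [] := Hy m.
have yc : y @ \oo --> (0 : R).
  apply: (@squeeze_cvgr _ _ _ _ (fun=> 0) (fun m => m.+1%:R^-1)).
  - by near=> m; have [y1 y2 _] := Hy m; rewrite (ltW y1) (ltW y2).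
  - exact: cvg_cst.
  - exact: cvg_harmonic.
have cyc : c + y m @[m --> \oo] --> c.
  by rewrite -[X in _ --> X]addr0; apply: cvgD => //; exact: cvg_cst.
pose s m := c + y m + 2 * k%:R.
have sE m : s m + n%:R = y m by rewrite /s; ring.
(* Negativity holds because y m < 1/(m+1) <= 1 <= n. *)
have s1 m : - n%:R < s m < 0.
  have [y1 y2 _] := Hy m; have : m.+1%:R^-1 <= 1 :> R by rewrite invf_le1// ler1n.
  have : 1 <= n%:R :> R by rewrite ler1n.
  move=> n1 m1; rewrite -subr_gt0 opprK sE y1 -(ltrD2r n%:R) sE add0r.
  exact: lt_le_trans y2 (le_trans m1 n1).
have sc : s @ \oo --> (- n%:R : R).
  have -> : s = (fun m => - n%:R + y m) by apply/funext => m; rewrite -sE addrCA addNr addr0.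
  by rewrite -[X in _ --> X]addr0; apply: cvgD => //; exact: cvg_cst.
have cU := Mint_cvg n0 s1 sc gU; have cV := Mint_cvg n0 s1 sc gV.
have cg := laurent_simple_pole ga y0 yc.
have L : (c + y m) * (lapf k (c + y m) * (y m * g (c + y m))) @[m --> \oo] -->
    c * (lapf k c * a 0%N).
  by apply: cvgM => //; apply: cvgM => //; exact: cvg_lapfactor.
have Rg : (c + y m) * ((s m + n%:R) * Mint (s m) U) + (s m + n%:R) * Mint (s m) V
    @[m --> \oo] --> c * (sphere_area n * U 0) + sphere_area n * V 0.
  by apply: cvgD => //; apply: cvgM.
have -> : sphere_area n * (c * U 0 + V 0) =
  c * (sphere_area n * U 0) + sphere_area n * V 0 by ring.
apply: norm_cvg_unique L _.
have -> : (fun m => (c + y m) * (lapf k (c + y m) * (y m * g (c + y m)))) =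
  (fun m => (c + y m) * ((s m + n%:R) * Mint (s m) U) + (s m + n%:R) * Mint (s m) V).
  apply/funext => m; have [_ _] := Hy m; rewrite /h sE mulN1r => /subr0_eq H.
  transitivity (y m * ((c + y m) * (lapf k (c + y m) * g (c + y m)))); first by ring.
  by rewrite H -/(s m); ring.
exact: Rg.
Unshelve. all: by end_near. Qed.

(** At l = -n-2k the factors of [lapfactor], read in reverse order, are 4 (i+1) (n/2+i) for i < k.
    They contribute 4^k k! and the product of the n/2 + i, which the functional equation of Gamma
    converts into the quotient of the two Gamma values. *)
Lemma residue_constant :
  sphere_area n = 2 * pi `^ (n%:R / 2) /
    (4 ^+ k * k`!%:R * Gamma (n%:R / 2 + k%:R + 1)) * ((n%:R / 2 + k%:R) * lapf k c).
Proof.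
set q := n%:R / 2 : R; have q0 : 0 < q by rewrite divr_gt0// ltr0n.
have E j : lapf j (- (n%:R + 2 * j%:R)) =
    4 ^+ j * j`!%:R * \prod_(i < j) (q + i%:R).
  rewrite /lapfactor (reindex_inj rev_ord_inj) /=.
  transitivity (\prod_(i < j) (4 * i.+1%:R * (q + i%:R))).
    apply: eq_bigr => i _; rewrite natrB ?ltn_ord// -[i.+1%:R]natr1.
    have -> : n%:R = 2 * q by rewrite /q mulrC divfK.
    by ring.
  rewrite !big_split /= prodr_const card_ord; congr (_ * _ * _).
  rewrite fact_prod natr_prod big_add1 /= big_mkord.
  by [].
(* The quotient of Gamma values is the product of q + i for 1 <= i <= j. The extra q on the left
   supplies i = 0, and the last factor on the right is i = j. *)
have G j : Gamma (q + j%:R + 1) * q = Gamma (q + 1) * \prod_(i < j) (q + i%:R) * (q + j%:R).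
  elim: j => [|j ih]; first by rewrite big_ord0 addr0 mulr1.
  rewrite big_ord_recr /= -[j.+1%:R]natr1 addrA GammaS; last first.
    by have : 0 <= j%:R :> R by []; lra.
  by rewrite -mulrA ih; ring.
have gk : 0 < Gamma (q + k%:R + 1).
  by apply: Gamma_gt0; have : 0 <= k%:R :> R by []; lra.
have g0 : 0 < Gamma (q + 1) by exact: Gamma_gt0.
have f0 : k`!%:R != 0 :> R by rewrite pnatr_eq0 -lt0n fact_gt0.
rewrite E /sphere_area -/q; have -> : n%:R = 2 * q by rewrite /q mulrC divfK.
have f4 : 4 ^+ k != 0 :> R by rewrite expf_neq0.
apply: (mulIf (lt0r_neq0 gk)); apply: (mulIf (lt0r_neq0 g0)).
transitivity (2 * pi `^ q * (Gamma (q + k%:R + 1) * q)).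
  by field; rewrite gt_eqF.
rewrite G; field.
by rewrite f0 f4 gt_eqF.
Qed.

End residue.

(** * Comparison with the Branson-Gover operator at the origin *)

Section value_at_origin.
Context {R : realType} {n : nat}.
Variable f : cfun R n.
Hypothesis sf : schwartz f.
Local Notation P := (tclass f).

Lemma iter_lapD k u v : P u -> P v ->
  iter k lap (fun x => u x + v x) = (fun x => iter k lap u x + iter k lap v x).
Proof.
by move=> Pu Pv; elim: k => //= k ->; rewrite (lapD sf)//; exact: tclass_iter_lap.
Qed.

Lemma iter_lap_sum k (I : Type) (s : seq I) (F : I -> cfun R n) : (forall i, P (F i)) ->
  iter k lap (fun x => \sum_(i <- s) F i x) = (fun x => \sum_(i <- s) iter k lap (F i) x).
Proof.
move=> PF; have P0 : P (fun=> 0) by exact: tclass0.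
elim: s => [|i s ih].
  have -> : (fun x => \sum_(i <- [::]) F i x) = (fun x => 0 * 0) :> cfun R n.
    by apply/funext => x; rewrite big_nil mul0r.
  by rewrite (iter_lapZ sf)//; apply/funext => x; rewrite big_nil mul0r.
have -> : (fun x => \sum_(j <- i :: s) F j x) = (fun x => F i x + \sum_(j <- s) F j x).
  by apply/funext => x; rewrite big_cons.
by rewrite iter_lapD ?ih//; [apply/funext => x; rewrite big_cons|exact: tclass_sum].
Qed.

Variables (p k : nat) (b : pform R n p) (J : {set 'I_n}).
Local Notation w := (vsval b).
Local Notation c i j := (wedge i (contr j w) J).

(** At the origin each x_j d_i f contributes only the commutator term 2k d_j d_i Lap^(k-1) f, and
    the coefficients of Lap^k f add up to -(n+2k) + 2p = -2 alpha_k. This is -2 times the expression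
    found for the Dirac form. *)
Lemma iter_lap_kernel :
  (- (n%:R + 2 * k%:R))%:C * iter k lap (kernel_lead f b J) 0 +
    iter k lap (kernel_rest f b J) 0 =
  - 2 * ((-1) ^+ k * branson_gover p k (dirac_form b) f J).
Proof.
have Pf := tclass_self f.
have Pd i j : P (coordM j (partial i f)) by apply: tc_coordM; exact: tclass_partial.
have S2 := fun i => tclass_sum (index_enum 'I_n) (fun j => tclassZ (c i j) (Pd i j)).
have T2 := tclass_sum (index_enum 'I_n) S2.
rewrite (branson_gover_dirac sf) [(-1) ^+ k * _]mulrA -exprMn mulrNN mulr1 expr1n mul1r.
rewrite /kernel_lead (iter_lapZ sf)// /kernel_rest iter_lapD; last 2 first.
- exact: tclassZ.
- exact: tclassZ.
rewrite !(iter_lapZ sf)// iter_lap_sum//.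
have -> : \sum_i iter k lap (fun x => \sum_j c i j * coordM j (partial i f) x) 0 =
    2 * k%:R * \sum_i \sum_j partial j (partial i (iter k.-1 lap f)) 0 * c i j.
  rewrite mulr_sumr; apply: eq_bigr => i _.
  rewrite iter_lap_sum; last by move=> j; exact: tclassZ.
  rewrite mulr_sumr; apply: eq_bigr => j _.
  rewrite (iter_lapZ sf)// (iter_lap_coordM sf); last exact: tclass_partial.
  by rewrite !(iter_lap_partial sf)// /coordM mxE mul0r add0r; ring.
have -> : (- (n%:R + 2 * k%:R))%:C = - 2 * (alpha R n p k)%:C - 2 * p%:R.
  rewrite (_ : - _ = - 2 * alpha R n p k - 2 * p%:R); last by rewrite /alpha; field.
  by rewrite rmorphB !rmorphM rmorphN !rmorph_nat.
by ring.
Qed.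

End value_at_origin.

Theorem corollary4p4 (R : realType) (n p k : nat) (n_gt0 : (0 < n)%N)
    (p_le_n : (p <= n)%N) (F : R[i] -> end_distr R n p)
    (HF : Rlambda_extension F)
    (f : cfun R n) (Hf : schwartz f) (b : pform R n p) (J : {set 'I_n}) :
  is_residue (fun l => apply_distr (F l) b f J) (pole_point R n k)
    (((-1) ^+ k * 2 * pi `^ (n%:R / 2) /
        (4 ^+ k * k`!%:R * Gamma (n%:R / 2 + k%:R + 1)))%:C *
     branson_gover p k (dirac_form b) f J).
Proof.
have [_ HG /(_ f b J Hf) [holoG poleG]] := HF.
set G := fun l => apply_distr (F l) b f J in holoG poleG *.
have poleE j : pole_point R n j = (- (n%:R + 2 * j%:R))%:C.
  by rewrite /pole_point rmorphN rmorphD rmorphM !rmorph_nat.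
set c : R := - (n%:R + 2 * k%:R).
(* Regular points and poles are treated alike, so that the functional equation can pass the poles
   lying between 4 and c. *)
have LG (l : R) : exists N a, laurent_at G l%:C N a.
  have [[j lj]|nl] := pselect (exists j, l%:C = pole_point R n j).
    by exists 1%N; rewrite lj; exact: poleG.
  exists 0%N; apply: holomorphic_laurent; apply: holoG => j lj.
  by apply: nl; exists j.
(* With a pole of order at most 1, [N] is 0 in [is_residue], and the residue is the coefficient
   [a 0]. *)
have [a ha] := poleG k; exists 0%N, a; split => //.
rewrite poleE -/c in ha.
set U := kernel_lead f b J; set V := kernel_rest f b J.
have PU : tclass f (iter k lap U) by apply: tclass_iter_lap => //; exact: tclass_kernel_lead.
have PV : tclass f (iter k lap V) by apply: tclass_iter_lap => //; exact: tclass_kernel_rest.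
have [rU iU _] := tclass_regular Hf PU; have [rV iV _] := tclass_regular Hf PV.
have E l : 4 < l -> l%:C * ((@lapfactor R n k l)%:C * G l%:C) =
    l%:C * MC (l + 2 * k%:R) (iter k lap U) + MC (l + 2 * k%:R) (iter k lap V).
  move=> l4; have nR : 0 <= n%:R :> R by [].
  have GE : G l%:C = integral_Rn (fun x => f x * Rkernel l%:C x (vsval b) J).
    by apply: HG => //=; lra.
  rewrite !(MC_iter_lap Hf n_gt0)//; last 2 first.
  - exact: tclass_kernel_rest.
  - exact: tclass_kernel_lead.
  rewrite mulrCA GE (integral_kernel Hf n_gt0)//.
  by rewrite mulrDr mulrCA.
have Z := iter_lap_kernel Hf k b J.
set BG := branson_gover p k (dirac_form b) f J in Z *.
pose K : R := 2 * pi `^ (n%:R / 2) / (4 ^+ k * k`!%:R * Gamma (n%:R / 2 + k%:R + 1)).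
pose m : R := (n%:R / 2 + k%:R) * @lapfactor R n k c.
have SK : sphere_area n = K * m by exact: residue_constant.
have m0 : m != 0.
  have : sphere_area n != 0 :> R.
    rewrite mulf_neq0 ?invr_neq0 ?mulf_neq0 ?pnatr_eq0 -?lt0n//.
      by rewrite gt_eqF// powR_gt0// pi_gt0.
    by rewrite gt_eqF// Gamma_gt0// divr_gt0// ltr0n.
  by rewrite SK mulf_eq0 => /norP[].
(* As c = -2 (n/2 + k), the left side is -2 m r, while the sphere area is K m; the nonzero factor -2
   m cancels. *)
have solve (r v : R) : c * (@lapfactor R n k c * r) = sphere_area n * (-2 * v) -> r = K * v.
  move=> Er; apply: (mulfI m0); apply: (mulfI (_ : -2 != 0 :> R)); first by rewrite oppr_eq0.
  transitivity (c * (@lapfactor R n k c * r)); first by rewrite /m /c; field.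
  by rewrite Er SK; ring.
have EBG : (((-1) ^+ k * 2 * pi `^ (n%:R / 2) /
    (4 ^+ k * k`!%:R * Gamma (n%:R / 2 + k%:R + 1)))%:C * BG) = K%:C * ((-1) ^+ k * BG).
  rewrite mulrA; congr (_ * _).
  have -> : (-1) ^+ k = ((-1) ^+ k)%:C :> R[i] by rewrite rmorphXn rmorphN rmorph1.
  by rewrite -rmorphM; congr (_%:C); rewrite /K; ring.
rewrite EBG; move: ((-1) ^+ k * BG) Z => B Z.
have MM (l : R) N a' : laurent_at G l%:C N a' ->
    mero (fun x => complex.Re (G x%:C)) l /\ mero (fun x => complex.Im (G x%:C)) l.
  by move=> H; split; do 2 eexists; [exact: laurent_Re H|exact: laurent_Im H].
have ReE (x : R) (u v : R[i]) : complex.Re (x%:C * u + v) = x * complex.Re u + complex.Re v.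
  by rewrite cReD (realCE _ _).1.
have ImE (x : R) (u v : R[i]) : complex.Im (x%:C * u + v) = x * complex.Im u + complex.Im v.
  by rewrite cImD (realCE _ _).2.
have N2 : -2 = (-2)%:C :> R[i] by rewrite rmorphN rmorph_nat.
(* All coefficients in the functional equation are real, so it splits into one real equation for
   each part of the residue. *)
apply: complex_eq; rewrite ((realCE _ _).1, (realCE _ _).2); apply: solve.
- rewrite -(realCE (-2) B).1 -N2 -Z ReE.
  apply: (residue_of_functional_equation n_gt0 rU rV _ (laurent_Re ha)) => l.
    by have [N [a' H]] := LG l; have [] := MM _ _ _ H.
  by move=> /E/(congr1 (@complex.Re R)); rewrite ReE !(realCE _ _).1.
- rewrite -(realCE (-2) B).2 -N2 -Z ImE.
  apply: (residue_of_functional_equation n_gt0 iU iV _ (laurent_Im ha)) => l.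
    by have [N [a' H]] := LG l; have [] := MM _ _ _ H.
  by move=> /E/(congr1 (@complex.Im R)); rewrite ImE !(realCE _ _).2.
Qed.
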